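(* Let $\alpha>0$. For $n_1$ even let $n_2=\lfloor\alpha n_1/2\rfloor$. For $j\ge1$ let $U_j$ denote the number of connected components with exactly $j$ vertices in a random multigraph drawn from $\mathcal{MG}_{n_1,n_2}$ according to the configuration model. Then, as $n_1\to\infty$ along the even integers, for every $j\ge2$, \[ \mathbb{E}[U_j]\sim\frac{\alpha^{j-2}}{(1+\alpha)^{j-1}}\frac{n_1}{2}\qquad\text{and}\qquad\operatorname{Var}(U_j)=O\!\left(\frac{n_1}{2}\right), \] and \[ \mathbb{E}[U_1]\sim\frac12\,\frac{\alpha}{1+\alpha}\qquad\text{and}\qquad\operatorname{Var}(U_1)\sim\frac12\,\frac{\alpha}{1+\alpha}. \] Furthermore, for any integer $q\ge2$, as $n_1\to\infty$ along the even integers, the vector \[ \frac{1}{\sqrt{n_1/2}}\left(U_j-\frac{\alpha^{j-2}}{(1+\alpha)^{j-1}}\frac{n_1}{2}\right)_{2\le j\le q} \] converges in distribution to a multivariate Gaussian $\mathcal{N}(\mathbf{0},\mathcal{H}(\alpha))$, where \[ \mathcal{H}_{i,j}(\alpha)=-\frac{\alpha^{i+j-4}}{(1+\alpha)^{i+j-2}}\left(1+\frac{(i-2-\alpha)(j-2-\alpha)}{\alpha(1+\alpha)}\right)+\frac{\mathbb{1}_{i=j}}{1+\alpha}\left(\frac{\alpha}{1+\alpha}\right)^{i-2}\quad(2\le i,j\le q) \] is positive semi-definite, and $U_1$ converges in distribution to a Poisson random variable with parameter $\frac12\frac{\alpha}{1+\alpha}$.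
   Context: $\mathcal{MG}_{n_1,n_2}$ is the set of vertex-labelled multigraphs (loops and multiple edges allowed; a loop contributes $2$ to the degree) on vertex set $\{1,\dots,n_1+n_2\}$ with exactly $n_1$ vertices of degree $1$ and $n_2$ vertices of degree $2$. For a multigraph $G$ on $[n]$ with $m$ edges, $\operatorname{seqv}(G)$ is the number of sequences $(v_1,w_1,\dots,v_m,w_m)\in[n]^{2m}$ such that the multiset of edges $\{\{v_i,w_i\}:1\le i\le m\}$ equals the edge multiset of $G$, and the compensation factor is $\kappa(G)=\operatorname{seqv}(G)/(2^m m!)$. The configuration model distribution on $\mathcal{MG}_{n_1,n_2}$ assigns to each $G$ probability proportional to $\kappa(G)$ (equivalently, the law induced by a uniform random perfect matching of half-edges with the prescribed degrees). The size of a component is its number of vertices. $\mathbb{1}_{i=j}$ is $1$ if $i=j$ and $0$ otherwise. *)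

(* Defs.v *)
From HB Require Import structures.
From mathcomp Require Import all_boot all_order all_algebra.
From mathcomp Require Import all_classical all_reals all_analysis.
Set Implicit Arguments. Unset Strict Implicit. Unset Printing Implicit Defensive.
Import Order.TTheory GRing.Theory Num.Theory.
Import numFieldNormedType.Exports.
Local Open Scope ring_scope.

(* A multigraph on vertex set 'I_n (= {1..n}) is encoded by its symmetric
   multiplicity function: G (v,w) = number of edges {v,w} (for v = w, the
   number of loops at v).  Since every multigraph of MG_{n1,n2} has maximum
   degree 2, all multiplicities are <= 2, so values in 'I_3 suffice and this
   encoding is a bijection onto MG_{n1,n2}. *)
Definition mgraph (n : nat) := {ffun 'I_n * 'I_n -> 'I_3}.

Definition msym n (G : mgraph n) : bool := [forall v, forall w, G (v, w) == G (w, v)].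

(* a loop contributes 2 to the degree *)
Definition mdeg n (G : mgraph n) (v : 'I_n) : nat :=
  (\sum_(w < n) G (v, w) + G (v, v))%N.

Definition nedges n (G : mgraph n) : nat := (\sum_(v < n) mdeg G v)./2.

Definition inMG (n1 n2 : nat) (G : mgraph (n1 + n2)) : bool :=
  [&& msym G, #|[set v | mdeg G v == 1%N]| == n1 & #|[set v | mdeg G v == 2%N]| == n2].

(* seqv G : number of sequences (v_1,w_1,...,v_m,w_m) in [n]^{2m} whose edge
   multiset {{v_i,w_i}} equals the edge multiset of G *)
Definition seqv n (G : mgraph n) : nat :=
  #|[set s : {ffun 'I_(nedges G) -> 'I_n * 'I_n} |
      [forall v, forall w,
        #|[set i | (s i == (v, w)) || (s i == (w, v))]| == (G (v, w) : nat)]]|.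

Definition kappa {R : realType} n (G : mgraph n) : R :=
  (seqv G)%:R / (2 ^ nedges G * (nedges G)`!)%:R.

Definition CMexp {R : realType} (n1 n2 : nat) (X : mgraph (n1 + n2) -> R) : R :=
  (\sum_(G | @inMG n1 n2 G) kappa G * X G) / (\sum_(G | @inMG n1 n2 G) kappa G).

Arguments CMexp {R} n1 n2 X.

Definition CMvar {R : realType} (n1 n2 : nat) (X : mgraph (n1 + n2) -> R) : R :=
  CMexp n1 n2 (fun G => (X G - CMexp n1 n2 X) ^+ 2).

Arguments CMvar {R} n1 n2 X.

Definition madj n (G : mgraph n) : rel 'I_n := fun v w => (0 < G (v, w))%N.

Definition mcomp n (G : mgraph n) (v : 'I_n) : {set 'I_n} := [set w | connect (madj G) v w].

Definition ncomp n (j : nat) (G : mgraph n) : nat :=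
  #|[set mcomp G v | v in [set v | #|mcomp G v| == j]]|.

Definition n2of {R : realType} (alpha : R) (n1 : nat) : nat :=
  Num.truncn (alpha * n1%:R / 2).

Definition cj {R : realType} (alpha : R) (j : nat) : R :=
  alpha ^+ (j - 2) / (1 + alpha) ^+ (j - 1).

Definition Hij {R : realType} (alpha : R) (i j : nat) : R :=
  - (alpha ^+ (i + j - 4) / (1 + alpha) ^+ (i + j - 2))
      * (1 + (i%:R - 2 - alpha) * (j%:R - 2 - alpha) / (alpha * (1 + alpha)))
  + (i == j)%:R / (1 + alpha) * (alpha / (1 + alpha)) ^+ (i - 2).

Definition Hmat {R : realType} (alpha : R) (q : nat) : 'M[R]_(q.-1) :=
  \matrix_(i, j) Hij alpha (i + 2)%N (j + 2)%N.

(* expectation of f(Z) for Z a standard Gaussian vector in R^d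
   (iid N(0,1) coordinates), as iterated Lebesgue integrals *)
Fixpoint stdgaussE {R : realType} (d : nat) : ('rV[R]_d -> R) -> R :=
  match d return ('rV[R]_d -> R) -> R with
  | 0 => fun f => f 0
  | d'.+1 => fun f =>
      \int[@lebesgue_measure R]_x
        (normal_pdf 0 1 x * stdgaussE (fun z : 'rV[R]_d' =>
            f (\row_(i < d'.+1) (if unlift ord0 i is Some i' then z ord0 i' else x))))
  end.

Definition poissonE {R : realType} (lambda : R) (f : R -> R) : R :=
  limn (fun N : nat => \sum_(n < N) (poisson_pmf lambda n * f n%:R)).

(* Main.v *)
Require Import Defs.
From HB Require Import structures.
From mathcomp Require Import all_boot all_order all_algebra.
From mathcomp Require Import all_classical all_reals all_analysis.
From mathcomp Require Import measurable_realfun.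
From mathcomp Require Import ring lra zify.
Set Implicit Arguments. Unset Strict Implicit. Unset Printing Implicit Defensive.
Import Order.TTheory GRing.Theory Num.Theory.
Import numFieldNormedType.Exports.
Local Open Scope ring_scope.

(** The sequences counted by [seqv] assign vertices to half-edges, so the configuration model is
    the uniform law on words with the prescribed degrees.  Deleting a vertex of degree 2 and closing
    up its two half-edges turns a word with [n+1] vertices of degree 2 into one with [n]; conversely
    such a word is obtained by inserting a vertex into one of the [2(n+k)] half-edges or as a loop.
    The components thus evolve as an urn-like Markov chain started from [k] single edges: a path
    with [a+1] edges, or a cycle with [j], is subdivided with probability proportional to its length.
    Path counts alone form a closed system, whose factorial moments of order one and two and the
    factorial moments of the number of loops satisfy solvable linear recursions.
    A linear functional [u] of the path counts is a martingale once [u] is pulled back along the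
    mean dynamics; since the conditional variances concentrate, the cosines of its centering
    converge to those of a Gaussian.  Cycles with at least two vertices have bounded second moment
    and do not matter at scale [sqrt k].  The factorial moments of the loops give the Poisson limit
    by inclusion-exclusion and dominated convergence of series.  To pass from cosines to bounded
    continuous [f], approximate [f] on a box by Bernstein polynomials in the variables [sin (z_i/2L)]:
    these are trigonometric polynomials that stay bounded by [sup |f|] outside the box. *)

(** * Words and insertion of a vertex *)

(** No probability space is built: a law is a finite sum over words, and [wmean k n.+1 Psi] is
    rewritten as [wmean k n] of another observable. Test functions are transported backward in this
    way instead of following a martingale forward, so statements about a functional [u] are proved
    by induction on [n] for all [u] at once. The martingale argument only shows that mean cosines
    are close to [expR (- (pvar / 2))], with [pvar] the exact variance; the limit of [pvar] comes
    separately from exact second moments. There the products of means cancel at leading order, hence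
    the expansions to relative order [1 / k]. With coefficients of order [1 / sqrt k] and [O(k)]
    steps, an error of order [k^(-3/2)] per step is affordable. Centering at [cj alpha j * k] rather
    than at the mean requires the mean up to [o(sqrt k)]. The closed formulas contain the
    half-integer [n + k - 1/2] because an insertion has [2(n + k) + 1] choices, one of them the
    loop. *)

(* The half-edges of edge [i] are [(i, true)] and [(i, false)]; a word is a sequence
   [(v_1,w_1,...,v_m,w_m)] as counted by [seqv]. *)
Definition half m := ('I_m * bool)%type.
Definition opp_half m (h : half m) : half m := (h.1, ~~ h.2).
Definition word m N := {ffun half m -> 'I_N}.

Definition wadj m N (x : word m N) : rel 'I_N :=
  fun v w => [exists h, (x h == v) && (x (opp_half h) == w)].
Definition wdeg m N (x : word m N) (v : 'I_N) : nat := (\sum_h (x h == v))%N.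
Definition wsize m N (x : word m N) v := #|[set w | connect (wadj x) v w]|.
(** Separates the two kinds of components: paths have two leaves, cycles none. *)
Definition wleaf m N (x : word m N) v :=
  #|[set w | connect (wadj x) v w & wdeg x w == 1%N]|.
Definition valid n1 m N (x : word m N) :=
  [forall v, (wdeg x v == 1%N) || (wdeg x v == 2%N)] &&
  (#|[set v | wdeg x v == 1%N]| == n1).

Lemma opp_halfK m : involutive (@opp_half m).
Proof. by case=> i b; rewrite /opp_half /= negbK. Qed.

Lemma wadj_sym m N (x : word m N) : symmetric (wadj x).
Proof.
move=> v w; apply/existsP/existsP => -[h /andP[/eqP hv /eqP hw]];
  by exists (opp_half h); rewrite opp_halfK hv hw !eqxx.
Qed.

Lemma connect_wadj_sym m N (x : word m N) : connect_sym (wadj x).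
Proof. exact/sym_connect_sym/wadj_sym. Qed.

Lemma wadj_half m N (x : word m N) h : wadj x (x h) (x (opp_half h)).
Proof. by apply/existsP; exists h; rewrite !eqxx. Qed.

(* The vertex [v0] receives the half-edge [h2] of a new edge.  If [o = Some h], the half-edge [h]
   is moved to [v0] and the other end of the new edge takes its former vertex; if [o = None], the
   new edge is a loop at [v0]. *)
Definition ins m N (v0 : 'I_N.+1) (h2 : half m.+1) (s : word m N)
    (o : option (half m)) : word m.+1 N.+1 :=
  [ffun h : half m.+1 => if unlift h2.1 h.1 is Some i then
       if o == Some (i, h.2) then v0 else lift v0 (s (i, h.2))
     else if h.2 == h2.2 then v0 else
       if o is Some h' then lift v0 (s h') else v0].

Section ins.
Variables (m N : nat) (v0 : 'I_N.+1) (h2 : half m.+1).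
Implicit Types (s : word m N) (o : option (half m)).
Definition lift_half (h : half m) : half m.+1 := (lift h2.1 h.1, h.2).

Lemma ins_lift s o h :
  ins v0 h2 s o (lift_half h) = if o == Some h then v0 else lift v0 (s h).
Proof. by rewrite ffunE /= liftK; case: h. Qed.

Lemma ins_self s o : ins v0 h2 s o h2 = v0.
Proof. by rewrite ffunE unlift_none eqxx. Qed.

Lemma ins_opp s o :
  ins v0 h2 s o (opp_half h2) = if o is Some h' then lift v0 (s h') else v0.
Proof. by rewrite ffunE /= unlift_none; case: (h2.2). Qed.

Lemma lift_half_opp h : opp_half (lift_half h) = lift_half (opp_half h).
Proof. by []. Qed.

Lemma half_cases h : [\/ h = h2, h = opp_half h2 | exists h', h = lift_half h'].
Proof.
case: h => i b; case: (unliftP h2.1 i) => [j ->|->].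
  by apply: Or33; exists (j, b).
case: (eqVneq b h2.2) => [->|bN]; first by apply: Or31; case: h2.
by apply: Or32; rewrite /opp_half; case: h2 bN => k [] /=; case: b.
Qed.

Lemma sum_half_lift (V : nmodType) (F : half m.+1 -> V) :
  \sum_h F h = F h2 + F (opp_half h2) + \sum_h F (lift_half h).
Proof.
rewrite (eq_bigr (fun h => F (h.1, h.2))); last by case.
rewrite -(pair_bigA _ (fun i b => F (i, b))) /=.
rewrite (bigD1_ord h2.1) //=; congr (_ + _).
  by rewrite big_bool /opp_half; case: h2 => i [] //=; rewrite addrC.
by rewrite -(pair_bigA _ (fun i b => F (lift h2.1 i, b))).
Qed.

(** For [o = Some h'] the vertex [s h'] gives up [h'] to [v0] but receives the far end of the new
    edge in return, so old degrees do not change. *)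
Lemma wdeg_ins_lift s o u : wdeg (ins v0 h2 s o) (lift v0 u) = wdeg s u.
Proof.
rewrite /wdeg sum_half_lift ins_self ins_opp (negbTE (neq_lift _ _)) add0r.
rewrite (eq_bigr (fun h => ((o != Some h) && (s h == u) : nat))); last first.
  move=> h _; rewrite ins_lift; case: (o == Some h) => /=.
    by rewrite (negbTE (neq_lift _ _)).
  by rewrite (inj_eq lift_inj).
case: o => [h'|]; last by rewrite (negbTE (neq_lift _ _)) add0r.
rewrite (inj_eq lift_inj) (bigD1 h') //= [RHS](bigD1 h') //= eqxx add0r.
by congr (_ + _)%N; apply: eq_bigr => h hh; rewrite -[Some h' == _]/(h' == h) eq_sym hh.
Qed.

Lemma wdeg_ins_new s o : wdeg (ins v0 h2 s o) v0 = 2.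
Proof.
rewrite /wdeg sum_half_lift ins_self ins_opp eqxx.
rewrite (eq_bigr (fun h => (o == Some h) : nat)); last first.
  move=> h _; rewrite ins_lift; case: (o == Some h); first by rewrite eqxx.
  by rewrite eq_sym (negbTE (neq_lift _ _)).
case: o => [h'|]; last by rewrite eqxx big1.
rewrite eq_sym (negbTE (neq_lift _ _)) (bigD1 h') //= eqxx big1 //.
by move=> h hh; rewrite -[Some h' == _]/(h' == h) eq_sym (negbTE hh).
Qed.

Lemma forall_lift (P : pred 'I_N.+1) :
  [forall v, P v] = P v0 && [forall u, P (lift v0 u)].
Proof.
apply/forallP/andP => [H|[H0 /forallP H] v]; first by split=> //; apply/forallP.
by case: (unliftP v0 v) => [u ->|->].
Qed.

Lemma card_lift (P : pred 'I_N.+1) :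
  #|[set v | P v]| = (P v0 + #|[set u | P (lift v0 u)]|)%N.
Proof.
by rewrite -!sum1dep_card big_mkcond [in RHS]big_mkcond /= (bigD1_ord v0) //=; case: (P v0).
Qed.

Lemma valid_ins n1 s o : valid n1 (ins v0 h2 s o) = valid n1 s.
Proof.
rewrite /valid forall_lift card_lift !wdeg_ins_new /= add0n.
by congr andb; [apply: eq_forallb => u | congr (_ == n1); apply: eq_card => u];
   rewrite ?inE wdeg_ins_lift.
Qed.

(** The vertex at [opp_half h2] tells whether the new edge is a loop. If it is not, the moved
    half-edge is the only old one placed at [v0], and the value of [s] lost there is stored at
    [opp_half h2]. *)
Lemma ins_inj s s' o o' : ins v0 h2 s o = ins v0 h2 s' o' -> (s, o) = (s', o').
Proof.
move=> e.
have eo : o = o'.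
  have := congr1 (fun x : word _ _ => x (opp_half h2)) e; rewrite !ins_opp.
  case: o e => [h|]; case: o' => [h'|] e //; last 2 first.
  - by move=> /esym/eqP; rewrite (negbTE (neq_lift _ _)).
  - by move=> /eqP; rewrite (negbTE (neq_lift _ _)).
  move=> _; have := congr1 (fun x : word _ _ => x (lift_half h)) e.
  rewrite !ins_lift eqxx; case: eqP => [->//|_ /eqP].
  by rewrite (negbTE (neq_lift _ _)).
subst o'; congr (_, _); apply/ffunP => h.
have := congr1 (fun x : word _ _ => x (lift_half h)) e; rewrite !ins_lift.
case: eqP => [oh _|_ /lift_inj//].
have := congr1 (fun x : word _ _ => x (opp_half h2)) e; rewrite !ins_opp oh.
by move/lift_inj.
Qed.

(** [v0] has degree 2 and [h2] accounts for one unit; the other is either [opp_half h2], a loop, or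
    exactly one half-edge of another edge, which is then moved back. *)
Lemma ins_surj (x : word m.+1 N.+1) : x h2 = v0 -> wdeg x v0 = 2 ->
  exists s o, x = ins v0 h2 s o.
Proof.
move=> xh2; rewrite /wdeg sum_half_lift xh2 eqxx => d.
have ex_lift y : y != v0 -> exists u, y = lift v0 u.
  by case: (unliftP v0 y) => [u ->|->]; [exists u | rewrite eqxx].
have [xo|xo] := eqVneq (x (opp_half h2)) v0.
  have /eqP : (\sum_h (x (lift_half h) == v0) = 0)%N.
    by move: d; rewrite xo eqxx; case.
  rewrite sum_nat_eq0 => /forallP H.
  have [s Hs] : exists s : half m -> 'I_N, forall h, x (lift_half h) = lift v0 (s h).
    apply: (@fin_all_exists _ _ (fun h u => x (lift_half h) = lift v0 u)) => h.
    by apply: ex_lift; have := H h; case: (x _ == v0).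
  exists [ffun h => s h], None; apply/ffunP => h.
  case: (half_cases h) => [->|->|[h' ->]]; first by rewrite ins_self.
    by rewrite ins_opp.
  by rewrite ins_lift ffunE Hs.
have d1 : (\sum_h (x (lift_half h) == v0) = 1)%N.
  by move: d; rewrite (negbTE xo); case.
have [h' xh'] : exists h', x (lift_half h') == v0.
  apply/existsP; move: d1; apply: contra_eqT; rewrite negb_exists => /forallP H.
  by rewrite big1 // => h _; rewrite (negbTE (H h)).
have xN h : h != h' -> x (lift_half h) != v0.
  move=> hh'; move: d1; apply: contra_eqN => xh.
  by rewrite (bigD1 h') // (bigD1 h) //= xh' xh.
have [u0 xu0] := ex_lift _ xo.
have [s Hs] : exists s : half m -> 'I_N, forall h,
    if h == h' then s h = u0 else x (lift_half h) = lift v0 (s h).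
  apply: (@fin_all_exists _ _ (fun h u => if h == h' then u = u0
    else x (lift_half h) = lift v0 u)) => h.
  by case: eqP => [_|/eqP/xN/ex_lift//]; exists u0.
exists [ffun h => s h], (Some h'); apply/ffunP => h.
case: (half_cases h) => [->|->|[h1 ->]]; first by rewrite ins_self.
  by rewrite ins_opp ffunE xu0; have := Hs h'; rewrite eqxx => ->.
rewrite ins_lift ffunE -[Some h' == _]/(h' == h1) eq_sym; have := Hs h1.
by case: eqP => [->|//]; rewrite (eqP xh').
Qed.
End ins.

(** Replaces inductions on paths: the connectivity results below take for [r] the expected
    description of the components. *)
Lemma connect_min (T : finType) (e r : rel T) : reflexive r -> transitive r ->
  subrel e r -> subrel (connect e) r.
Proof.
move=> rr rt er a b /connectP[p pth ->]; elim: p a pth => //= c p IH a /andP[/er ac /IH].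
exact: rt ac.
Qed.

(** * Components after an insertion *)

Section components_of_ins.
Variables (m N : nat) (v0 : 'I_N.+1) (h2 : half m.+1) (s : word m N).

Section subdivide.
Variable h : half m.
Let x := ins v0 h2 s (Some h).
(** Contraction of the new edge: [v0] is merged with the vertex [s h] at its other end. Contracting
    an edge does not change connectivity, so [p] describes the components of [x] by those of [s]. *)
Let p a := odflt (s h) (unlift v0 a).

Let p_lift u : p (lift v0 u) = u. Proof. by rewrite /p liftK. Qed.
Let p_new : p v0 = s h. Proof. by rewrite /p unlift_none. Qed.
Let p_x g : p (x (lift_half h2 g)) = s g.
Proof. by rewrite /x ins_lift; case: eqP => [[<-]|_]; rewrite ?p_new ?p_lift. Qed.

Lemma connect_ins_some a b : connect (wadj x) a b = connect (wadj s) (p a) (p b).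
Proof.
have xs g : connect (wadj x) (x (lift_half h2 g)) (lift v0 (s g)).
  rewrite /x ins_lift; case: eqP => [[<-]|_]; last exact: connect0.
  by apply: connect1; have := wadj_half x h2; rewrite /x ins_self ins_opp.
have up : connect (wadj x) a (lift v0 (p a)).
  rewrite /p; case: unliftP => [u ->|->]; first exact: connect0.
  by apply: connect1; have := wadj_half x h2; rewrite /x ins_self ins_opp.
have up' : connect (wadj x) (lift v0 (p b)) b.
  rewrite connect_wadj_sym /p; case: unliftP => [u ->|->]; first exact: connect0.
  by apply: connect1; have := wadj_half x h2; rewrite /x ins_self ins_opp.
apply/idP/idP; last first.
  move=> c; apply: (connect_trans up); apply: connect_trans up'.
  move: (p a) (p b) c {up} => u w c.
  apply: (@connect_min _ (wadj s)
    (fun u w => connect (wadj x) (lift v0 u) (lift v0 w))) c.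
  - by move=> ?; exact: connect0.
  - by move=> ? ? ?; exact: connect_trans.
  - move=> {}u {}w /existsP[g /andP[/eqP <- /eqP <-]].
    apply: connect_trans (xs _); rewrite connect_wadj_sym.
    apply: connect_trans (xs _); rewrite connect_wadj_sym.
    exact/connect1/wadj_half.
apply: (@connect_min _ _ (fun a b => connect (wadj s) (p a) (p b))).
- by move=> ?; exact: connect0.
- by move=> ? ? ?; exact: connect_trans.
- move=> {up up'}a {}b /existsP[g /andP[/eqP <- /eqP <-]].
  case: (half_cases h2 g) => [->|->|[g' ->]].
  + by rewrite /x ins_self ins_opp p_new p_lift; exact: connect0.
  + by rewrite opp_halfK /x ins_self ins_opp p_new p_lift; exact: connect0.
  + by rewrite lift_half_opp !p_x; exact/connect1/wadj_half.
Qed.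

Lemma wsize_ins_some a :
  wsize x a = (wsize s (p a) + connect (wadj s) (s h) (p a))%N.
Proof.
rewrite /wsize (card_lift v0) connect_ins_some p_new connect_wadj_sym addnC.
by congr addn; apply: eq_card => u; rewrite !inE connect_ins_some p_lift.
Qed.

Lemma wleaf_ins_some a : wleaf x a = wleaf s (p a).
Proof.
rewrite /wleaf (card_lift v0) wdeg_ins_new andbF add0n.
by apply: eq_card => u; rewrite !inE connect_ins_some p_lift wdeg_ins_lift.
Qed.

End subdivide.

Section loop.
Let x := ins v0 h2 s None.

Lemma connect_ins_none a b : connect (wadj x) a b =
  match unlift v0 a, unlift v0 b with
  | Some u, Some w => connect (wadj s) u w | None, None => true | _, _ => false
  end.
Proof.
apply/idP/idP.
  apply: (@connect_min _ _ (fun a b => match unlift v0 a, unlift v0 b with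
    | Some u, Some w => connect (wadj s) u w | None, None => true
    | _, _ => false end)).
  - by move=> c; case: unlift.
  - move=> c d e; case: (unlift v0 d) => [?|]; case: (unlift v0 c) => [?|];
      case: (unlift v0 e) => [?|] //; exact: connect_trans.
  - move=> {}a {}b /existsP[g /andP[/eqP <- /eqP <-]].
    case: (half_cases h2 g) => [->|->|[g' ->]].
    + by rewrite /x ins_self ins_opp unlift_none.
    + by rewrite opp_halfK /x ins_self ins_opp unlift_none.
    + by rewrite lift_half_opp /x !ins_lift /= !liftK; exact/connect1/wadj_half.
case: (unliftP v0 a) => [u ->|->]; case: (unliftP v0 b) => [w ->|->] //.
apply: (@connect_min _ (wadj s) (fun u w => connect (wadj x) (lift v0 u) (lift v0 w))).
- by move=> ?; exact: connect0.
- by move=> ? ? ?; exact: connect_trans.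
- move=> {}u {}w /existsP[g /andP[/eqP <- /eqP <-]]; apply: connect1.
  by have := wadj_half x (lift_half h2 g); rewrite lift_half_opp /x !ins_lift.
Qed.

Lemma wsize_ins_none_lift u : wsize x (lift v0 u) = wsize s u.
Proof.
rewrite /wsize (card_lift v0) connect_ins_none liftK unlift_none add0n.
by apply: eq_card => w; rewrite !inE connect_ins_none !liftK.
Qed.

Lemma wleaf_ins_none_lift u : wleaf x (lift v0 u) = wleaf s u.
Proof.
rewrite /wleaf (card_lift v0) wdeg_ins_new andbF add0n.
by apply: eq_card => w; rewrite !inE connect_ins_none !liftK wdeg_ins_lift.
Qed.

Lemma wsize_ins_none_new : wsize x v0 = 1%N.
Proof.
rewrite /wsize (card_lift v0) connect0 -[RHS]addn0; congr addn.
by apply: eq_card0 => w; rewrite !inE connect_ins_none liftK unlift_none.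
Qed.

Lemma wleaf_ins_none_new : wleaf x v0 = 0%N.
Proof.
rewrite /wleaf (card_lift v0) wdeg_ins_new andbF add0n.
by apply: eq_card0 => w; rewrite !inE connect_ins_none liftK unlift_none.
Qed.

End loop.
End components_of_ins.

(** * Counting paths and cycles *)

Section component_counts.
Variables (m N : nat).
Implicit Types (x : word m N).

Lemma connect_class x v w : connect (wadj x) v w ->
  [set u | connect (wadj x) v u] = [set u | connect (wadj x) w u].
Proof.
move=> vw; apply/setP => u; rewrite !inE; apply/idP/idP; last exact: connect_trans.
by apply: connect_trans; rewrite connect_wadj_sym.
Qed.

Lemma wsize_connect x v w : connect (wadj x) v w -> wsize x v = wsize x w.
Proof. by rewrite /wsize => /connect_class ->. Qed.

Lemma wleaf_connect x v w : connect (wadj x) v w -> wleaf x v = wleaf x w.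
Proof.
move=> /connect_class/setP vw; apply: eq_card => u; rewrite !inE.
by have := vw u; rewrite !inE => ->.
Qed.

Lemma wsize_gt0 x v : (0 < wsize x v)%N.
Proof. by apply/card_gt0P; exists v; rewrite inE connect0. Qed.

Lemma wsize_le x v : (wsize x v <= N)%N.
Proof. by rewrite -[leqRHS]card_ord max_card. Qed.

Lemma wleaf_le_wsize x v : (wleaf x v <= wsize x v)%N.
Proof. by apply: subset_leq_card; apply/fintype.subsetP => w; rewrite !inE => /andP[]. Qed.

Lemma sum_half_wdeg (V : nmodType) x (F : 'I_N -> V) :
  \sum_h F (x h) = \sum_v F v *+ wdeg x v.
Proof.
under [RHS]eq_bigr => v _ do rewrite /wdeg -sumrMnr.
rewrite exchange_big /=; apply: eq_bigr => h _.
by rewrite (bigD1 (x h)) //= eqxx big1 ?addr0 // => v; rewrite eq_sym => /negbTE->.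
Qed.

End component_counts.

Section counts.
Variable R : realFieldType.

(* Dividing by [j] counts each component of [j] vertices, [l] of them leaves, once. *)
Definition cnt m N (x : word m N) j l : R :=
  #|[set v | (wsize x v == j) && (wleaf x v == l)]|%:R / j%:R.

(* [S.1 a] is the number of paths with [a + 2] vertices, [S.2 j] the number of cycles with [j]. *)
Definition state := ((nat -> R) * (nat -> R))%type.

Definition st m N (x : word m N) : state :=
  (fun a => cnt x a.+2 2, fun j => cnt x j 0).

Definition subdivide_path a (S : state) : state :=
  (fun i => S.1 i - (i == a)%:R + (i == a.+1)%:R, S.2).
Definition subdivide_cycle j (S : state) : state :=
  (S.1, fun i => S.2 i - (i == j)%:R + (i == j.+1)%:R).
Definition add_loop (S : state) : state := (S.1, fun i => S.2 i + (i == 1%N)%:R).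

Definition path_cycle_word m N (x : word m N) :=
  [forall v, (wleaf x v == 0%N) || (wleaf x v == 2%N)].

(** Double counting of pairs formed by a leaf and a vertex of its component: each leaf spreads its
    weight evenly over the [wsize] vertices of the component. *)
Lemma sum_leaves m N (x : word m N) (F : nat -> nat -> R) :
  \sum_(v | wdeg x v == 1%N) F (wsize x v) (wleaf x v) =
  \sum_v (wleaf x v)%:R / (wsize x v)%:R * F (wsize x v) (wleaf x v).
Proof.
under [RHS]eq_bigr => v _.
  rewrite -mulrA {1}/wleaf -sum1dep_card natr_sum big_distrl big_mkcond /=.
  over.
rewrite /= exchange_big /= [LHS]big_mkcond /=; apply: eq_bigr => w _.
case: ifP => dw; last by rewrite big1 // => v _; rewrite andbF.
transitivity (\sum_(v | connect (wadj x) w v) ((wsize x w)%:R^-1 * F (wsize x w) (wleaf x w))).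
  rewrite sumr_const (_ : #|_| = wsize x w); last by rewrite /wsize cardsE.
  rewrite -[RHS]mulr_natl mulrA.
  by rewrite divff ?mul1r // pnatr_eq0 -lt0n wsize_gt0.
rewrite big_mkcond /=; apply: eq_bigr => v _; rewrite andbT connect_wadj_sym.
by case: ifP => // vw; rewrite mul1r (wsize_connect vw) (wleaf_connect vw).
Qed.

(** Groups the vertices by the type of their component. Sizes are at most [N], so [B] merely
    truncates the two sums. *)
Lemma sum_vertices m N (x : word m N) (F : nat -> nat -> R) B : path_cycle_word x ->
  (N < B)%N ->
  \sum_v F (wsize x v) (wleaf x v) =
  \sum_(a < B) (st x).1 a * a.+2%:R * F a.+2 2 + \sum_(j < B) (st x).2 j * j%:R * F j 0.
Proof.
move=> /forallP px NB.
have cntE j l : cnt x j l * j%:R = \sum_(v | (wsize x v == j) && (wleaf x v == l)) 1.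
  rewrite sumr_const /cnt; case: j => [|j].
    rewrite mulr0 (_ : #|_| = 0%N) //; apply: eq_card0 => v; rewrite unfold_in /=.
    by rewrite -leqn0 leqNgt wsize_gt0.
  rewrite divfK ?pnatr_eq0 //; congr (_ *+ _); apply: eq_card => v.
  by rewrite inE [in RHS]unfold_in.
under [X in _ = X + _]eq_bigr => a _ do rewrite cntE big_distrl big_mkcond /=.
under [X in _ = _ + X]eq_bigr => a _ do rewrite cntE big_distrl big_mkcond /=.
rewrite exchange_big /= [X in _ = _ + X]exchange_big -big_split /=.
apply: eq_bigr => v _.
have sv := leq_ltn_trans (wsize_le x v) NB.
case/orP: (px v) => /eqP lv; rewrite lv /=.
  rewrite big1 => [|a _]; last by rewrite andbF.
  rewrite add0r (bigD1 (Ordinal sv)) //= !eqxx big1 ?addr0 ?mul1r // => j.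
  by rewrite -val_eqE eq_sym /= => /negbTE->.
rewrite addrC big1 => [|a _]; last by rewrite andbF.
have s2 : (2 <= wsize x v)%N by rewrite -lv wleaf_le_wsize.
have sv2 : (wsize x v - 2 < B)%N by lia.
have e2 : (wsize x v - 2).+2 = wsize x v by lia.
rewrite add0r (bigD1 (Ordinal sv2)) //= e2 !eqxx big1 ?addr0 ?mul1r // => j.
rewrite -val_eqE /= => jN; case: ifP => //; lia.
Qed.

Lemma sum_halves m N n1 (x : word m N) (F : nat -> nat -> R) B : valid n1 x ->
  path_cycle_word x -> (N < B)%N ->
  \sum_h F (wsize x (x h)) (wleaf x (x h)) =
  \sum_(a < B) 2 * a.+1%:R * (st x).1 a * F a.+2 2 +
  \sum_(j < B) 2 * j%:R * (st x).2 j * F j 0.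
Proof.
move=> /andP[/forallP vx _] px NB.
rewrite (sum_half_wdeg x (fun v => F (wsize x v) (wleaf x v))).
(* A degree is 2 minus the indicator of a leaf; averaged over a component, the indicator becomes
   [wleaf / wsize]. A path on [a + 2] vertices thus gets [2(a + 1)] half-edges. *)
transitivity (\sum_v (2 - (wleaf x v)%:R / (wsize x v)%:R) * F (wsize x v) (wleaf x v)).
  under [RHS]eq_bigr => v _ do rewrite mulrBl.
  rewrite sumrB -sum_leaves [X in _ = _ - X]big_mkcond /= -sumrB.
  apply: eq_bigr => v _; case/orP: (vx v) => /eqP -> /=; rewrite ?mulr1n ?mulr2n; ring.
rewrite (sum_vertices (fun j l => (2 - l%:R / j%:R) * F j l) px NB); congr (_ + _).
  apply: eq_bigr => a _.
  have a0 : a.+2%:R != 0 :> R by rewrite pnatr_eq0.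
  have -> : a.+2%:R = a.+1%:R + 1 :> R by rewrite -natr1.
  have : a.+1%:R + 1 != 0 :> R by rewrite natr1.
  by move: a.+1%:R ((st x).1 a) (F a.+2 2) => c u f c0; field.
by apply: eq_bigr => j _; ring.
Qed.

Lemma cnt_ins_some m N v0 h2 (s : word m N) h j l (i := wsize s (s h)) :
  cnt (ins v0 h2 s (Some h)) j l =
  cnt s j l - ((j == i) && (l == wleaf s (s h)))%:R
            + ((j == i.+1) && (l == wleaf s (s h)))%:R.
Proof.
have i0 : i%:R != 0 :> R by rewrite pnatr_eq0 -lt0n wsize_gt0.
set l0 := wleaf s (s h).
(* Cleared of divisions and subtractions: the [i] vertices of the old component leave size [i], and
   [i + 1] vertices, now including [v0], enter size [i + 1]. *)
have key : (#|[set a | (wsize (ins v0 h2 s (Some h)) a == j) &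
             (wleaf (ins v0 h2 s (Some h)) a == l)]| + i * ((j == i) && (l == l0)) =
  #|[set u | (wsize s u == j) && (wleaf s u == l)]| + i.+1 * ((j == i.+1) && (l == l0)))%N.
  rewrite (card_lift v0) wsize_ins_some wleaf_ins_some unlift_none /= connect0 addn1.
  rewrite -addnA mulSn [RHS]addnCA (eq_sym i.+1) (eq_sym l0); congr addn.
  have iE c : (i * c = \sum_u connect (wadj s) (s h) u * c)%N.
    rewrite -big_distrl /= /i /wsize -sum1dep_card big_mkcond /=.
    by congr (_ * _)%N; apply: eq_bigr => u _; case: connect.
  rewrite -!sum1dep_card /= big_mkcond [X in _ = (X + _)%N]big_mkcond /=.
  rewrite !iE -!big_split /=; apply: eq_bigr => u _.
  rewrite wsize_ins_some wleaf_ins_some liftK /=.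
  case: (boolP (connect _ _ _)) => c; last by rewrite !addn0.
  rewrite -(wsize_connect c) -(wleaf_connect c) addn1 -/i -/l0 !mul1n.
  by rewrite (eq_sym i.+1) (eq_sym i) (eq_sym l0); do 2![case: (_ && _)].
rewrite /cnt; move/(congr1 (fun n => n%:R : R)): key; rewrite !natrD !natrM.
set X := #|_|%:R; set Y := #|_|%:R => key.
have -> : X = Y + i.+1%:R * ((j == i.+1) && (l == l0))%:R
              - i%:R * ((j == i) && (l == l0))%:R.
  by move: key; rewrite -/(wsize s (s h)) -/i -[i.+1%:R]natr1; lra.
rewrite mulrBl mulrDl addrAC; congr (_ - _ + _).
  by case: (eqVneq j i) => [->|_] /=; rewrite ?mulr0 ?mul0r // mulrAC divff ?mul1r.
by case: (eqVneq j i.+1) => [->|_] /=; rewrite ?mulr0 ?mul0r // mulrAC divff ?mul1r ?pnatr_eq0 //.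
Qed.

Lemma cnt_ins_none m N v0 h2 (s : word m N) j l :
  cnt (ins v0 h2 s None) j l = cnt s j l + ((j == 1%N) && (l == 0%N))%:R.
Proof.
rewrite /cnt (card_lift v0) wsize_ins_none_new wleaf_ins_none_new natrD mulrDl addrC.
rewrite (eq_sym 1%N) (eq_sym 0%N); congr (_ + _).
  congr (_%:R / _); apply: eq_card => u.
  by rewrite !inE wsize_ins_none_lift wleaf_ins_none_lift.
by case: (eqVneq j 1%N) => [->|_] /=; rewrite ?mul0r ?divr1.
Qed.

Lemma st_ins_path m N v0 h2 (s : word m N) h a :
  wsize s (s h) = a.+2 -> wleaf s (s h) = 2 ->
  st (ins v0 h2 s (Some h)) = subdivide_path a (st s).
Proof.
move=> hs hl; rewrite /st /subdivide_path /=; congr (_, _); apply/funext => j;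
  by rewrite cnt_ins_some hs hl ?andbT ?andbF ?subr0 ?addr0 ?eqSS.
Qed.

Lemma st_ins_cycle m N v0 h2 (s : word m N) h j :
  wsize s (s h) = j -> wleaf s (s h) = 0%N ->
  st (ins v0 h2 s (Some h)) = subdivide_cycle j (st s).
Proof.
move=> hs hl; rewrite /st /subdivide_cycle /=; congr (_, _); apply/funext => i;
  by rewrite cnt_ins_some hs hl ?andbT ?andbF ?subr0 ?addr0.
Qed.

Lemma st_ins_loop m N v0 h2 (s : word m N) :
  st (ins v0 h2 s None) = add_loop (st s).
Proof.
rewrite /st /add_loop /=; congr (_, _); apply/funext => i;
  by rewrite cnt_ins_none ?andbT ?andbF ?addr0.
Qed.

Lemma path_cycle_ins m N v0 h2 (s : word m N) o :
  path_cycle_word s -> path_cycle_word (ins v0 h2 s o).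
Proof.
rewrite /path_cycle_word (forall_lift v0); case: o => [h|] /forallP H.
  rewrite !wleaf_ins_some H /=; apply/forallP => u; by rewrite !wleaf_ins_some H.
rewrite wleaf_ins_none_new /=; apply/forallP => u; by rewrite !wleaf_ins_none_lift H.
Qed.

End counts.

(** * The Markov chain of component counts *)

Section chain.
Variable R : realFieldType.
Implicit Types (Psi : state R -> R) (S : state R).

(** Sum over all insertions, not an average: the weights are numbers of half-edges, with one more
    term for the loop. *)
Definition step B Psi S : R :=
  Psi (add_loop S) + \sum_(a < B) 2 * a.+1%:R * S.1 a * Psi (subdivide_path a S)
  + \sum_(j < B) 2 * j%:R * S.2 j * Psi (subdivide_cycle j S).

Definition wsum m N n1 Psi : R := \sum_(s : word m N | valid n1 s) Psi (st R s).

Lemma sum_option (V : nmodType) (T : finType) (F : option T -> V) :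
  \sum_o F o = F None + \sum_t F (Some t).
Proof.
rewrite (bigD1 None) //=; congr (_ + _).
rewrite (reindex_omap Some id) => [|[]//].
by apply: eq_bigl => t; rewrite /= eqxx.
Qed.

Lemma sum_ins m N n1 v0 h2 (s : word m N) Psi B : valid n1 s -> path_cycle_word s ->
  (N < B)%N -> \sum_o Psi (st R (ins v0 h2 s o)) = step B Psi (st R s).
Proof.
move=> vs ps NB; rewrite sum_option st_ins_loop /step -addrA; congr (_ + _).
pose G j l := if l == 0%N then Psi (subdivide_cycle j (st R s))
              else Psi (subdivide_path (j - 2)%N (st R s)).
rewrite (eq_bigr (fun h => G (wsize s (s h)) (wleaf s (s h)))).
  rewrite (sum_halves G vs ps NB) /G /=; congr (_ + _).
  by apply: eq_bigr => a _; rewrite !subSS subn0.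
move=> h _; move/forallP: ps => /(_ (s h)) /orP[] /eqP e; rewrite /G e /=.
  by rewrite (st_ins_cycle _ _ _ (erefl _) e).
rewrite (st_ins_path _ _ (a := (wsize s (s h) - 2)%N) _ _ e) //.
by have := wleaf_le_wsize s (s h); rewrite e; lia.
Qed.

(** Double counting of pairs [(x, h2)] with [h2] at a vertex of degree 2. Each [x] has two such
    half-edges per vertex of degree 2; conversely, for fixed [h2] and [v0 = x h2], the words [x] are
    exactly the insertions [ins v0 h2 s o]. *)
Lemma wsum_step m N n1 Psi B : (forall s : word m N, valid n1 s -> path_cycle_word s) ->
  (N < B)%N ->
  (2 * (N.+1 - n1))%:R * wsum m.+1 N.+1 n1 Psi =
  (m.+1 * 2 * N.+1)%:R * wsum m N n1 (step B Psi).
Proof.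
move=> pv NB.
transitivity (\sum_(x : word m.+1 N.+1 | valid n1 x)
   \sum_(h2 | wdeg x (x h2) == 2%N) Psi (st R x)).
  rewrite /wsum big_distrr /=; apply: eq_bigr => x /andP[/forallP vx /eqP lx].
  rewrite big_mkcond /= (sum_half_wdeg x
    (fun v => if wdeg x v == 2%N then Psi (st R x) else 0)).
  have <- : #|[set v | wdeg x v == 2%N]| = (N.+1 - n1)%N.
    rewrite cardsCs card_ord -lx; congr (_ - _)%N; apply: eq_card => v.
    by rewrite !inE; case/orP: (vx v) => /eqP ->.
  rewrite mulr_natl mulrnA -sumr_const [LHS]big_mkcond /=; apply: eq_bigr => v _.
  by rewrite inE; case: eqP => [->|_]; rewrite ?mul0rn.
rewrite (exchange_big_dep xpredT) //=.
transitivity (\sum_(h2 : half m.+1) \sum_(v0 : 'I_N.+1) wsum m N n1 (step B Psi)).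
  apply: eq_bigr => h2 _.
  rewrite (partition_big (fun x : word m.+1 N.+1 => x h2) xpredT) //=.
  apply: eq_bigr => v0 _.
  rewrite (eq_bigl (fun x => x \in
     [set ins v0 h2 p.1 p.2 | p in [set p : word m N * option (half m) | valid n1 p.1]])).
    rewrite big_imset /=; last first.
      by move=> [s o] [s' o'] _ _ /= /ins_inj.
    transitivity (\sum_(s : word m N | valid n1 s) \sum_o Psi (st R (ins v0 h2 s o))).
      by rewrite pair_big_dep /=; apply: eq_bigl => p; rewrite inE andbT.
    by apply: eq_bigr => s vs; rewrite (sum_ins v0 h2 Psi vs (pv _ vs) NB).
  move=> x; apply/idP/imsetP => [/andP[/andP[vx /eqP dx] /eqP xh]|[[s o]]].
    rewrite xh in dx; have [s [b e]] := ins_surj xh dx.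
    by exists (s, b); rewrite // inE -(valid_ins v0 h2 n1 s b) -e.
  rewrite inE => vs ->; rewrite valid_ins vs ins_self /= wdeg_ins_new.
  by rewrite !eqxx.
rewrite !sumr_const card_prod !card_ord card_bool -mulrnA mulr_natl.
by rewrite mulnC.
Qed.

(** The normalising sums obey the same recursion with [2m + 1] insertions per word, so the
    prefactors cancel in [wmean_step]. *)
Lemma wsum_step1 m N n1 : (forall s : word m N, valid n1 s -> path_cycle_word s) ->
  (2 * (N.+1 - n1))%:R * wsum m.+1 N.+1 n1 (fun=> 1) =
  (m.+1 * 2 * N.+1)%:R * ((2 * m).+1%:R * wsum m N n1 (fun=> 1)).
Proof.
move=> pv; rewrite (wsum_step _ pv (ltnSn N)); congr (_ * _).
rewrite /wsum big_distrr /=; apply: eq_bigr => s vs.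
rewrite -(sum_ins ord0 (ord0, true) (fun=> 1) vs (pv _ vs) (ltnSn N)) sumr_const.
by rewrite card_option card_prod card_ord card_bool mulr1 mulnC.
Qed.

(** * Words without vertices of degree 2 *)

Section base.
Variables (k : nat) (x : word k (2 * k)).
Hypothesis vx : valid (2 * k) x.

Let deg1 v : wdeg x v = 1%N.
Proof.
case/andP: vx => _ /eqP c.
have /eqP/setP/(_ v) : [set v | wdeg x v == 1%N] == [set: 'I_(2 * k)].
  by rewrite eqEcard finset.subsetT cardsT card_ord c leqnn.
by rewrite !inE => /eqP.
Qed.

Let inj_x : injective x.
Proof.
move=> h g e; apply/eqP; have := deg1 (x h); apply: contra_eqT => hg.
by rewrite /wdeg (bigD1 h) // (bigD1 g) 1?eq_sym //= e eqxx.
Qed.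

Let ex_half v : exists h, x h = v.
Proof.
suff /existsP[h /eqP] : [exists h, x h == v] by exists h.
have := deg1 v; rewrite /wdeg; apply: contra_eqT; rewrite negb_exists => /forallP H.
by rewrite big1 // => h _; rewrite (negbTE (H h)).
Qed.

(** All degrees being 1, [x] is a bijection from half-edges to vertices, and every component
    consists of the two ends of one edge. *)
Let connect_base h w : connect (wadj x) (x h) w = (w == x h) || (w == x (opp_half h)).
Proof.
apply/idP/orP => [|[/eqP->|/eqP->]]; [|exact: connect0|exact/connect1/wadj_half].
move=> c; suff : [forall g, (x g == x h) ==> ((w == x g) || (w == x (opp_half g)))].
  by move/forallP/(_ h); rewrite eqxx => /orP.
apply: (@connect_min _ (wadj x) (fun a b =>
   [forall g, (x g == a) ==> ((b == x g) || (b == x (opp_half g)))])) c.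
- by move=> a; apply/forallP => g; apply/implyP => /eqP ->; rewrite eqxx.
- move=> b a c /forallP H1 /forallP H2; apply/forallP => g; apply/implyP => ga.
  have := H1 g; rewrite ga => /orP[/eqP e|/eqP e]; first by have := H2 g; rewrite e eqxx.
  by have := H2 (opp_half g); rewrite -e eqxx opp_halfK orbC.
- move=> a b /existsP[g /andP[/eqP <- /eqP <-]]; apply/forallP => g'.
  by apply/implyP => /eqP/inj_x ->; rewrite eqxx orbT.
Qed.

Lemma wsize_base v : wsize x v = 2.
Proof.
have [h <-] := ex_half v; rewrite /wsize.
have -> : [set w | connect (wadj x) (x h) w] = [set x h; x (opp_half h)].
  by apply/setP => w; rewrite !inE connect_base.
rewrite cards2 (inj_eq inj_x); case: h => i b.
by rewrite /opp_half xpair_eqE /= eqxx; case: b.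
Qed.

Lemma wleaf_base v : wleaf x v = 2.
Proof.
rewrite -(wsize_base v) /wleaf /wsize; apply: eq_card => w.
by rewrite !inE deg1 andbT.
Qed.

Lemma st_base : st R x = (fun a => k%:R * (a == 0%N)%:R, fun=> 0).
Proof.
rewrite /st /cnt; congr (_, _); apply/funext => j.
  rewrite -sum1dep_card /=; under eq_bigl => v do rewrite wsize_base wleaf_base andbT !eqSS eq_sym.
  case: eqP => [->|_]; last by rewrite big_pred0 ?mul0r ?mulr0.
  by rewrite sum1_card card_ord natrM mulr1 mulrC mulKf ?pnatr_eq0.
rewrite (_ : #|_| = 0%N) ?mul0r //; apply: eq_card0 => v.
by rewrite !inE wleaf_base andbF.
Qed.

End base.

(** A valid word with a vertex of degree 2 is an insertion into a smaller one, and insertions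
    preserve the property; without such vertices all components are single edges. *)
Lemma valid_path_cycle n k (x : word (n + k) (n + 2 * k)) : valid (2 * k) x ->
  path_cycle_word x.
Proof.
elim: n x => [|n IH] x vx.
  by apply/forallP => v; rewrite (wleaf_base vx) orbT.
case/andP: (vx) => /forallP dx /eqP lx.
have [v0 dv0] : exists v0, wdeg x v0 == 2%N.
  apply/existsP; rewrite -[[exists _, _]]negbK negb_exists; apply/negP => /forallP H.
  have : #|[set v | wdeg x v == 1%N]| = #|[set: 'I_(n.+1 + 2 * k)]|.
    by apply: eq_card => v; rewrite !inE; have := dx v; rewrite (negbTE (H v)) orbF.
  by rewrite cardsT card_ord lx; lia.
have [h2 xh2] : exists h2, x h2 == v0.
  apply/existsP; rewrite -[[exists _, _]]negbK negb_exists; apply/negP => /forallP H.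
  by move: dv0; rewrite /wdeg big1 // => h _; rewrite (negbTE (H h)).
have [s [b e]] := @ins_surj (n + k) (n + 2 * k) v0 h2 x (eqP xh2) (eqP dv0).
rewrite e; apply: path_cycle_ins; apply: IH.
by rewrite -(valid_ins v0 h2 (2 * k) s b) -e.
Qed.

Lemma wsum1_gt0 k n : 0 < wsum (n + k) (n + 2 * k) (2 * k) (fun=> 1).
Proof.
elim: n => [|n IH].
  rewrite /wsum sumr_const ltr0n; apply/card_gt0P.
  have c : #|{: half k}| = (2 * k)%N by rewrite card_prod card_ord card_bool mulnC.
  exists [ffun h => cast_ord c (enum_rank h)].
  suff d v : wdeg [ffun h : half k => cast_ord c (enum_rank h)] v = 1%N.
    rewrite unfold_in /valid; apply/andP; split; first by apply/forallP => v; rewrite d.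
    by under eq_finset => v do rewrite d eqxx; rewrite cardsT card_ord.
  rewrite /wdeg (bigD1 (enum_val (cast_ord (esym c) v))) //= ffunE enum_valK cast_ordKV.
  rewrite eqxx big1 // => h; apply: contraNeq; rewrite eqb0 negbK ffunE => /eqP <-.
  by rewrite cast_ordK enum_rankK.
have pos : 0 < (2 * ((n + 2 * k).+1 - 2 * k))%:R :> R by rewrite ltr0n; lia.
rewrite -(pmulr_rgt0 _ pos) wsum_step1; last exact: valid_path_cycle.
by rewrite pmulr_rgt0 ?pmulr_rgt0 ?ltr0n.
Qed.

(* Mean of an observable of the component counts, for [2k] vertices of degree 1 and [n] of degree 2 *)
Definition wmean k n Psi : R :=
  wsum (n + k) (n + 2 * k) (2 * k) Psi / wsum (n + k) (n + 2 * k) (2 * k) (fun=> 1).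

Lemma ratio_eq (p q c A B D W : R) : p != 0 -> q != 0 -> c != 0 -> W != 0 ->
  p * A = q * B -> p * D = q * (c * W) -> A / D = B / W / c.
Proof.
move=> p0 q0 c0 W0 e1 e2.
have -> : A = q * B / p by rewrite -e1 mulrC mulKf.
have -> : D = q * (c * W) / p by rewrite -e2 mulrC mulKf.
by field; rewrite p0 q0 c0 W0.
Qed.

Lemma wmean_step k n B Psi : (n + 2 * k < B)%N ->
  wmean k n.+1 Psi = wmean k n (step B Psi) / (2 * (n + k)).+1%:R.
Proof.
move=> NB; rewrite /wmean.
have pos : (2 * ((n + 2 * k).+1 - 2 * k))%:R != 0 :> R by rewrite pnatr_eq0; lia.
have w0 : wsum (n + k) (n + 2 * k) (2 * k) (fun=> 1) != 0 by rewrite gt_eqF ?wsum1_gt0.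
have q0 : ((n + k).+1 * 2 * (n + 2 * k).+1)%:R != 0 :> R by rewrite pnatr_eq0; lia.
have c0 : (2 * (n + k)).+1%:R != 0 :> R by rewrite pnatr_eq0.
have pv := @valid_path_cycle n k.
apply: (ratio_eq pos q0 c0 w0 (wsum_step Psi pv NB)); exact: wsum_step1 pv.
Qed.

(** What the moment and limit arguments retain of words: nonnegative counts, an integral number of
    loops, and [n + k] edges in total. *)
Definition admissible k n S :=
  [/\ forall a, 0 <= S.1 a, forall j, 0 <= S.2 j, exists c : nat, S.2 1%N = c%:R
    & forall B, (n + 2 * k < B)%N ->
      \sum_(a < B) a.+1%:R * S.1 a + \sum_(j < B) j%:R * S.2 j = (n + k)%:R].

Lemma st_admissible k n (s : word (n + k) (n + 2 * k)) : valid (2 * k) s ->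
  admissible k n (st R s).
Proof.
move=> vs; split.
- by move=> a; rewrite divr_ge0.
- by move=> a; rewrite divr_ge0.
- by rewrite /st /= /cnt divr1; eexists.
move=> B NB; have := sum_halves (fun _ _ => 1 : R) vs (valid_path_cycle vs) NB.
rewrite sumr_const card_prod card_ord card_bool natrM.
under eq_bigr => a _ do rewrite mulr1 -mulrA.
under [X in _ = _ + X]eq_bigr => a _ do rewrite mulr1 -mulrA.
have two : (2 : R) != 0 by rewrite pnatr_eq0.
by rewrite -!mulr_sumr -mulrDr mulrC => /(mulfI two) ->.
Qed.

Lemma wmean_le k n f g : (forall S, admissible k n S -> f S <= g S) ->
  wmean k n f <= wmean k n g.
Proof.
move=> fg; rewrite ler_pM2r ?invr_gt0 ?wsum1_gt0 //.
by apply: ler_sum => s vs; apply/fg/st_admissible.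
Qed.

Lemma eq_wmean k n f g : (forall S, admissible k n S -> f S = g S) ->
  wmean k n f = wmean k n g.
Proof.
by move=> fg; apply/eqP; rewrite eq_le !wmean_le // => S /fg ->.
Qed.

Lemma wmeanD k n f g : wmean k n (fun S => f S + g S) = wmean k n f + wmean k n g.
Proof. by rewrite /wmean /wsum big_split mulrDl. Qed.

Lemma wmeanZ k n c f : wmean k n (fun S => c * f S) = c * wmean k n f.
Proof. by rewrite /wmean /wsum -mulr_sumr mulrA. Qed.

Lemma wmean_cst k n c : wmean k n (fun=> c) = c.
Proof.
have -> : (fun=> c) = (fun S : state R => c * 1) by apply/funext => S; rewrite mulr1.
by rewrite wmeanZ /wmean divff ?mulr1 // gt_eqF ?wsum1_gt0.
Qed.

Lemma wmean0 k f : wmean k 0 f = f (fun a => k%:R * (a == 0%N)%:R, fun=> 0).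
Proof.
rewrite -[RHS](wmean_cst k 0); rewrite /wmean /wsum; congr (_ / _).
by apply: eq_bigr => s vs; rewrite st_base.
Qed.

End chain.

(** * From multigraphs to words *)

Section graph_of_word.
Variables (m N : nat).
Implicit Types (x : word m N) (G : mgraph N).

(** The disjunction counts a loop once, as the encoding of multigraphs does; its second unit of
    degree is added in [mult_wdeg]. *)
Definition mult x v w : nat :=
  (\sum_(i < m) ((x (i, true) == v) && (x (i, false) == w) ||
                (x (i, true) == w) && (x (i, false) == v)))%N.

Definition gmatch x G := [forall v, forall w, mult x v w == G (v, w) :> nat].

Lemma sum_eq_nat (T : finType) (a : T) (b : T -> bool) :
  (\sum_w ((a == w) && b w) = b a)%N.
Proof.
rewrite (bigD1 a) //= eqxx big1 ?addn0 // => w; rewrite eq_sym => /negbTE->//.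
Qed.

Lemma mult_wdeg x v : (\sum_w mult x v w + mult x v v = wdeg x v)%N.
Proof.
rewrite /mult exchange_big /= -big_split /= /wdeg.
rewrite (eq_bigr (fun h : half m => (x (h.1, h.2) == v) : nat)); last by case.
rewrite -(pair_bigA _ (fun i b => (x (i, b) == v) : nat)) /=.
apply: eq_bigr => i _; rewrite big_bool /=.
set a := x (i, true); set b := x (i, false).
have [av|av] := eqVneq a v; have [bv|bv] := eqVneq b v; rewrite /= ?orbF.
- rewrite (eq_bigr (fun w => ((v == w) && true) : nat)) => [|w _]; last first.
    by rewrite av bv !andbT orbb.
  by rewrite sum_eq_nat.
- rewrite (eq_bigr (fun w => ((b == w) && true) : nat)) => [|w _]; last first.
    by rewrite andbF orbF andbT.
  by rewrite sum_eq_nat.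
- by rewrite (eq_bigr (fun w => ((a == w) && true) : nat)) // sum_eq_nat.
- by rewrite big1 // => w _; rewrite andbF.
Qed.

Lemma multC x v w : mult x v w = mult x w v.
Proof. by apply: eq_bigr => i _; rewrite orbC. Qed.

Lemma mult_gt0 x v w : (0 < mult x v w)%N = wadj x v w.
Proof.
rewrite lt0n sum_nat_eq0 negb_forall; apply/existsP/existsP => [[i]|[[i b]]].
  rewrite implyTb eqb0 negbK => /orP[/andP[/eqP <- /eqP <-]|/andP[/eqP <- /eqP <-]].
    by exists (i, true); rewrite !eqxx.
  by exists (i, false); rewrite !eqxx.
move=> /andP[/eqP <- /eqP <-]; exists i; rewrite /= eqb0 negbK.
by case: b; rewrite /opp_half /= !eqxx ?orbT.
Qed.

Section matching.
Variables (x : word m N) (G : mgraph N).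
Hypothesis xG : gmatch x G.

Let multE v w : G (v, w) = mult x v w :> nat.
Proof. by move/forallP: xG => /(_ v)/forallP/(_ w)/eqP. Qed.

Lemma gmatch_mdeg v : mdeg G v = wdeg x v.
Proof. by rewrite /mdeg -mult_wdeg multE; congr addn; apply: eq_bigr => w _; exact: multE. Qed.

Lemma gmatch_msym : msym G.
Proof.
apply/forallP => v; apply/forallP => w; apply/eqP/val_inj.
by rewrite /= !multE multC.
Qed.

Lemma gmatch_mcomp v : mcomp G v = [set w | connect (wadj x) v w].
Proof.
apply/setP => w; rewrite !inE; apply: eq_connect => a b.
by rewrite /madj multE mult_gt0.
Qed.

End matching.

Lemma deg12_sum n1 n2 (d : 'I_N -> nat) : (n1 + n2 = N)%N ->
  #|[set v | d v == 1%N]| = n1 -> #|[set v | d v == 2%N]| = n2 ->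
  (forall v, (d v == 1%N) || (d v == 2%N)) /\ (\sum_v d v = n1 + 2 * n2)%N.
Proof.
move=> nN c1 c2.
have d12 v : (d v == 1%N) || (d v == 2%N).
  have : #|[set v | d v == 1%N] :|: [set v | d v == 2%N]| = N.
    rewrite cardsU (_ : _ :&: _ = finset.set0) ?cards0 ?subn0 ?c1 ?c2 //.
    by apply/setP => u; rewrite !inE; case: eqP => // ->.
  move=> c; have /eqP/setP/(_ v) : [set v | d v == 1%N] :|: [set v | d v == 2%N] == [set: 'I_N].
    by rewrite eqEcard finset.subsetT cardsT card_ord c leqnn.
  by rewrite !inE.
split=> //; rewrite -c1 -c2 -!sum1dep_card mulnC big_distrl /=.
rewrite [X in (X + _)%N]big_mkcond [X in (_ + X)%N]big_mkcond -big_split /=.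
by apply: eq_bigr => v _; case/orP: (d12 v) => /eqP->.
Qed.

Lemma gmatch_inMG n1 n2 x G : (n1 + n2 = N)%N -> gmatch x G ->
  [&& msym G, #|[set v | mdeg G v == 1%N]| == n1 & #|[set v | mdeg G v == 2%N]| == n2]
  = valid n1 x.
Proof.
move=> nN xG; rewrite (gmatch_msym xG) /valid /=.
have e j : #|[set v | mdeg G v == j]| = #|[set v | wdeg x v == j]|.
  by apply: eq_card => v; rewrite !inE (gmatch_mdeg xG).
rewrite !e; apply/andP/andP => -[].
  move=> /eqP c1 /eqP c2; split; last exact/eqP.
  by apply/forallP => v; case: (deg12_sum nN c1 c2).
move=> /forallP d /eqP c1; split; first exact/eqP.
rewrite cardsCs card_ord (_ : #|~: _| = n1); first by apply/eqP; lia.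
rewrite -c1; apply: eq_card => v.
by rewrite !inE; case/orP: (d v) => /eqP->.
Qed.

(** All degrees are at most 2, hence so are all multiplicities, and they fit into ['I_3]. *)
Lemma gmatch_exists n1 x : valid n1 x -> exists G, forall G', gmatch x G' = (G' == G).
Proof.
move=> /andP[/forallP d _].
have le2 v w : (mult x v w < 3)%N.
  have d2 : (wdeg x v <= 2)%N by case/orP: (d v) => /eqP->.
  rewrite ltnS (leq_trans _ d2) // -mult_wdeg (bigD1 w) //= -addnA leq_addr //.
exists [ffun p => inord (mult x p.1 p.2)] => G; apply/idP/eqP => [xG|->].
  apply/ffunP => -[v w]; rewrite ffunE; apply/val_inj; rewrite /= inordK //.
  by move/forallP: xG => /(_ v)/forallP/(_ w)/eqP.
by apply/forallP => v; apply/forallP => w; rewrite ffunE inordK.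
Qed.

End graph_of_word.

Lemma seqvE m N (G : mgraph N) : nedges G = m ->
  seqv G = #|[set x : word m N | gmatch x G]|.
Proof.
move=> <-.
pose f (t : {ffun 'I_(nedges G) -> 'I_N * 'I_N}) : word (nedges G) N :=
  [ffun h => if h.2 then (t h.1).1 else (t h.1).2].
pose g (y : word (nedges G) N) : {ffun 'I_(nedges G) -> 'I_N * 'I_N} :=
  [ffun i => (y (i, true), y (i, false))].
have fK : cancel f g by move=> t; apply/ffunP => i; rewrite !ffunE /=; case: (t i).
have gK : cancel g f by move=> y; apply/ffunP => -[i []]; rewrite !ffunE.
rewrite /seqv -!sum1dep_card (reindex f) /=; last by exists g => ? _.
apply: eq_bigl => t; rewrite /gmatch; apply: eq_forallb => v; apply: eq_forallb => w.
congr (_ == _); rewrite /mult -sum1dep_card big_mkcond /=; apply: eq_bigr => i _.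
by rewrite !ffunE /=; case: (t i) => a b; rewrite !xpair_eqE; case: (_ || _).
Qed.

Section ncomp.
Variable R : realFieldType.

Lemma ncomp_wsize m N (x : word m N) (G : mgraph N) j : gmatch x G ->
  (ncomp j G)%:R = #|[set v | wsize x v == j]|%:R / j%:R :> R.
Proof.
move=> xG; rewrite /ncomp.
have szE v : #|mcomp G v| = wsize x v by rewrite (gmatch_mcomp xG).
(* For [j = 0] both sides vanish: no component is empty, and division by zero gives zero. *)
case: (posnP j) => [->|j0].
  rewrite invr0 mulr0 (_ : [set v | _] = finset.set0) ?imset0 ?cards0 //.
  by apply/setP => v; rewrite !inE szE -leqn0 leqNgt wsize_gt0.
apply: (canRL (mulfK _)); first by rewrite pnatr_eq0 -lt0n.
rewrite -natrM; congr _%:R.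
rewrite -sum_nat_const -[RHS]sum1dep_card.
rewrite (partition_big (mcomp G)
  [pred A | A \in [set mcomp G v | v in [set v | #|mcomp G v| == j]]]) /=; last first.
  by move=> v vj; apply/imsetP; exists v; rewrite // inE szE.
apply: eq_bigr => A /imsetP[v]; rewrite inE => /eqP vj ->.
rewrite -{1}vj -sum1_card; apply: eq_bigl => w; rewrite (gmatch_mcomp xG) inE.
apply/idP/andP => [vw|[_ /eqP/setP/(_ w)]].
  by rewrite -(wsize_connect vw) -szE vj eqxx (gmatch_mcomp xG) (connect_class vw).
by rewrite (gmatch_mcomp xG) !inE connect0.
Qed.

(** Paths have at least two vertices; the test keeps the truncated subtraction from reading [S.1 0]
    for [j < 2]. *)
Definition obs (S : state R) j : R := (if (j < 2)%N then 0 else S.1 (j - 2)%N) + S.2 j.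

Lemma ncomp_obs m N (x : word m N) (G : mgraph N) j : gmatch x G ->
  path_cycle_word x -> (ncomp j G)%:R = obs (st R x) j.
Proof.
move=> xG /forallP px; rewrite (ncomp_wsize _ xG).
have -> : obs (st R x) j = cnt R x j 2 + cnt R x j 0.
  rewrite /obs; case: ifP => [j2|]; last by case: j => [|[|j]] //; rewrite !subSS subn0.
  rewrite [X in _ = X + _](_ : _ = 0) //= /cnt (_ : #|_| = 0%N) ?mul0r //.
  apply: eq_card0 => v; rewrite !inE; apply/negP => /andP[/eqP sj /eqP lv].
  by have := wleaf_le_wsize x v; rewrite sj lv; lia.
rewrite /cnt -mulrDl -natrD; congr (_%:R / _).
rewrite -!sum1dep_card big_mkcond [X in (X + _)%N]big_mkcond [X in (_ + X)%N]big_mkcond.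
rewrite -big_split /=; apply: eq_bigr => v _.
by case: eqP => //= _; case/orP: (px v) => /eqP->.
Qed.

End ncomp.

(** [kappa G] is the number of words matching [G] divided by [2 ^ m * m!], with [m = k + n] for
    every graph of the class. Exchanging the sums over graphs and words turns the weighted mean into
    a uniform mean over words, where the common divisor cancels. *)
Lemma CMexp_wmean (R : realType) k n (Phi : (nat -> R) -> R) :
  CMexp (2 * k) n (fun G => Phi (fun j => (ncomp j G)%:R)) =
  wmean k n (fun S => Phi (obs S)).
Proof.
have inMG_edges G : @inMG (2 * k) n G -> nedges G = (k + n)%N.
  move=> /and3P[_ /eqP c1 /eqP c2]; rewrite /nedges.
  have [_ ->] := deg12_sum (erefl _) c1 c2.
  by rewrite -mulnDr mul2n doubleK.
have key (X : mgraph (2 * k + n) -> R) :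
    \sum_(G | @inMG (2 * k) n G) kappa G * X G =
    (\sum_(x : word (k + n) (2 * k + n) | valid (2 * k) x)
       \sum_(G | gmatch x G) X G) / (2 ^ (k + n) * (k + n)`!)%:R.
  rewrite (exchange_big_dep (@inMG (2 * k) n)) /=; last first.
    by move=> x G vx xG; rewrite /inMG (gmatch_inMG (erefl _) xG).
  rewrite mulr_suml; apply: eq_bigr => G GM.
  rewrite /kappa (inMG_edges _ GM) mulrAC; congr (_ / _).
  rewrite (seqvE (inMG_edges _ GM)) -sumr_const mulr_suml.
  rewrite [LHS](eq_bigr (fun=> X G)) => [|x _]; last by rewrite mul1r.
  apply: eq_bigl => x; rewrite inE.
  case: (boolP (gmatch x G)) => [xG|]; last by rewrite andbF.
  by rewrite andbT -(gmatch_inMG (erefl _) xG); apply/esym.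
have keyP (Psi : state R -> R) (X : mgraph (2 * k + n) -> R) :
    (forall (x : word (k + n) (2 * k + n)) G, path_cycle_word x -> gmatch x G ->
      X G = Psi (st R x)) ->
    \sum_(G | @inMG (2 * k) n G) kappa G * X G =
    wsum (n + k) (n + 2 * k) (2 * k) Psi / (2 ^ (k + n) * (k + n)`!)%:R.
  move=> XP; rewrite key; congr (_ / _).
  rewrite (addnC n k) (addnC n (2 * k)%N) /wsum; apply: eq_bigr => x vx.
  have [G HG] := gmatch_exists vx.
  rewrite (big_pred1 G) //.
  apply: XP; last by rewrite HG.
  move: x vx {G HG}; rewrite (addnC k n) (addnC (2 * k)%N n); exact: valid_path_cycle.
rewrite /CMexp.
under [X in _ / X]eq_bigr => G _ do rewrite -[kappa G]mulr1.
rewrite (keyP (fun S => Phi (obs S))) ?(keyP (fun=> 1)) //; last first.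
  move=> x G px xG; congr Phi; apply/funext => j; exact: ncomp_obs.
have f0 : (2 ^ (k + n) * (k + n)`!)%:R != 0 :> R.
  by rewrite pnatr_eq0 -lt0n muln_gt0 expn_gt0 fact_gt0.
by rewrite invfM invrK mulrACA mulVf // mulr1.
Qed.

Local Open Scope classical_set_scope.
Local Open Scope ring_scope.

(** * Taylor estimates *)

Section trig_taylor.
Variable R : realType.

(** The trigonometric bounds below are integrated one from another with it: the derivative of each
    defect is the defect before it. *)
Lemma ge0_is_derive (F f : R -> R) x : 0 <= F 0 -> (forall y, is_derive y (1 : R) F (f y)) ->
  (forall y, 0 <= y -> 0 <= f y) -> 0 <= x -> 0 <= F x.
Proof.
move=> F0 dF f0 x0.
have cF : {within `[0, x]%classic, continuous F}.
  by apply: derivable_within_continuous => y _; exact: ex_derive.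
have [c] := MVT_segment x0 (fun y _ => dF y) cF.
rewrite in_itv /= subr0 => /andP[c0 _] e.
have : 0 <= F x - F 0 by rewrite e mulr_ge0 // f0.
by lra.
Qed.

Lemma sin_le_id (x : R) : 0 <= x -> sin x <= x.
Proof.
move=> x0; rewrite -subr_ge0.
apply: (@ge0_is_derive (fun x => x - sin x) (fun x => 1 - cos x)) => //.
by rewrite sin0 subrr.
Qed.

Lemma cos_ge_quad (x : R) : 0 <= x -> 1 - x ^+ 2 / 2 <= cos x.
Proof.
move=> x0; rewrite -subr_ge0.
apply: (@ge0_is_derive (fun x => cos x - (1 - x ^+ 2 / 2)) (fun x => - sin x + x)) => //.
- by rewrite cos0 expr2 mul0r mul0r subr0 subrr.
- move=> y; apply: is_derive_eq; rewrite /GRing.scale /=; by field.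
- by move=> y y0; have := sin_le_id y0; lra.
Qed.

Lemma sin_ge_cubic (x : R) : 0 <= x -> x - x ^+ 3 / 6 <= sin x.
Proof.
move=> x0; rewrite -subr_ge0.
apply: (@ge0_is_derive (fun x => sin x - (x - x ^+ 3 / 6)) (fun x => cos x - (1 - x ^+ 2 / 2))) => //.
- by rewrite sin0 expr0n /= mul0r !subr0.
- move=> y; apply: is_derive_eq; rewrite /GRing.scale /=; by field.
- by move=> y y0; have := cos_ge_quad y0; lra.
Qed.

Lemma cos_le_quartic (x : R) : 0 <= x -> cos x <= 1 - x ^+ 2 / 2 + x ^+ 4 / 24.
Proof.
move=> x0; rewrite -subr_ge0.
apply: (@ge0_is_derive (fun x => 1 - x ^+ 2 / 2 + x ^+ 4 / 24 - cos x)
   (fun x => sin x - (x - x ^+ 3 / 6))) => //.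
- by rewrite cos0 !expr0n /= !mul0r subr0 addr0 subrr.
- move=> y; apply: is_derive_eq; rewrite /GRing.scale /=; by field.
- by move=> y y0; have := sin_ge_cubic y0; lra.
Qed.

Lemma cos_taylor0 (h : R) : `|cos h - (1 - h ^+ 2 / 2)| <= `|h| ^+ 3.
Proof.
rewrite -cos_norm -[h ^+ 2]real_normK ?num_real //.
have := normr_ge0 h; move: `|h| => x x0.
have lo := cos_ge_quad x0; rewrite ger0_norm ?subr_ge0 //.
have hi := cos_le_quartic x0; have c1 := cos_le1 x.
(* The quartic remainder is at most [x ^+ 3] for [x <= 1]; beyond, [x ^+ 2 / 2] already is. *)
have [x1|x1] := leP x 1.
  have x3 : 0 <= x ^+ 3 by rewrite exprn_ge0.
  have : 0 <= x ^+ 3 * (1 - x) by rewrite mulr_ge0 // subr_ge0.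
  by rewrite mulrBr mulr1 -exprSr; lra.
have x2 : 0 <= x ^+ 2 by rewrite exprn_ge0.
have : 0 <= x ^+ 2 * (x - 1) by rewrite mulr_ge0 // subr_ge0 ltW.
by rewrite mulrBr mulr1 -exprSr; lra.
Qed.

Lemma sin_taylor0 (h : R) : `|sin h - h| <= `|h| ^+ 3.
Proof.
wlog h0 : h / 0 <= h.
  move=> H; have [/H//|h0] := leP 0 h.
  have := H (- h); rewrite oppr_ge0 ltW // => /(_ isT).
  by rewrite sinN normrN -opprD normrN.
have lo := sin_ge_cubic h0; have hi := sin_le_id h0.
rewrite ler0_norm; last by lra.
rewrite ger0_norm //.
have : 0 <= h ^+ 3 by rewrite exprn_ge0.
by lra.
Qed.

Lemma cos_taylor (x h : R) :
  `|cos (x + h) - (cos x - h * sin x - h ^+ 2 / 2 * cos x)| <= 2 * `|h| ^+ 3.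
Proof.
have -> : cos (x + h) - (cos x - h * sin x - h ^+ 2 / 2 * cos x) =
  cos x * (cos h - (1 - h ^+ 2 / 2)) - sin x * (sin h - h) by rewrite cosD; ring.
rewrite (le_trans (ler_normB _ _)) // !normrM mulr2n mulrDl mul1r lerD //.
  by rewrite -[leRHS]mul1r ler_pM ?cos_max ?cos_taylor0.
by rewrite -[leRHS]mul1r ler_pM ?sin_max ?sin_taylor0.
Qed.

Lemma expRN_taylor (x : R) : 0 <= x -> `|expR (- x) - (1 - x)| <= x ^+ 2.
Proof.
move=> x0; have := expR_ge1Dx (- x) => lo; rewrite ger0_norm ?subr_ge0 //.
suff : 0 <= 1 - x + x ^+ 2 - expR (- x) by lra.
apply: (@ge0_is_derive (fun x => 1 - x + x ^+ 2 - expR (- x))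
   (fun x => expR (- x) - (1 - x) + x)) => //.
- move=> y; apply: is_derive_eq; rewrite /GRing.scale /=; by ring.
- by move=> y y0; have := expR_ge1Dx (- y); lra.
Qed.

End trig_taylor.

(** * Moments of path and cycle counts *)

Section moments.
Variables (R : realType) (k : nat).
Implicit Types (S : state R) (g : (nat -> R) -> R).
Local Notation E := (@wmean R k).

(* There are [2 * bn n = 2(n + k) + 1] ways to insert a vertex. *)
Definition bn n : R := (n + k)%:R + 2^-1.

Lemma bn_gt0 n : 0 < bn n.
Proof. by rewrite /bn ltr_wpDl ?invr_gt0. Qed.

Lemma bnS n : bn n.+1 = bn n + 1.
Proof. by rewrite /bn addSn -natr1 addrAC. Qed.

(** Generator form of [wmean_step]: the weights of [step] add up to [2 * bn n], so after halving a
    loop is born with weight [1/2], and a component is subdivided with weight its number of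
    edges. *)
Lemma wmean_gen n B Psi : (n + 2 * k < B)%N ->
  E n.+1 Psi = E n (fun S => Psi S + (bn n)^-1 *
    (2^-1 * (Psi (add_loop S) - Psi S)
     + \sum_(a < B) a.+1%:R * S.1 a * (Psi (subdivide_path a S) - Psi S)
     + \sum_(j < B) j%:R * S.2 j * (Psi (subdivide_cycle j S) - Psi S))).
Proof.
move=> NB; rewrite (wmean_step _ NB) mulrC -wmeanZ; apply: eq_wmean => S [_ _ _ /(_ B NB) tot].
have -> : (2 * (n + k)).+1%:R = 2 * bn n :> R.
  by rewrite /bn mulrDr divff ?pnatr_eq0 // -natrM -natr1.
have sB (w F : 'I_B -> R) : \sum_a w a * (F a - Psi S) =
    \sum_a w a * F a - (\sum_a w a) * Psi S.
  by rewrite mulr_suml -sumrB; apply: eq_bigr => a _; rewrite mulrBr.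
rewrite !sB /step /=.
have s2 (c v F : 'I_B -> R) : \sum_a 2 * c a * v a * F a = 2 * \sum_a c a * v a * F a.
  by rewrite mulr_sumr; apply: eq_bigr => a _; rewrite !mulrA.
rewrite !s2 /=.
have bE : bn n = \sum_(a < B) a.+1%:R * S.1 a + \sum_(j < B) j%:R * S.2 j + 2^-1.
  by rewrite tot.
have bn0 := bn_gt0 n; have : bn n != 0 by rewrite gt_eqF.
move: bE; move: (\sum_(a < B) a.+1%:R * S.1 a) (\sum_(j < B) j%:R * S.2 j) => p c.
move: (\sum_(a < B) _) (\sum_(j < B) _) (bn n) => u v b bE b0.
transitivity (Psi S + b^-1 * (2^-1 * Psi (add_loop S) + u + v - b * Psi S)).
  by field.
by congr (_ + _ * _); rewrite bE; ring.
Qed.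

Definition subpath a (P : nat -> R) i : R := P i - (i == a)%:R + (i == a.+1)%:R.

(** Subdividing a path of index [a] only touches the indices [a] and [a + 1]. A function of the
    first [d] counts does not see [a >= d], so these counts form a closed system. *)
Lemma wmean_path_gen n d g :
  (forall P P', (forall a, (a < d)%N -> P a = P' a) -> g P = g P') ->
  E n.+1 (fun S => g S.1) = E n (fun S => g S.1 + (bn n)^-1 *
    \sum_(a < d) a.+1%:R * S.1 a * (g (subpath a S.1) - g S.1)).
Proof.
move=> gd; have NB : (n + 2 * k < (n + 2 * k).+1 + d)%N by lia.
rewrite (wmean_gen _ NB); apply: eq_wmean => S _ /=.
rewrite subrr mulr0 add0r [X in _ * (_ + X)]big1 ?addr0 => [|j _]; last by rewrite mulr0.
congr (_ + _ * _); rewrite [RHS](big_ord_widen ((n + 2 * k).+1 + d)%N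
  (fun a => a.+1%:R * S.1 a * (g (subpath a S.1) - g S.1))) ?leq_addl //=.
rewrite [RHS]big_mkcond /=. apply: eq_bigr => a _; case: ltnP => // da.
rewrite (gd _ S.1) ?subrr ?mulr0 // => i id; have ia := leq_trans id da.
by rewrite /subpath (ltn_eqF ia) (ltn_eqF (leqW ia)) subr0 addr0.
Qed.

(** Falling factorial of a real number; it is evaluated at half-integers as well. *)
Fixpoint ff (x : R) j : R := if j is j'.+1 then ff x j' * (x - j'%:R) else 1.

Lemma ffS x j : ff (x + 1) j.+1 = (x + 1) * ff x j.
Proof.
elim: j => [|j IH]; first by rewrite /= mul1r mulr1 subr0.
rewrite [LHS]/= -/(ff (x + 1) j.+1) IH /= -natr1; ring.
Qed.

Lemma ff0 j : ff 0 j = (j == 0%N)%:R.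
Proof. by elim: j => //= j ->; case: j => [|j]; rewrite ?subr0 ?mulr0 ?mul0r. Qed.

Lemma ff_neq0 x j : (forall i, x != i%:R) -> ff x j != 0.
Proof. by move=> xi; elim: j => [|j IH] /=; rewrite ?oner_eq0 // mulf_neq0 // subr_eq0. Qed.

Definition afrac (x y : R) r s : R := ff x s / ff y (s + r).

(** Recursion solved by quotients of falling factorials. In the applications [r] is the number of
    paths observed and [s] the number of inserted vertices on the observed components, so that
    [s + r] edges can be hit. *)
Lemma afracS x y r s : (forall i, y + 1 != i%:R) ->
  afrac (x + 1) (y + 1) r s =
  afrac x y r s * (1 - (s + r)%:R / (y + 1)) + afrac x y r s.-1 * (s%:R / (y + 1)).
Proof.
move=> yi; have yi' i : y != i%:R by have := yi i.+1; rewrite -natr1 (inj_eq (addIr _)).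
have y0 : y + 1 != 0 by have := yi 0%N.
have ys i : y - i%:R != 0 by rewrite subr_eq0.
have fy := ff_neq0 _ yi'.
rewrite /afrac; case: s => [|s].
  case: r => [|r]; first by rewrite /= !mul0r mulr0 subr0 addr0 mulr1.
  rewrite !add0n ffS mul0r mulr0 addr0 /= -natr1.
  by field; rewrite fy ys y0.
rewrite addSn !ffS /= -!natr1 !natrD.
have := ys (s + r)%N; have := fy (s + r)%N; rewrite natrD.
move: (ff y _) (ff x _) => u v u0 w0.
by field; rewrite u0 w0 y0.
Qed.

Definition yn n : R := bn n - 1.

(** [bn n] and [yn n] are half-integers, so no falling factorial in a denominator vanishes. *)
Lemma bn_neq_nat n i : bn n != i%:R.
Proof.
apply/eqP => /(congr1 (fun x => x * 2)).
rewrite /bn mulrDl mulVf ?pnatr_eq0 // -!natrM natr1 => /eqP.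
by rewrite eqr_nat => /eqP; lia.
Qed.

Lemma ynK n : yn n + 1 = bn n. Proof. by rewrite /yn subrK. Qed.

Lemma yn_neq_nat n i : yn n != i%:R.
Proof. by rewrite -(inj_eq (addIr 1)) ynK natr1 bn_neq_nat. Qed.

Lemma yn0 : yn 0 = k%:R - 2^-1. Proof. by rewrite /yn /bn add0n; field. Qed.

Lemma ynS n : yn n.+1 = yn n + 1. Proof. by rewrite ynK /yn bnS addrK. Qed.

Definition aseq r s n : R := afrac n%:R (yn n) r s.

Lemma aseqS r s n : aseq r s n.+1 =
  aseq r s n * (1 - (s + r)%:R / bn n) + aseq r s.-1 n * (s%:R / bn n).
Proof.
by rewrite /aseq -natr1 ynS afracS ynK // => i; rewrite bn_neq_nat.
Qed.

Lemma aseq0 r s : aseq r s.+1 0 = 0.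
Proof. by rewrite /aseq /afrac ff0 mul0r. Qed.

Lemma sum_eq_ord d (F : nat -> R) i : (i < d)%N ->
  \sum_(a < d) F a * (i == a)%:R = F i.
Proof.
move=> id; rewrite (bigD1 (Ordinal id)) //= eqxx mulr1 big1 ?addr0 // => a.
by rewrite -val_eqE /= eq_sym => /negbTE->; rewrite mulr0.
Qed.

Lemma sum_eqS_ord d (F : nat -> R) i : (i <= d)%N ->
  \sum_(a < d) F a * (i == a.+1)%:R = (0 < i)%:R * F i.-1.
Proof.
case: i => [_|i id]; first by rewrite mul0r big1 // => a _; rewrite mulr0.
by rewrite mul1r -(sum_eq_ord F id); apply: eq_bigr => a _; rewrite eqSS.
Qed.

Lemma wmean_lin n (c d : R) (f h : state R -> R) :
  E n (fun S => c * f S + d * h S) = c * E n f + d * E n h.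
Proof. by rewrite wmeanD !wmeanZ. Qed.

(** The prefactor is fixed at [n = 0]: there are [k] single edges, and [k - 1/2] cancels
    [ff (yn 0) 1]. *)
Lemma wmean_path n i :
  E n (fun S => S.1 i) = k%:R * (k%:R - 2^-1) * aseq 1 i n.
Proof.
elim: n i => [|n IH] i.
  rewrite wmean0; case: i => [|i]; last by rewrite /= aseq0 !mulr0.
  rewrite /aseq /afrac /= mul1r subr0 yn0 mulr1 mul1r mulfK //.
  by rewrite -yn0 (yn_neq_nat 0 0).
rewrite (@wmean_path_gen n i.+1 (fun P => P i)) => [|P P' ->] //.
have -> : E n (fun S => S.1 i + (bn n)^-1 *
   \sum_(a < i.+1) a.+1%:R * S.1 a * (subpath a S.1 i - S.1 i)) =
   E n (fun S => (1 - i.+1%:R / bn n) * S.1 i + (i%:R / bn n) * S.1 i.-1).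
  apply: eq_wmean => S _.
  pose F (a : nat) := a.+1%:R * S.1 a : R.
  rewrite (eq_bigr (fun a : 'I_i.+1 => F a * (i == a.+1)%:R - F a * (i == a)%:R)).
    rewrite sumrB sum_eq_ord // sum_eqS_ord // /F.
    by case: i => [|i]; rewrite ?mul0r ?mul1r /=; ring.
  by move=> a _; rewrite /subpath /F; ring.
rewrite wmean_lin !IH aseqS addn1; ring.
Qed.

(** The observable counts ordered pairs of distinct paths of indices [i] and [j]. Its recursion is
    solved by a function of [i + j] alone; the prefactor is [k(k - 1)] times [ff (yn 0) 2]. *)
Lemma wmean_path2 n i j :
  E n (fun S => S.1 i * S.1 j - (i == j)%:R * S.1 i) =
  k%:R * (k%:R - 1) * (k%:R - 2^-1) * (k%:R - 3 / 2) * aseq 2 (i + j) n.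
Proof.
elim: n i j => [|n IH] i j.
  rewrite wmean0 /=; case: i => [|i]; last by rewrite /= aseq0 !(mulr0, mul0r) subr0.
  case: j => [|j]; last by rewrite /= aseq0 !(mulr0, mul0r) subr0.
  rewrite /aseq /afrac /= subr0 yn0 !mulr1 !mul1r.
  have -> : k%:R - 2^-1 - 1 = k%:R - 3 / 2 :> R by field.
  have u0 : k%:R - 2^-1 != 0 :> R by rewrite -yn0 (yn_neq_nat 0 0).
  have v0 : k%:R - 3 / 2 != 0 :> R.
    have := yn_neq_nat 0 1; rewrite yn0 -subr_eq0; apply: contraNN => /eqP h.
    by apply/eqP; rewrite -h; field.
  move: u0 v0; move: (k%:R - 2^-1) (k%:R - 3 / 2) => u v u0 v0.
  by field; rewrite u0 v0.
rewrite (@wmean_path_gen n (maxn i j).+1 (fun P => P i * P j - (i == j)%:R * P i)); last first.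
  by move=> P P' PP'; rewrite !PP' // ltnS ?leq_maxl ?leq_maxr.
pose G i j S := S.1 i * S.1 j - (i == j)%:R * S.1 i : R.
transitivity (E n (fun S => (1 - (i + j + 2)%:R / bn n) * G i j S +
   (bn n)^-1 * (i%:R * G i.-1 j S + j%:R * G i j.-1 S))); last first.
  rewrite (wmean_lin _ _ _ (G i j)) (wmean_lin _ _ _ (G i.-1 j)) !IH aseqS.
  case: i => [|i]; case: j => [|j]; rewrite ?mul0r ?addn0 ?add0n ?addnS ?addSn /=; ring.
apply: eq_wmean => S _.
have im : (i < (maxn i j).+1)%N by rewrite ltnS leq_maxl.
have jm : (j < (maxn i j).+1)%N by rewrite ltnS leq_maxr.
pose F (a : nat) := a.+1%:R * S.1 a : R.
(* The increment of the product is expanded into indicators; the coefficients of the last two terms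
   record the coincidences [i = j], [j = i + 1] and [i = j + 1]. *)
rewrite (eq_bigr (fun a : 'I_(maxn i j).+1 =>
   S.1 i * (F a * (j == a.+1)%:R) - S.1 i * (F a * (j == a)%:R)
 + S.1 j * (F a * (i == a.+1)%:R) - S.1 j * (F a * (i == a)%:R)
 + (2 * (i == j)%:R - (j == i.+1)%:R) * (F a * (i == a)%:R)
 - (i == j.+1)%:R * (F a * (j == a)%:R))) => [|a _]; last first.
  rewrite /subpath /F; move: (S.1 a) (S.1 i) (S.1 j) (a.+1%:R : R) => p u v c.
  case: (eqVneq i a) => [ia|ia]; case: (eqVneq i a.+1) => [ia1|ia1];
  case: (eqVneq j a) => [ja|ja]; case: (eqVneq j a.+1) => [ja1|ja1];
  case: (eqVneq i j) => [ij|ij]; case: (eqVneq j i.+1) => [ij1|ij1];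
  case: (eqVneq i j.+1) => [ji1|ji1]; try (exfalso; lia); rewrite /=; ring.
rewrite !(sumrB, big_split) /= -!mulr_sumr !sum_eq_ord //.
rewrite (sum_eqS_ord _ (ltnW im)) (sum_eqS_ord _ (ltnW jm)).
rewrite /F /G; clear; have b0 : bn n != 0 by rewrite gt_eqF ?bn_gt0.
case: i => [|i]; case: j => [|j]; rewrite /= ?eqSS ?(eq_sym i.+1 j).
- by field.
- by case: (eqVneq j 0%N) => [->|_] /=; field.
- by case: (eqVneq i 0%N) => [->|_] /=; field.
have [->|ij] := eqVneq i j; first by rewrite (ltn_eqF (ltnSn j)) /=; field.
have [ji|_] := eqVneq j i.+1; first by rewrite ji (ltn_eqF (leqnSn _)) /=; field.
by have [->|_] := eqVneq i j.+1; rewrite /=; field.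
Qed.

End moments.

(** * Cycle counts *)

Section cycle_moments.
Variables (R : realType) (k : nat).
Implicit Types (S : state R).
Local Notation E := (@wmean R k).
Local Notation bn := (@bn R k).

Lemma ff_addn1 (x : R) r : ff (x + 1) r - ff x r = r%:R * ff x r.-1.
Proof. by case: r => [|r]; rewrite ?ffS /= ?subrr ?mul0r // -natr1; ring. Qed.

Lemma ff_subn1 (x : R) r : x * (ff (x - 1) r - ff x r) = - (r%:R * ff x r).
Proof. by have := ffS (x - 1) r; rewrite subrK mulrBr => <- /=; ring. Qed.

(** Loops are born with weight [1/2], the origin of the factor [2^-1 ^+ r], and each is destroyed
    with weight 1; for falling factorials this is the recursion [afracS] with [r = 0] paths. *)
Lemma wmean_loops n r :
  E n (fun S => ff (S.2 1%N) r) = 2^-1 ^+ r * aseq R k 0 r n.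
Proof.
elim: n r => [|n IH] r.
  rewrite wmean0 /= ff0; case: r => [|r]; last by rewrite aseq0 mulr0.
  by rewrite /aseq /afrac /= divr1 expr0 mulr1.
have NB : (n + 2 * k < (n + 2 * k).+2)%N by lia.
rewrite (wmean_gen _ NB).
transitivity (E n (fun S => (1 - r%:R / bn n) * ff (S.2 1%N) r
                           + (r%:R / (2 * bn n)) * ff (S.2 1%N) r.-1)); last first.
  have b0 : bn n != 0 by rewrite gt_eqF ?bn_gt0.
  rewrite (wmean_lin _ _ _ _ (fun S => ff (S.2 1%N) r)) !IH aseqS addn0.
  case: r => [|r]; first by rewrite !mul0r !mulr0 !addr0; ring.
  by rewrite /= exprS; field.
apply: eq_wmean => S _; rewrite /= subrr.
rewrite [X in _ * (_ + X + _)]big1 => [|a _]; last by rewrite mulr0.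
rewrite big_ord_recl /= mul0r mul0r add0r big_ord_recl /= mul1r.
rewrite [X in _ * (_ + (_ + X))]big1 => [|j _]; last by rewrite subr0 addr0 subrr mulr0.
rewrite ff_addn1 !addr0 ff_subn1.
have b0 : bn n != 0 by rewrite gt_eqF ?bn_gt0.
by field.
Qed.

Definition cycle_vertices D S : R := \sum_(j < D) j%:R * S.2 j.

(** A Polya urn: whether a loop is born or a cycle is subdivided, the number of vertices on cycles
    grows by one, with probability [(c + 1/2) / bn n]. *)
Lemma wmean_cycle_gen n B (phi : R -> R) : (n + 2 * k < B)%N ->
  let c := cycle_vertices B.+1 in
  E n.+1 (fun S => phi (c S)) =
  E n (fun S => phi (c S) + (bn n)^-1 * ((c S + 2^-1) * (phi (c S + 1) - phi (c S)))).
Proof.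
move=> NB c; rewrite (wmean_gen _ NB); apply: eq_wmean => S [p0 c0 _ tot].
have upd (i : nat) : (i < B)%N ->
    \sum_(j < B.+1) j%:R * (S.2 j - (j == i :> nat)%:R + (j == i.+1 :> nat)%:R) = c S + 1.
  move=> iB; rewrite (eq_bigr (fun j : 'I_B.+1 => j%:R * S.2 j - j%:R * (i == j :> nat)%:R
      + j%:R * (i.+1 == j :> nat)%:R)) => [|j _]; last first.
    by rewrite (eq_sym i) (eq_sym i.+1); ring.
  rewrite big_split sumrB /= (sum_eq_ord (fun j => j%:R)) ?(sum_eq_ord (fun j => j%:R)) //.
    by rewrite -[i.+1%:R]natr1 /c /cycle_vertices; ring.
  by rewrite ltnS ltnW.
congr (_ + _ * _); rewrite [X in _ + X + _]big1 ?addr0 => [|a _]; last first.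
  by rewrite /c /cycle_vertices /= subrr mulr0.
have -> : c (add_loop S) = c S + 1.
  rewrite /c /cycle_vertices /= (eq_bigr (fun j : 'I_B.+1 => j%:R * S.2 j + j%:R * (1%N == j :> nat)%:R)).
    by rewrite big_split /= (sum_eq_ord (fun j => j%:R)) //; lia.
  by move=> j _; rewrite eq_sym; ring.
(* Sizes below [B] already account for all [n + k] edges, so the count at [B] is zero; the cutoff
   [B + 1] in [c] leaves room for a subdivided cycle. *)
have cB : c S = \sum_(j < B) j%:R * S.2 j.
  rewrite /c /cycle_vertices big_ord_recr /=.
  have := tot B.+1 (leqW NB); rewrite !big_ord_recr /=; have := tot B NB.
  have : 0 <= B.+1%:R * S.1 B by rewrite mulr_ge0.
  have : 0 <= B%:R * S.2 B by rewrite mulr_ge0.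
  by move: (\sum_(i < B) _) (\sum_(i < B) _) => u v; lra.
rewrite [RHS]mulrDl [RHS]addrC; congr (_ + _).
rewrite [X in _ = X * _]cB mulr_suml; apply: eq_bigr => j _.
by congr (_ * (phi _ - phi _)); rewrite {1}/c /cycle_vertices /= upd.
Qed.

(** [c + 1/2] and [(c + 1/2)(c + 3/2)] are eigenfunctions of the urn step, with factors
    [1 + 1 / bn n] and [1 + 2 / bn n], whose products telescope. *)
Lemma wmean_cycle_vertices n B : (n + 2 * k <= B)%N ->
  let c := cycle_vertices B.+1 in
  E n (fun S => c S + 2^-1) = 2^-1 * (bn n / bn 0) /\
  E n (fun S => (c S + 2^-1) * (c S + 3 / 2)) =
    3 / 4 * (bn n * (bn n + 1) / (bn 0 * (bn 0 + 1))).
Proof.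
move=> + c; have b0 := bn_gt0 R k 0; elim: n => [|n IH] nB.
  rewrite !wmean0 (_ : c _ = 0); last by rewrite /c /cycle_vertices big1 // => j _ /=; rewrite mulr0.
  by split; field; rewrite ?gt_eqF //; lra.
have [IH1 IH2] := IH (ltnW nB); have bp := bn_gt0 R k n.
rewrite (wmean_cycle_gen (fun x => x + 2^-1) nB).
rewrite (wmean_cycle_gen (fun x => (x + 2^-1) * (x + 3 / 2)) nB) -/c bnS.
split.
- rewrite (eq_wmean (g := fun S => (1 + (bn n)^-1) * (c S + 2^-1))) => [|S _].
    by rewrite wmeanZ IH1; field; rewrite !gt_eqF.
  by field; rewrite gt_eqF.
- rewrite (eq_wmean (g := fun S => (1 + 2 / bn n) * ((c S + 2^-1) * (c S + 3 / 2)))) => [|S _].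
    by rewrite wmeanZ IH2; field; rewrite !gt_eqF //; lra.
  by field; rewrite gt_eqF.
Qed.

Lemma bn_ratio n K : 0 <= K -> n%:R <= K * k%:R -> bn n <= (1 + K) * bn 0.
Proof. by move=> K0 nK; rewrite !/(bn _) add0n natrD; lra. Qed.

(** A count of cycles is at most the number of vertices on cycles, whose first two moments stay
    bounded as long as [n] is of order [k]. *)
Lemma wmean_cycle_le n j K : (0 < j)%N -> 0 <= K -> n%:R <= K * k%:R ->
  E n (fun S => S.2 j) <= 1 + K /\ E n (fun S => S.2 j ^+ 2) <= (1 + K) ^+ 2.
Proof.
move=> j0 K0 nK; pose B := (n + 2 * k + j)%N; pose c := cycle_vertices B.+1.
have [c1 c2] := wmean_cycle_vertices (leq_addr j (n + 2 * k)).
have cj S : admissible k n S -> 0 <= S.2 j <= c S.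
  move=> [p0 c0 _ _]; rewrite c0 /c /cycle_vertices.
  have jB : (j < B.+1)%N by rewrite ltnS leq_addl.
  rewrite (bigD1 (Ordinal jB)) //=; apply: ler_wpDr; first by apply: sumr_ge0 => i _; rewrite mulr_ge0.
  have : 1 <= j%:R :> R by rewrite ler1n.
  by have := c0 j; nra.
have b0 := bn_gt0 R k 0; have bK := bn_ratio K0 nK; have bp := bn_gt0 R k n.
split.
- apply: (@le_trans _ _ (E n (fun S => c S + 2^-1))).
    by apply: wmean_le => S /cj /andP[_ cS]; rewrite ler_wpDr.
  rewrite c1 mulrA ler_pdivrMr //; lra.
- apply: (@le_trans _ _ (E n (fun S => (c S + 2^-1) * (c S + 3 / 2)))).
    by apply: wmean_le => S /cj /andP[s0 cS]; nra.
  rewrite c2 mulrA ler_pdivrMr ?mulr_gt0 //; last by lra.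
  have : bn n * (bn n + 1) <= (1 + K) ^+ 2 * (bn 0 * (bn 0 + 1)).
    rewrite expr2 mulrACA ler_pM //; [lra|lra|].
    by move: (bn n) (bn 0) bp b0 bK => x y; nra.
  have : 0 <= bn n * (bn n + 1) by rewrite mulr_ge0 // ?ltW //; lra.
  by lra.
Qed.

End cycle_moments.

(** * One step of a martingale with small jumps *)

Section one_step.
Variables (R : realType) (d : nat) (eta : R) (delta : 'I_d -> R).
Hypothesis eta0 : 0 <= eta.
Hypothesis delta_le : forall a, `|delta a| <= 2 * eta.
Implicit Types r : 'I_d -> R.

(* Variance of one step: [delta a] is the jump taken with probability [r a], no jump otherwise *)
Definition stepvar r : R := \sum_a r a * delta a ^+ 2 - (\sum_a r a * delta a) ^+ 2.

Section subprobability.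
Variable r : 'I_d -> R.
Hypothesis r0 : forall a, 0 <= r a.
Hypothesis r1 : \sum_a r a <= 1.
Let rho := \sum_a r a * delta a.

Lemma sum_weighted_le (F : 'I_d -> R) c : 0 <= c -> (forall a, F a <= c) ->
  \sum_a r a * F a <= c.
Proof.
move=> c0 Fc; apply: (@le_trans _ _ ((\sum_a r a) * c)); last by rewrite ler_piMl.
by rewrite mulr_suml; apply: ler_sum => a _; rewrite ler_wpM2l.
Qed.

Lemma drift_le : `|rho| <= 2 * eta.
Proof.
rewrite (le_trans (ler_norm_sum _ _ _)) //.
under eq_bigr => a _ do rewrite normrM (ger0_norm (r0 a)).
by apply: sum_weighted_le => //; rewrite mulr_ge0.
Qed.

(** The variance as a mean of squares about the drift; the mass [1 - \sum_a r a] belongs to the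
    event without jump. *)
Let quad_id : (1 - \sum_a r a) * rho ^+ 2 + \sum_a r a * (delta a - rho) ^+ 2 = stepvar r.
Proof.
rewrite [X in _ + X](eq_bigr (fun a => r a * delta a ^+ 2 - 2 * rho * (r a * delta a) + rho ^+ 2 * r a)).
  by rewrite big_split sumrB /= -!mulr_sumr /stepvar -/rho; ring.
by move=> a _; ring.
Qed.

Lemma stepvar_ge0 : 0 <= stepvar r.
Proof.
rewrite -quad_id; apply: addr_ge0; first by rewrite mulr_ge0 ?subr_ge0 ?sqr_ge0.
by apply: sumr_ge0 => a _; rewrite mulr_ge0 ?r0 ?sqr_ge0.
Qed.

Lemma stepvar_le : stepvar r <= 4 * eta ^+ 2.
Proof.
apply: (@le_trans _ _ (\sum_a r a * delta a ^+ 2)); first by rewrite gerBl sqr_ge0.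
apply: sum_weighted_le => [|a]; first by rewrite mulr_ge0 ?sqr_ge0.
rewrite -[_ ^+ 2]real_normK ?num_real // (_ : 4 * _ = (2 * eta) ^+ 2); last by ring.
by rewrite lerXn2r ?nnegrE ?mulr_ge0.
Qed.

(** The drift is subtracted, so the first-order Taylor term averages out and the second-order one
    gives [stepvar r / 2]. A compensated jump is at most [4 * eta], and [cos_taylor] then costs
    [2 * (4 * eta) ^+ 3]. *)
Lemma cos_step x :
  `|cos (x - rho) + \sum_a r a * (cos (x - rho + delta a) - cos (x - rho))
     - (1 - stepvar r / 2) * cos x| <= 128 * eta ^+ 3.
Proof.
pose T h := cos x - h * sin x - h ^+ 2 / 2 * cos x.
have rhole := drift_le.
have err h : `|h| <= 4 * eta -> `|cos (x + h) - T h| <= 128 * eta ^+ 3.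
  move=> hle; rewrite (le_trans (cos_taylor _ _)) //.
  have -> : 128 * eta ^+ 3 = 2 * (4 * eta) ^+ 3 by ring.
  by rewrite ler_pM2l // lerXn2r ?nnegrE ?mulr_ge0.
have -> : (1 - stepvar r / 2) * cos x =
    (1 - \sum_a r a) * T (- rho) + \sum_a r a * T (delta a - rho).
  rewrite [X in _ = _ + X](eq_bigr (fun a => cos x * r a - sin x * (r a * delta a) + sin x * rho * r a
      - cos x / 2 * (r a * (delta a - rho) ^+ 2))) => [|a _]; last by rewrite /T; ring.
  rewrite !(sumrB, big_split) /= -!mulr_sumr -/rho -quad_id /T.
  by rewrite sqrrN; field.
have -> : cos (x - rho) + \sum_a r a * (cos (x - rho + delta a) - cos (x - rho)) =
    (1 - \sum_a r a) * cos (x - rho) + \sum_a r a * cos (x + (delta a - rho)).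
  rewrite mulrBl mul1r mulr_suml -addrA addrC [RHS]addrC; congr (_ + _).
  rewrite addrC -sumrB; apply: eq_bigr => a _.
  by rewrite mulrBr; congr (_ * cos _ - _); ring.
rewrite opprD addrACA -mulrBr -sumrB.
rewrite [X in `|_ + X|](eq_bigr (fun a =>
  r a * (cos (x + (delta a - rho)) - T (delta a - rho)))) => [|a _]; last first.
  by rewrite -mulrBr.
rewrite (le_trans (ler_normD _ _)) //.
set e := 128 * eta ^+ 3 in err *.
have e0 : 0 <= e by rewrite mulr_ge0 ?exprn_ge0.
have -> : e = (1 - \sum_a r a) * e + \sum_a r a * e by rewrite -mulr_suml; ring.
apply: lerD.
  rewrite normrM ger0_norm ?subr_ge0 // ler_wpM2l ?subr_ge0 // err // normrN.
  by apply: (le_trans rhole); rewrite ler_wpM2r // ler_nat.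
rewrite (le_trans (ler_norm_sum _ _ _)) //; apply: ler_sum => a _.
rewrite normrM (ger0_norm (r0 a)) ler_wpM2l // err // (le_trans (ler_normB _ _)) //.
by apply: (le_trans (lerD (delta_le a) rhole)); rewrite -mulrDl -natrD.
Qed.

End subprobability.

(** [12 = 4 + 8]: squared jumps are at most [4 * eta ^+ 2], and the squared drifts differ by a
    product of two factors, at most [2 * eta] times the distance and [4 * eta]. *)
Lemma stepvar_lip r r' : `|\sum_a r a * delta a| <= 2 * eta ->
  `|\sum_a r' a * delta a| <= 2 * eta ->
  `|stepvar r - stepvar r'| <= 12 * eta ^+ 2 * \sum_a `|r a - r' a|.
Proof.
move=> hr hr'; set D := \sum_a _.
have -> : stepvar r - stepvar r' = \sum_a (r a - r' a) * delta a ^+ 2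
   - (\sum_a (r a - r' a) * delta a) * (\sum_a r a * delta a + \sum_a r' a * delta a).
  rewrite /stepvar.
  under [X in _ = X - _]eq_bigr => a _ do rewrite mulrBl.
  under [X in _ = _ - X * _]eq_bigr => a _ do rewrite mulrBl.
  by rewrite !sumrB; ring.
rewrite (le_trans (ler_normB _ _)) // normrM.
have s2 : `|\sum_a (r a - r' a) * delta a ^+ 2| <= 4 * eta ^+ 2 * D.
  rewrite (le_trans (ler_norm_sum _ _ _)) // /D mulr_sumr; apply: ler_sum => a _.
  rewrite normrM mulrC ler_wpM2r // normrX (_ : 4 * _ = (2 * eta) ^+ 2); last by ring.
  by rewrite lerXn2r ?nnegrE ?mulr_ge0.
have s1 : `|\sum_a (r a - r' a) * delta a| <= 2 * eta * D.
  rewrite (le_trans (ler_norm_sum _ _ _)) // /D mulr_sumr; apply: ler_sum => a _.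
  by rewrite normrM mulrC ler_wpM2r.
have s3 : `|\sum_a r a * delta a + \sum_a r' a * delta a| <= 4 * eta.
  by rewrite (le_trans (ler_normD _ _)) //; lra.
have -> : 12 * eta ^+ 2 * D = 4 * eta ^+ 2 * D + 2 * eta * D * (4 * eta) by ring.
by rewrite lerD // ler_pM.
Qed.

End one_step.

(** * Linear functionals of the path counts *)

Section martingale.
Variables (R : realType) (k d : nat).
Implicit Types (S : state R) (u P : nat -> R).
Local Notation E := (@wmean R k).
Local Notation bn := (@bn R k).

Definition dot u P : R := \sum_(a < d) u a * P a.
Definition pmean n a : R := E n (fun S => S.1 a).
Definition centered n u S : R := dot u S.1 - dot u (pmean n).
Definition rate n S a : R := a.+1%:R * S.1 a / bn n.
Definition jump u a : R := u a.+1 - u a.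
(* Adjoint of the mean one-step evolution: [E (dot u P_(n+1) | P_n) = dot (pull n u) P_n] *)
Definition pull n u a : R := u a + a.+1%:R / bn n * jump u a.
Definition drift n u S : R := \sum_(a < d) rate n S a * jump u a.

Lemma wmean_sum n (F : 'I_d -> state R -> R) :
  E n (fun S => \sum_a F a S) = \sum_a E n (F a).
Proof.
rewrite /wmean /wsum exchange_big /= mulr_suml //.
Qed.

Lemma wmean_dot n u : E n (fun S => dot u S.1) = dot u (pmean n).
Proof. by rewrite /dot wmean_sum; apply: eq_bigr => a _; rewrite wmeanZ. Qed.

(** A path of index [d - 1] that is subdivided leaves the window [a < d]; [u d = 0] makes the jump
    formula valid there too. *)
Lemma dot_subpath u P a : u d = 0 -> (a < d)%N ->
  dot u (subpath a P) = dot u P + jump u a.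
Proof.
move=> ud ad; rewrite /dot.
rewrite (eq_bigr (fun i : 'I_d => u i * P i - u i * (a == i :> nat)%:R
   + u i * (a.+1 == i :> nat)%:R)) => [|i _]; last first.
  by rewrite /subpath (eq_sym a) (eq_sym a.+1); ring.
rewrite big_split sumrB /= (sum_eq_ord u ad) /jump.
have -> : \sum_(i < d) u i * (a.+1 == i :> nat)%:R = u a.+1; last by ring.
have [a1|da] := ltnP a.+1 d; first exact: sum_eq_ord.
have -> : a.+1 = d by apply/eqP; rewrite eqn_leq ad da.
by rewrite ud big1 // => i _; rewrite gtn_eqF ?mulr0.
Qed.

Lemma dot_pull n u S : dot (pull n u) S.1 = dot u S.1 + drift n u S.
Proof.
rewrite /dot /drift -big_split; apply: eq_bigr => a _ /=.
by rewrite /pull /rate; field; rewrite gt_eqF ?bn_gt0.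
Qed.

Lemma wmean_dot_step n u (g : R -> R) : u d = 0 ->
  E n.+1 (fun S => g (dot u S.1)) = E n (fun S => g (dot u S.1) +
    \sum_(a < d) rate n S a * (g (dot u S.1 + jump u a) - g (dot u S.1))).
Proof.
move=> ud; rewrite (@wmean_path_gen _ _ n d (fun P => g (dot u P))).
  apply: eq_wmean => S _; congr (_ + _); rewrite mulr_sumr; apply: eq_bigr => a _.
  by rewrite dot_subpath // /rate; ring.
by move=> P P' PP'; congr g; apply: eq_bigr => a _; rewrite PP'.
Qed.

Lemma dot_pmeanS n u : u d = 0 -> dot u (pmean n.+1) = dot (pull n u) (pmean n).
Proof.
move=> ud; rewrite -!wmean_dot (wmean_dot_step n (fun x => x) ud).
apply: eq_wmean => S _; rewrite dot_pull; congr (_ + _); apply: eq_bigr => a _.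
by rewrite addrAC subrr add0r.
Qed.

(** By [dot_pull], [y] is [dot u] at time [n] centred by the mean at time [n + 1]. Relative to
    [centered n (pull n u)], the increment is jump minus drift, of conditional mean zero. *)
Lemma centered_step n u (g : R -> R) : u d = 0 ->
  E n.+1 (fun S => g (centered n.+1 u S)) =
  E n (fun S => let y := centered n (pull n u) S - drift n u S in
     g y + \sum_(a < d) rate n S a * (g (y + jump u a) - g y)).
Proof.
move=> ud; rewrite /centered.
rewrite (wmean_dot_step n (fun x => g (x - dot u (pmean n.+1))) ud).
apply: eq_wmean => S _ /=; rewrite dot_pull dot_pmeanS //.
rewrite (_ : _ - _ - drift _ _ _ = dot u S.1 - dot (pull n u) (pmean n)); last by ring.
by congr (_ + _); apply: eq_bigr => a _; rewrite addrAC.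
Qed.

Lemma wmean_norm n (f : state R -> R) : `|E n f| <= E n (fun S => `|f S|).
Proof.
rewrite ler_norml; apply/andP; split; last by apply: wmean_le => S _; exact: ler_norm.
rewrite lerNl -mulN1r -wmeanZ; apply: wmean_le => S _.
by rewrite mulN1r -normrN ler_norm.
Qed.

Lemma wmean_norm_le n (f : state R -> R) c :
  (forall S, admissible k n S -> `|f S| <= c) -> `|E n f| <= c.
Proof.
move=> fc; rewrite (le_trans (wmean_norm _ _)) // -(wmean_cst k n c).
exact: wmean_le.
Qed.

Lemma rate_ge0 n S a : admissible k n S -> 0 <= rate n S a.
Proof. by case=> p0 _ _ _; rewrite divr_ge0 ?mulr_ge0 // ltW ?bn_gt0. Qed.

Lemma sum_rate_le1 n S : admissible k n S -> \sum_(a < d) rate n S a <= 1.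
Proof.
case=> p0 c0 _ tot; rewrite -mulr_suml ler_pdivrMr ?bn_gt0 // mul1r.
have B : (n + 2 * k < (n + 2 * k).+1 + d)%N by lia.
apply: (@le_trans _ _ (n + k)%:R); last by rewrite !/(bn _) lerDl invr_ge0.
rewrite -(tot _ B) ler_wpDr //; first by apply: sumr_ge0 => j _; rewrite mulr_ge0.
rewrite (big_ord_widen ((n + 2 * k).+1 + d)%N (fun a => a.+1%:R * S.1 a)) ?leq_addl //.
rewrite big_mkcond; apply: ler_sum => a _; case: ifP => // _.
by rewrite mulr_ge0.
Qed.

End martingale.

(** * Central limit theorem for linear functionals of the path counts *)

Section martingale_clt.
Variables (R : realType) (k d : nat).
Hypothesis dk : (d <= k)%N.
Implicit Types (S : state R) (u P : nat -> R).
Local Notation E := (@wmean R k).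
Local Notation bn := (@bn R k).
Local Notation centered := (@centered R k d).
Local Notation pull := (@pull R k).
Local Notation rate := (@rate R k).
Local Notation pmean := (@pmean R k).

Definition supported u := forall a, (d <= a)%N -> u a = 0.

Definition svar n u S : R := stepvar (fun a : 'I_d => jump u a) (fun a => rate n S a).
Definition pvar n u : R := E n (fun S => centered n u S ^+ 2).

Lemma pull_supported n u : supported u -> supported (pull n u).
Proof. by move=> su a da; rewrite !/(pull _ _) /jump !su ?(leqW da) // subrr mulr0 addr0. Qed.

(** For [a < d <= k] the value is a convex combination of [u a] and [u a.+1], because
    [a + 1 <= bn n]. Hence pulling back through all steps never enlarges the coefficients. *)
Lemma pull_le n u eta : supported u -> (forall a, `|u a| <= eta) ->
  forall a, `|pull n u a| <= eta.
Proof.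
move=> su ue a; have [da|ad] := leqP d a.
  by rewrite pull_supported // normr0 (le_trans _ (ue 0%N)).
have -> : pull n u a = (1 - a.+1%:R / bn n) * u a + a.+1%:R / bn n * u a.+1.
  by rewrite !/(pull _ _) /jump; ring.
have c0 : 0 <= a.+1%:R / bn n by rewrite divr_ge0 // ltW ?bn_gt0.
have c1 : 0 <= 1 - a.+1%:R / bn n.
  rewrite subr_ge0 ler_pdivrMr ?bn_gt0 // mul1r !/(bn _) (@le_trans _ _ (n + k)%:R) //.
    by rewrite ler_nat (leq_trans ad) // (leq_trans dk) // leq_addl.
  by rewrite lerDl invr_ge0.
move: (_ / _) c0 c1 => c c0 c1.
rewrite (le_trans (ler_normD _ _)) // !normrM (ger0_norm c0) (ger0_norm c1).
by have := ler_wpM2l c0 (ue a.+1); have := ler_wpM2l c1 (ue a); rewrite !mulrBl; lra.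
Qed.

Lemma jump_le u eta : (forall a, `|u a| <= eta) -> forall a, `|jump u a| <= 2 * eta.
Proof.
by move=> ue a; rewrite (le_trans (ler_normB _ _)) // mulr2n mulrDl mul1r lerD.
Qed.

Lemma centered0 u S : S = (fun a => k%:R * (a == 0%N)%:R, fun=> 0) -> centered 0 u S = 0.
Proof.
move=> ->; apply/eqP; rewrite subr_eq0; apply/eqP; apply: eq_bigr => a _ /=.
by rewrite !/(pmean _ _) wmean0.
Qed.

Lemma pvar0 u : pvar 0 u = 0.
Proof. by rewrite /pvar wmean0 centered0 // expr0n. Qed.

(** Martingale increments are orthogonal: the cross term vanishes and the mean conditional variance
    is added. *)
Lemma pvarS n u : supported u -> pvar n.+1 u = pvar n (pull n u) + E n (svar n u).
Proof.
move=> su; rewrite /pvar (centered_step k n (fun x => x ^+ 2) (su _ (leqnn _))) -wmeanD.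
apply: eq_wmean => S _ /=; rewrite /svar /stepvar -/(drift k d n u S).
move: (centered _ _ _) => y.
rewrite (eq_bigr (fun a : 'I_d => 2 * (y - drift k d n u S) * (rate n S a * jump u a)
    + rate n S a * jump u a ^+ 2)) => [|a _]; last by ring.
by rewrite big_split /= -mulr_sumr -/(drift k d n u S); ring.
Qed.

Section bounded_coefficients.
Variables (eta : R).
Hypothesis eta0 : 0 <= eta.

Lemma svar_bounds n u : (forall a, `|u a| <= eta) ->
  0 <= E n (svar n u) <= 4 * eta ^+ 2.
Proof.
move=> ue; apply/andP; split.
  rewrite -(wmean_cst k n 0); apply: wmean_le => S adm.
  by apply: stepvar_ge0 => [a|]; [exact: rate_ge0 | exact: sum_rate_le1].
rewrite -(wmean_cst k n (4 * _)); apply: wmean_le => S adm.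
apply: stepvar_le => // [a|a|]; [exact: jump_le | exact: rate_ge0 | exact: sum_rate_le1].
Qed.

Lemma pvar_bounds n u : supported u -> (forall a, `|u a| <= eta) ->
  0 <= pvar n u <= 4 * eta ^+ 2 * n%:R.
Proof.
elim: n u => [|n IH] u su ue; first by rewrite pvar0 mulr0 lexx.
rewrite pvarS // -[n.+1%:R]natr1 mulrDr mulr1.
have /andP[? ?] := svar_bounds n ue.
have /andP[? ?] := IH _ (pull_supported n su) (pull_le n su ue).
by rewrite addr_ge0 ?lerD.
Qed.

End bounded_coefficients.

Lemma pvar_path n a : (a < d)%N ->
  E n (fun S => (S.1 a - pmean n a) ^+ 2) <= 4 * n%:R.
Proof.
move=> ad; pose u i : R := (a == i)%:R.
have su : supported u.
  by move=> i di; rewrite /u ltn_eqF // (leq_trans ad).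
have ue i : `|u i| <= 1 by rewrite /u; case: eqP => _; rewrite ?normr1 ?normr0.
have /andP[_] := pvar_bounds ler01 n su ue; rewrite expr1n mulr1; apply: le_trans.
apply: wmean_le => S _; rewrite !/(centered _ _) /dot.
suff e P : \sum_(i < d) u i * P i = P a :> R by rewrite !e.
by rewrite -[RHS](sum_eq_ord P ad); apply: eq_bigr => i _; rewrite mulrC.
Qed.

Section scaling.
Variables (eps tau K : R).
Hypothesis eps0 : 0 < eps.
Hypothesis epsk : eps ^+ 2 * k%:R = 1.
Hypothesis K0 : 0 <= K.

Let eps1 : eps != 0. Proof. by rewrite gt_eqF. Qed.

Let kE : k%:R = (eps ^+ 2)^-1 :> R.
Proof.
have e2 : eps ^+ 2 != 0 by rewrite expf_neq0.
by apply: (mulfI e2); rewrite epsk divff.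
Qed.

Lemma pdev_path n a : (a < d)%N -> n%:R <= K * k%:R ->
  E n (fun S => `|S.1 a - pmean n a|) <= (4 * K + 1) / 2 * eps^-1.
Proof.
move=> ad nK.
(* Young's inequality in place of Cauchy-Schwarz; with [eps = 1 / sqrt k] both terms have order
   [sqrt k]. *)
apply: (@le_trans _ _ (E n (fun S => eps / 2 * (S.1 a - pmean n a) ^+ 2 + (2 * eps)^-1 * 1))).
  apply: wmean_le => S _; set x := _ - _; rewrite -(real_normK (num_real x)).
  move: (`|x|) => y; rewrite -subr_ge0.
  have -> : eps / 2 * y ^+ 2 + (2 * eps)^-1 * 1 - y = (2 * eps)^-1 * (eps * y - 1) ^+ 2.
    by field.
  by rewrite mulr_ge0 ?sqr_ge0 ?invr_ge0 ?mulr_ge0 // ltW.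
rewrite (wmean_lin k n _ _ (fun S => (S.1 a - pmean n a) ^+ 2)) wmean_cst mulr1.
apply: (@le_trans _ _ (eps / 2 * (4 * (K * k%:R)) + (2 * eps)^-1)).
  rewrite lerD2r; apply: ler_wpM2l; first by rewrite divr_ge0 // ltW.
  by rewrite (le_trans (pvar_path n ad)) // ler_wpM2l.
by rewrite kE le_eqVlt; apply/orP; left; apply/eqP; field.
Qed.

(** Rates deviate from their means by order [1 / sqrt k], so the conditional variance is close to
    [c], its value at the mean rates. Passing from [c] to the mean of [svar] doubles the bound, from
    6 to 12. *)
Lemma svar_dev n u eta : 0 <= eta -> (forall a, `|u a| <= eta) -> n%:R <= K * k%:R ->
  E n (fun S => `|svar n u S - E n (svar n u)|) <=
  12 * d%:R ^+ 2 * (4 * K + 1) * eta ^+ 2 * eps.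
Proof.
move=> eta0 ue nK.
pose r' (a : 'I_d) := E n (fun S => rate n S a).
pose c := stepvar (fun a : 'I_d => jump u a) r'.
have r'0 a : 0 <= r' a.
  by rewrite /r' -(wmean_cst k n 0); apply: wmean_le => S; exact: rate_ge0.
have r'1 : \sum_a r' a <= 1.
  by rewrite /r' -wmean_sum -(wmean_cst k n 1); apply: wmean_le => S; exact: sum_rate_le1.
have ju := jump_le ue.
have key : E n (fun S => `|svar n u S - c|) <= 6 * d%:R ^+ 2 * (4 * K + 1) * eta ^+ 2 * eps.
  apply: (@le_trans _ _ (E n (fun S => 12 * eta ^+ 2 * \sum_(a < d) `|rate n S a - r' a|))).
    apply: wmean_le => S adm; apply: stepvar_lip => //.
      by apply: drift_le => // [a|]; [exact: rate_ge0 | exact: sum_rate_le1].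
    exact: drift_le.
  rewrite wmeanZ wmean_sum.
  have -> : 6 * d%:R ^+ 2 * (4 * K + 1) * eta ^+ 2 * eps =
     12 * eta ^+ 2 * (d%:R * (d%:R * ((4 * K + 1) / 2 * eps))) by field.
  rewrite ler_wpM2l ?mulr_ge0 ?sqr_ge0 //.
  have -> : d%:R * (d%:R * ((4 * K + 1) / 2 * eps)) =
     \sum_(a < d) d%:R * ((4 * K + 1) / 2 * eps) :> R.
    by rewrite sumr_const card_ord [LHS]mulr_natl.
  apply: ler_sum => a _.
  rewrite (@eq_wmean _ _ _ _ (fun S => a.+1%:R / bn n * `|S.1 a - pmean n a|)); last first.
    move=> S _; have -> : r' a = a.+1%:R / bn n * pmean n a.
      by rewrite /r' -wmeanZ; apply: eq_wmean => S' _; rewrite !/(rate _ _ _) mulrAC.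
    rewrite -[X in X * `|_|]ger0_norm ?divr_ge0 // 1?ltW ?bn_gt0 // -normrM.
    by congr `|_|; rewrite !/(rate _ _ _); ring.
  rewrite wmeanZ.
  apply: (@le_trans _ _ (d%:R * eps ^+ 2 * ((4 * K + 1) / 2 * eps^-1))); last first.
    by rewrite le_eqVlt; apply/orP; left; apply/eqP; field.
  apply: ler_pM.
  - by rewrite divr_ge0 // ltW ?bn_gt0.
  - by rewrite -(wmean_cst k n 0); apply: wmean_le.
  - apply: ler_pM; rewrite ?invr_ge0 ?ler_nat //; first by rewrite ltW ?bn_gt0.
    rewrite -[leRHS]invrK lef_pV2 ?posrE ?invr_gt0 ?exprn_gt0 ?bn_gt0 // -kE.
    by rewrite !/(bn _) natrD; have : 0 <= n%:R :> R by []; lra.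
  - exact: pdev_path.
apply: (@le_trans _ _ (E n (fun S => `|svar n u S - c| + `|c - E n (svar n u)| * 1))).
  apply: wmean_le => S _; rewrite mulr1; apply: (le_trans _ (ler_normD _ _)).
  by rewrite addrA subrK.
rewrite wmeanD wmeanZ wmean_cst mulr1.
have : `|c - E n (svar n u)| <= E n (fun S => `|svar n u S - c|).
  have -> : c - E n (svar n u) = E n (fun S => c * 1 + (-1) * svar n u S).
    by rewrite (wmean_lin k n c (-1) (fun=> 1) (svar n u)) wmean_cst; ring.
  rewrite (le_trans (wmean_norm _ _ _)) //; apply: wmean_le => S _.
  by rewrite mulr1 mulN1r distrC.
by move: key; lra.
Qed.

(** Each step multiplies the mean cosine by nearly [1 - w / 2], with [w] the mean conditional
    variance, and [expR (- (w / 2))] matches it; the errors add up. The induction generalises over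
    [u] since a step replaces [u] by [pull n u], with the same [eta]. For [eta] and [eps] of order
    [1 / sqrt k] and [n] of order [k], the total is of order [1 / sqrt k]. *)
Lemma cos_clt n u eta s : 0 <= eta <= 1 -> supported u -> (forall a, `|u a| <= eta) ->
  n%:R <= K * k%:R ->
  `|E n (fun S => cos (centered n u S + s)) - expR (- (pvar n u / 2)) * cos s| <=
  n%:R * (128 * eta ^+ 3 + 6 * d%:R ^+ 2 * (4 * K + 1) * eta ^+ 2 * eps + 4 * eta ^+ 4).
Proof.
move=> /andP[eta0 eta1].
set c := 128 * eta ^+ 3 + _ + _; elim: n u => [|n IH] u su ue nK.
  by rewrite pvar0 wmean0 centered0 // add0r mul0r oppr0 expR0 mul1r subrr normr0 mul0r.
have nK' : n%:R <= K * k%:R by rewrite (le_trans _ nK) // ler_nat.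
have /andP[w0 w4] := svar_bounds eta0 n ue.
have ju := jump_le ue.
have u'e := pull_le n su ue; have su' := pull_supported n su.
have := IH _ su' u'e nK'; have := svar_dev eta0 ue nK'.
have /andP[V0 _] := pvar_bounds eta0 n su' u'e.
rewrite (centered_step k n (fun x => cos (x + s)) (su _ (leqnn _))) pvarS //.
set w := E n (svar n u) in w0 w4 *; clearbody w; set X := centered n (pull n u).
set Phi := E n (fun S => cos (X S + s)); set V := pvar n (pull n u) in V0 *.
move=> dev IHn.
set Phi' := E n _.
have s1 : `|Phi' - E n (fun S => (1 - svar n u S / 2) * cos (X S + s))| <= 128 * eta ^+ 3.
  have -> : Phi' - E n (fun S => (1 - svar n u S / 2) * cos (X S + s)) =
    E n (fun S => (let y := X S - drift k d n u S in
       cos (y + s) + \sum_(a < d) rate n S a * (cos (y + jump u a + s) - cos (y + s)))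
       + (-1) * ((1 - svar n u S / 2) * cos (X S + s))).
    by rewrite wmeanD wmeanZ mulN1r.
  apply: wmean_norm_le => S adm /=; rewrite mulN1r.
  have := @cos_step R d eta (fun a => jump u a) eta0 (fun a => ju a)
     (fun a => rate n S a) (fun a => rate_ge0 a adm) (sum_rate_le1 d adm) (X S + s).
  rewrite -/(drift k d n u S) -/(svar n u S).
  rewrite (eq_bigr (fun a : 'I_d => rate n S a * (cos (X S - drift k d n u S + jump u a + s)
      - cos (X S - drift k d n u S + s)))); last first.
    by move=> a _; congr (_ * (cos _ - cos _)); ring.
  by rewrite (_ : X S + s - drift k d n u S = X S - drift k d n u S + s) //; ring.
have s2 : `|E n (fun S => (1 - svar n u S / 2) * cos (X S + s)) - (1 - w / 2) * Phi| <=
    6 * d%:R ^+ 2 * (4 * K + 1) * eta ^+ 2 * eps.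
  have -> : E n (fun S => (1 - svar n u S / 2) * cos (X S + s)) - (1 - w / 2) * Phi =
     E n (fun S => (- 2^-1) * ((svar n u S - w) * cos (X S + s))).
    rewrite /Phi -wmeanZ -mulN1r -wmeanZ -wmeanD; apply: eq_wmean => S _; ring.
  rewrite wmeanZ normrM normrN [`|2^-1|]ger0_norm ?invr_ge0 //.
  suff : `|E n (fun S => (svar n u S - w) * cos (X S + s))| <= E n (fun S => `|svar n u S - w|).
    by move: dev; lra.
  rewrite (le_trans (wmean_norm _ _ _)) //; apply: wmean_le => S _.
  by rewrite normrM ler_piMr ?cos_max.
have w2 : 0 <= w / 2 by rewrite divr_ge0.
(* [|1 - w / 2| <= 1] because [0 <= w <= 4 * eta ^+ 2 <= 4], so the earlier error is not
   amplified. *)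
have s3 : `|(1 - w / 2) * Phi - (1 - w / 2) * (expR (- (V / 2)) * cos s)| <= n%:R * c.
  rewrite -mulrBr normrM (le_trans _ IHn) // ler_piMl //.
  have : eta ^+ 2 <= 1 by rewrite expr_le1.
  by move: w4 w0 => w4 w0 e1; rewrite ler_norml; apply/andP; split; lra.
have s4 : `|(1 - w / 2) * (expR (- (V / 2)) * cos s) -
   expR (- ((V + w) / 2)) * cos s| <= 4 * eta ^+ 4.
  have -> : expR (- ((V + w) / 2)) = expR (- (V / 2)) * expR (- (w / 2)).
    by rewrite -expRD; congr expR; ring.
  have -> : (1 - w / 2) * (expR (- (V / 2)) * cos s) -
      expR (- (V / 2)) * expR (- (w / 2)) * cos s =
      - (expR (- (V / 2)) * cos s * (expR (- (w / 2)) - (1 - w / 2))) by ring.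
  rewrite normrN normrM (@le_trans _ _ (1 * (w / 2) ^+ 2)) //.
    rewrite ler_pM ?expRN_taylor // normrM ger0_norm ?expR_ge0 //.
    rewrite -[leRHS]mulr1 ler_pM ?expR_ge0 ?cos_max //.
    by rewrite expR_le1 oppr_le0 divr_ge0.
  have -> : 4 * eta ^+ 4 = (2 * eta ^+ 2) ^+ 2 by ring.
  by rewrite mul1r lerXn2r ?nnegrE ?mulr_ge0 ?sqr_ge0 //; lra.
have -> : n.+1%:R * c = n%:R * c + c by rewrite -[n.+1%:R]natr1 mulrDl mul1r.
have tri (a b c' d' e : R) : `|a - e| <= `|a - b| + `|b - c'| + `|c' - d'| + `|d' - e|.
  have -> : a - e = a - b + (b - c') + (c' - d') + (d' - e) by ring.
  by do 3 (rewrite (le_trans (ler_normD _ _)) // lerD2r).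
apply: (le_trans (tri _ _ _ _ _)); apply: (le_trans (lerD (lerD (lerD s1 s2) s3) s4)).
by rewrite /c le_eqVlt; apply/orP; left; apply/eqP; ring.
Qed.

End scaling.
End martingale_clt.

(** * Asymptotics of the moments *)

Section rates_of_convergence.
Variable R : realType.
Implicit Types (u v z : nat -> R).

(* Convergence at rate [o(1 / sqrt k)], as needed to centre at [cj alpha j * k] instead of the mean *)
Definition slow u L := (fun k => Num.sqrt k%:R * (u k - L)) @ \oo --> (0 : R).

Lemma cvg_near u v (l : R) : (\forall k \near \oo, u k = v k) ->
  u @ \oo --> l -> v @ \oo --> l.
Proof. by move=> uv; apply: cvg_trans; apply: near_eq_cvg; apply: filterS uv. Qed.

Lemma cvg_ext u v (l : R) : (forall k, u k = v k) -> u @ \oo --> l -> v @ \oo --> l.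
Proof. by move=> /funext ->. Qed.

Lemma cvg_val u (l l' : R) : l = l' -> u @ \oo --> l -> u @ \oo --> l'.
Proof. by move=> ->. Qed.

Lemma cvg_inv_nat : (fun k => (k%:R : R)^-1) @ \oo --> (0 : R).
Proof.
rewrite -(cvg_shiftn 1); apply: (@cvg_ext harmonic); last exact: cvg_harmonic.
by move=> k; rewrite /harmonic /= addn1.
Qed.

Lemma cvg_inv_sqrt : (fun k => (Num.sqrt (k%:R : R))^-1) @ \oo --> (0 : R).
Proof.
apply: (@cvg_ext (fun k => Num.sqrt (k%:R^-1))); first by move=> k; rewrite sqrtrV.
apply: (cvg_val (sqrtr0 R)).
by apply: continuous_cvg; [exact: sqrt_continuous | exact: cvg_inv_nat].
Qed.

Lemma near_posnat : \forall k \near \oo, 0 < (k%:R : R).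
Proof. by exists 1%N => // k /= k1; rewrite ltr0n. Qed.

Lemma slow_bounded z b C : (forall k, `|z k - b * k%:R| <= C) -> slow (fun k => z k / k%:R) b.
Proof.
move=> zC; apply: norm_cvg0.
have h : (fun k => C * (Num.sqrt (k%:R : R))^-1) @ \oo --> (0 : R).
  by apply: (cvg_val (mulr0 C)); apply: cvgM cvg_inv_sqrt; exact: cvg_cst.
apply: (squeeze_cvgr _ (cvg_cst 0) h); near=> k.
rewrite normr_ge0 /=.
have k0 : 0 < (k%:R : R) by near: k; exact: near_posnat.
have s0 : 0 < Num.sqrt (k%:R : R) by rewrite sqrtr_gt0.
have -> : Num.sqrt k%:R * (z k / k%:R - b) = (z k - b * k%:R) / Num.sqrt k%:R.
  have fld (s x y : R) : s != 0 -> x = s ^+ 2 -> s * (y / x - b) = (y - b * x) / s.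
    by move=> s1 ->; field.
  by apply: fld; rewrite ?gt_eqF // sqr_sqrtr // ltW.
by rewrite normrM normfV (ger0_norm (ltW s0)) ler_pM2r ?invr_gt0.
Unshelve. all: by end_near. Qed.

Lemma slow_cvg u L : slow u L -> u @ \oo --> L.
Proof.
move=> su; apply/subr_cvg0.
have h : (fun k => (Num.sqrt k%:R)^-1 * (Num.sqrt k%:R * (u k - L))) @ \oo --> (0 : R).
  by apply: (cvg_val (mul0r 0)); exact: cvgM cvg_inv_sqrt su.
apply: (cvg_near _ h); near=> k.
rewrite /= mulrA mulVf ?mul1r // gt_eqF // sqrtr_gt0.
by near: k; exact: near_posnat.
Unshelve. all: by end_near. Qed.

Lemma slowM u v L M : slow u L -> slow v M -> slow (fun k => u k * v k) (L * M).
Proof.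
move=> su sv; rewrite /slow.
have -> : (fun k => Num.sqrt k%:R * (u k * v k - L * M)) =
  (fun k => Num.sqrt k%:R * (u k - L) * v k + L * (Num.sqrt k%:R * (v k - M))).
  by apply/funext => k; ring.
apply: (@cvg_val _ (0 * M + L * 0)); first by ring.
apply: cvgD; first by apply: cvgM => //; exact: slow_cvg.
by apply: cvgM => //; exact: cvg_cst.
Qed.

Lemma slow_eq u v L : (forall k, u k = v k) -> slow u L -> slow v L.
Proof. by move=> /funext ->. Qed.

Lemma slowV u L : L != 0 -> slow u L -> slow (fun k => (u k)^-1) L^-1.
Proof.
move=> L0 su; have cu := slow_cvg su; have cuV := cvgV L0 cu.
have h : (fun k => - (Num.sqrt k%:R * (u k - L)) * (u k)^-1 * L^-1) @ \oo --> (0 : R).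
  apply: (@cvg_val _ (- 0 * L^-1 * L^-1)); first by ring.
  apply: cvgM; last exact: cvg_cst.
  by apply: cvgM; [apply: cvgN | exact: cuV].
apply: (cvg_near _ h).
have : \forall k \near \oo, u k != 0.
  exact: (cvgr_neq0 _ cu L0).
apply: filterS => k uk0 /=.
by field; rewrite uk0 L0.
Qed.

(* [u k = 1 + c / k + o(1 / k)]; the covariances come from the terms of order [1 / k] *)
Definition rel1 u c := (fun k => k%:R * (u k - 1)) @ \oo --> (c : R).

Lemma rel1_cvg u c : rel1 u c -> u @ \oo --> (1 : R).
Proof.
move=> su; apply/subr_cvg0.
have h : (fun k => k%:R^-1 * (k%:R * (u k - 1))) @ \oo --> (0 : R).
  by apply: (cvg_val (mul0r c)); exact: cvgM cvg_inv_nat su.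
apply: (cvg_near _ h).
apply: filterS near_posnat => k k0 /=.
by rewrite mulrA mulVf ?mul1r // gt_eqF.
Qed.

Lemma rel1M u v c e : rel1 u c -> rel1 v e -> rel1 (fun k => u k * v k) (c + e).
Proof.
move=> su sv; rewrite /rel1.
have -> : (fun k => k%:R * (u k * v k - 1)) =
  (fun k => k%:R * (u k - 1) * v k + k%:R * (v k - 1)).
  by apply/funext => k; ring.
apply: (@cvg_val _ (c * 1 + e)); first by ring.
by apply: cvgD => //; apply: cvgM => //; exact: rel1_cvg sv.
Qed.

Lemma rel1V u c : rel1 u c -> rel1 (fun k => (u k)^-1) (- c).
Proof.
move=> su; have cu := rel1_cvg su; have cuV := cvgV (oner_neq0 _) cu.
have h : (fun k => - (k%:R * (u k - 1)) * (u k)^-1) @ \oo --> - c.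
  apply: (@cvg_val _ (- c * 1^-1)); first by rewrite invr1 mulr1.
  by apply: cvgM; [apply: cvgN | exact: cuV].
apply: (cvg_near _ h).
have : \forall k \near \oo, u k != 0 by exact: (cvgr_neq0 _ cu (oner_neq0 _)).
by apply: filterS => k uk0 /=; field.
Qed.

Lemma rel1_shift z (b c : R) : b != 0 -> (fun k => z k / k%:R) @ \oo --> b ->
  rel1 (fun k => (z k - c) / z k) (- c / b).
Proof.
move=> b0 zb; rewrite /rel1.
have zV := cvgV b0 zb.
have h : (fun k => - c * (z k / k%:R)^-1) @ \oo --> - c / b.
  by apply: cvgM; [exact: cvg_cst | exact: zV].
apply: (cvg_near _ h).
have : \forall k \near \oo, z k / k%:R != 0 by exact: (cvgr_neq0 _ zb b0).
apply: filterS2 near_posnat => k k0; rewrite mulf_eq0 negb_or => /andP[z0 _] /=.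
by field; rewrite z0 gt_eqF.
Qed.

Lemma ffD (x : R) i j : ff x (i + j) = ff x i * ff (x - i%:R) j.
Proof.
elim: j => [|j IH]; first by rewrite addn0 mulr1.
by rewrite addnS /= IH natrD -mulrA; congr (_ * _); ring.
Qed.

Lemma shift_cvg z (b c : R) : (fun k => z k / k%:R) @ \oo --> b ->
  (fun k => (z k - c) / k%:R) @ \oo --> b.
Proof.
move=> zb; apply: (@cvg_ext (fun k => z k / k%:R - c * k%:R^-1)).
  by move=> k; rewrite mulrBl.
apply: (@cvg_val _ (b - c * 0)); first by ring.
apply: cvgB => //.
by apply: cvgM cvg_inv_nat; exact: cvg_cst.
Qed.

Lemma rel1_ff z (b : R) (i j : nat) : b != 0 -> (fun k => z k / k%:R) @ \oo --> b ->
  rel1 (fun k => ff (z k - i%:R) j / ff (z k) j) (- (i * j)%:R / b).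
Proof.
move=> b0 zb; elim: j => [|j IH].
  rewrite (_ : - _ / b = 0); last by rewrite muln0 oppr0 mul0r.
  by apply: (@cvg_ext (fun=> 0)); [move=> k; rewrite divr1 subrr mulr0 | exact: cvg_cst].
have h := rel1M IH (@rel1_shift _ _ i%:R b0 (@shift_cvg _ _ j%:R zb)).
have <- : - (i * j)%:R / b + - i%:R / b = - (i * j.+1)%:R / b.
  by rewrite mulnS natrD; ring.
apply: (cvg_ext _ h) => k; congr (_ * (_ - _)) => /=.
by rewrite -mulf_div; congr (_ * (_ / _)); ring.
Qed.

End rates_of_convergence.

Section moment_asymptotics.
Variables (R : realType) (alpha : R).
Hypothesis alpha0 : 0 < alpha.

Definition nk k : nat := n2of alpha (2 * k).

Lemma nk_bounds k : (nk k)%:R <= alpha * k%:R < (nk k)%:R + 1.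
Proof.
rewrite /nk /n2of; have -> : alpha * (2 * k)%:R / 2 = alpha * k%:R by rewrite natrM; field.
by have := @truncn_itv R (alpha * k%:R); rewrite natr1; apply; rewrite mulr_ge0 // ltW.
Qed.

Lemma slow_near (u v : nat -> R) L : (\forall k \near \oo, u k = v k) -> slow u L -> slow v L.
Proof.
move=> uv; apply: cvg_near; apply: filterS uv => k -> //.
Qed.

Lemma slow_ff (z : nat -> R) b C j : (forall k, `|z k - b * k%:R| <= C) ->
  slow (fun k => ff (z k) j / k%:R ^+ j) (b ^+ j).
Proof.
move=> zC; elim: j => [|j IH].
  apply: (@cvg_ext _ (fun=> 0)); last exact: cvg_cst.
  by move=> k /=; rewrite expr0 divr1 subrr mulr0.
have h : slow (fun k => (z k - j%:R) / k%:R) b.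
  apply: (@slow_bounded _ _ _ (C + j%:R)) => k; rewrite addrAC.
  by rewrite (le_trans (ler_normB _ _)) // lerD // ger0_norm.
rewrite exprSr; apply: slow_eq (slowM IH h) => k.
by rewrite /= exprSr -mulf_div.
Qed.

Lemma nk_dist k : `|(nk k)%:R - alpha * k%:R| <= 1.
Proof. by have /andP[] := nk_bounds k; rewrite ler_norml => ? ?; apply/andP; split; lra. Qed.

Lemma yk_dist k : `|yn R k (nk k) - (1 + alpha) * k%:R| <= 2.
Proof.
have /andP[] := nk_bounds k; rewrite /yn /bn natrD ler_norml mulrDl mul1r.
by move=> ? ?; apply/andP; split; lra.
Qed.

Let a1 : 1 + alpha != 0. Proof. by rewrite gt_eqF // addr_gt0. Qed.
Let a0 : alpha != 0. Proof. by rewrite gt_eqF. Qed.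

Definition mk k a : R := wmean k (nk k) (fun S => S.1 a).

(** In the closed formula each factor is within a bounded distance of a multiple of [k], which is
    precise enough for [slow]. *)
Lemma mk_slow a : slow (fun k => mk k a / k%:R) (cj alpha a.+2).
Proof.
have s1 : slow (fun k => (k%:R - 2^-1) / k%:R) (1 : R).
  apply: (@slow_bounded _ _ _ 2^-1) => k.
  by rewrite mul1r addrAC subrr add0r normrN ger0_norm // invr_ge0.
have s2 := slow_ff a nk_dist; have s3 := slow_ff a.+1 yk_dist.
have s3' := slowV (expf_neq0 _ a1) s3.
have -> : cj alpha a.+2 = 1 * alpha ^+ a * ((1 + alpha) ^+ a.+1)^-1.
  by rewrite /cj !subSS subn0 mul1r.
apply: slow_near (slowM (slowM s1 s2) s3').
apply: filterS (near_posnat R) => k k0; rewrite /mk wmean_path /aseq /afrac addn1.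
have k1 : k%:R != 0 :> R by rewrite gt_eqF.
have y0 : ff (yn R k (nk k)) a.+1 != 0 by apply: ff_neq0 => i; exact: yn_neq_nat.
rewrite [k%:R ^+ a.+1]exprS; have := expf_neq0 a k1; move: y0.
by move: (ff _ _) (ff _ _) (k%:R ^+ a) => u v w u0 w0; field; rewrite u0 w0 k1.
Qed.

Definition covk k i j : R :=
  wmean k (nk k) (fun S => S.1 i * S.1 j) - mk k i * mk k j.

(** With [rho] the mean number of pairs of distinct paths divided by the product of the two means,
    the covariance is [mk k i * mk k j * (rho k - 1)], plus [mk k i] on the diagonal. The means are
    of order [k], so the term of order [1 / k] in [rho] decides. *)
Lemma cov_cvg i j : (fun k => covk k i j / k%:R) @ \oo --> Hij alpha i.+2 j.+2.
Proof.
have natk : (fun k => (k%:R : R) / k%:R) @ \oo --> (1 : R).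
  apply: (@cvg_near _ (fun=> 1)); last exact: cvg_cst.
  by apply: filterS (near_posnat R) => k k0; rewrite divff // gt_eqF.
have n1 : (1 : R) != 0 by exact: oner_neq0.
have nkc : (fun k => (nk k)%:R / k%:R) @ \oo --> alpha.
  exact: slow_cvg (slow_bounded nk_dist).
have ykc : (fun k => yn R k (nk k) / k%:R) @ \oo --> 1 + alpha.
  exact: slow_cvg (slow_bounded yk_dist).
(* The factors of [rho]: [(k - 1) / k], [(k - 3/2) / (k - 1/2)], and the quotients of falling
   factorials of [nk k] and of [yn]. Their coefficients sum to [-2 - ij / alpha + (i + 1)(j + 1) /
   (1 + alpha)]. *)
have r1 := @rel1_shift _ _ _ 1 n1 natk.
have r2 := @rel1_shift _ _ _ 1 n1 (@shift_cvg _ _ _ 2^-1 natk).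
have r3 := @rel1_ff _ _ _ i j a0 nkc.
have r4 := rel1V (@rel1_ff _ _ _ i.+1 j.+1 a1 ykc).
have r := rel1M (rel1M (rel1M r1 r2) r3) r4.
have mi := slow_cvg (mk_slow i); have mj := slow_cvg (mk_slow j).
have d : (fun k => (i == j)%:R * (mk k i / k%:R)) @ \oo --> (i == j)%:R * cj alpha i.+2.
  by apply: cvgM; [exact: cvg_cst | exact: mi].
move: r; set rho := fun k => _ : R; set c := (X in rel1 _ X) => r.
have h : (fun k => (i == j)%:R * (mk k i / k%:R)
    + mk k i / k%:R * (mk k j / k%:R) * (k%:R * (rho k - 1))) @ \oo -->
    (i == j)%:R * cj alpha i.+2 + cj alpha i.+2 * cj alpha j.+2 * c.
  by apply: cvgD => //; apply: cvgM => //; apply: cvgM; [exact: mi | exact: mj].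
apply: (@cvg_val _ _ _ (Hij alpha i.+2 j.+2) _ (cvg_near _ h)); rewrite /c {h r c}.
  rewrite /Hij /cj; have -> : (i.+2 + j.+2 - 4 = i + j)%N by lia.
  have -> : (i.+2 + j.+2 - 2 = i + j + 2)%N by lia.
  rewrite eqSS eqSS !subSS !subn0 !exprD !exprS expr0 !natrM -!natr1.
  rewrite expr_div_n; have [<-|_] := eqVneq i j.
    have := expf_neq0 i a1; move: (alpha ^+ i) ((1 + alpha) ^+ i) => u v v0.
    by field; rewrite v0 a0 a1.
  have := expf_neq0 i a1; have := expf_neq0 j a1.
  move: (alpha ^+ i) ((1 + alpha) ^+ i) (alpha ^+ j) ((1 + alpha) ^+ j) => u v w z z0 v0.
  by field; rewrite v0 z0 a0 a1.
(* Unlike [yn], [nk k] is an integer, and [ff] vanishes at it as long as [nk k < j]; the algebraic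
   identity is used for large [k] only. *)
have nj : \forall k \near \oo, ff (nk k)%:R j / k%:R ^+ j != 0 :> R.
  exact: (cvgr_neq0 _ (slow_cvg (slow_ff j nk_dist)) (expf_neq0 j a0)).
apply: filterS2 (near_posnat R) nj => k k0; rewrite mulf_eq0 negb_or => /andP[ffn _] /=.
have k1 : k%:R != 0 :> R by rewrite gt_eqF.
have kh : k%:R - 2^-1 != 0 :> R by rewrite -yn0 (yn_neq_nat R k 0 0).
have fy l : ff (yn R k (nk k)) l != 0 by apply: ff_neq0 => l'; exact: yn_neq_nat.
have fyD := fy (i.+1 + j.+1)%N; rewrite ffD in fyD.
have fyi := fy i.+1; have fyj := fy j.+1.
have fys : ff (yn R k (nk k) - i.+1%:R) j.+1 != 0.
  by move: fyD; rewrite mulf_eq0 negb_or => /andP[].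
rewrite /covk; have -> : wmean k (nk k) (fun S => S.1 i * S.1 j) =
    k%:R * (k%:R - 1) * (k%:R - 2^-1) * (k%:R - 3 / 2) * aseq R k 2 (i + j) (nk k)
    + (i == j)%:R * mk k i.
  rewrite -wmean_path2 /mk -wmeanZ -wmeanD; apply: eq_wmean => S _; ring.
rewrite /mk !wmean_path /aseq /afrac.
have -> : (i + j + 2 = i.+1 + j.+1)%N by lia.
rewrite !addn1 [ff (yn R k (nk k)) (i.+1 + j.+1)]ffD [ff _ (i + j)]ffD.
have e3 : k%:R - 3 / 2 = k%:R - 2^-1 - 1 :> R by field.
have fld (x y z1 z2 z3 z4 z5 z6 b : R) : z4 != 0 -> z2 != 0 -> z3 != 0 -> z1 != 0 ->
    y != 0 -> x != 0 ->
  b * (y * x * (z5 / z2) / y) + y * x * (z5 / z2) / y * (y * x * (z4 / z3) / y) *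
    (y * ((y - 1) / y * ((x - 1) / x) * (z6 / z4) * (z1 / z3)^-1 - 1)) =
  (y * (y - 1) * x * (x - 1) * (z5 * z6 / (z2 * z1)) + b * (y * x * (z5 / z2))
   - y * x * (z5 / z2) * (y * x * (z4 / z3))) / y.
  move=> h1 h2 h3 h4 h5 h6.
  by field; rewrite h1 h2 h3 h4 h5 h6.
rewrite e3 /rho; exact: fld.
Qed.

(** These limits are the factorial moments of a Poisson law. *)
Lemma loops_cvg r :
  (fun k => wmean k (nk k) (fun S : state R => ff (S.2 1%N) r)) @ \oo -->
  (2^-1 * (alpha / (1 + alpha))) ^+ r.
Proof.
have s2 := slow_ff r nk_dist; have s3 := slow_ff r yk_dist.
have h : (fun k => 2^-1 ^+ r * (ff (nk k)%:R r / k%:R ^+ r *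
    (ff (yn R k (nk k)) r / k%:R ^+ r)^-1)) @ \oo -->
    (2^-1 : R) ^+ r * (alpha ^+ r * ((1 + alpha) ^+ r)^-1).
  apply: cvgM; first exact: cvg_cst.
  exact: slow_cvg (slowM s2 (slowV (expf_neq0 _ a1) s3)).
apply: (@cvg_val _ _ _ _ _ (cvg_near _ h)); first by rewrite exprMn expr_div_n.
apply: filterS (near_posnat R) => k k0; rewrite wmean_loops /aseq /afrac addn0.
have k1 : k%:R != 0 :> R by rewrite gt_eqF.
have y0 : ff (yn R k (nk k)) r != 0 by apply: ff_neq0 => i; exact: yn_neq_nat.
have fld (u v w x : R) : v != 0 -> w != 0 -> x * (u / w * (v / w)^-1) = x * (u / v).
  by move=> v0 w0; field; rewrite v0.
by apply: fld => //; rewrite expf_neq0.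
Qed.

End moment_asymptotics.

(** * Mean, variance and characteristic functions *)

Section limit_laws.
Variables (R : realType) (alpha : R).
Hypothesis alpha0 : 0 < alpha.
Local Notation nk := (nk alpha).
Local Notation mk := (mk alpha).
Local Notation E k := (@wmean R k (nk k)).

Let a1 : 1 + alpha != 0. Proof. by rewrite gt_eqF // addr_gt0. Qed.
Let a0 : alpha != 0. Proof. by rewrite gt_eqF. Qed.

Lemma nk_le k : (nk k)%:R <= alpha * k%:R :> R.
Proof. by have /andP[] := nk_bounds alpha0 k. Qed.

Lemma cycle_le k j : (0 < j)%N ->
  E k (fun S => S.2 j) <= 1 + alpha /\ E k (fun S => S.2 j ^+ 2) <= (1 + alpha) ^+ 2.
Proof. by move=> j0; apply: wmean_cycle_le => //; [exact: ltW | exact: nk_le]. Qed.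

Lemma wmean_ge0 k n (f : state R -> R) : (forall S, admissible k n S -> 0 <= f S) -> 0 <= wmean k n f.
Proof. by move=> f0; rewrite -(wmean_cst k n 0); apply: wmean_le. Qed.

Lemma cycle_ge0 k j : 0 <= E k (fun S => S.2 j).
Proof. by apply: wmean_ge0 => S []. Qed.

Lemma obs2 (S : state R) j : obs S j.+2 = S.1 j + S.2 j.+2.
Proof. by rewrite /obs /= !subSS subn0. Qed.

Lemma mean_cvg j :
  (fun k => E k (fun S => obs S j.+2) / (cj alpha j.+2 * k%:R)) @ \oo --> (1 : R).
Proof.
have c0 : cj alpha j.+2 != 0 :> R by rewrite /cj mulf_neq0 ?invr_eq0 ?expf_neq0.
have hC : (fun k => E k (fun S => S.2 j.+2) / k%:R) @ \oo --> (0 : R).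
  have h : (fun k => (1 + alpha) * k%:R^-1) @ \oo --> (0 : R).
    by apply: (cvg_val (mulr0 (1 + alpha))); apply: cvgM; [exact: cvg_cst | exact: cvg_inv_nat].
  apply: (squeeze_cvgr _ (cvg_cst 0) h); near=> k.
  by rewrite divr_ge0 ?cycle_ge0 //= ler_wpM2r ?invr_ge0 //; case: (cycle_le k (ltn0Sn j.+1)).
have h : (fun k => (mk k j / k%:R + E k (fun S => S.2 j.+2) / k%:R) * (cj alpha j.+2)^-1)
    @ \oo --> (cj alpha j.+2 + 0) * (cj alpha j.+2)^-1.
  apply: cvgM; last exact: cvg_cst.
  by apply: cvgD; [exact: slow_cvg (mk_slow alpha0 j) | exact: hC].
apply: (@cvg_val _ _ _ 1 _ (cvg_ext _ h)); first by rewrite addr0 divff.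
move=> k /=; rewrite (@eq_wmean _ _ _ (fun S => obs S j.+2) (fun S => S.1 j + S.2 j.+2)) => [|S _];
  last exact: obs2.
by rewrite wmeanD -/(mk k j) [(cj _ _ * _)^-1]invfM; ring.
Unshelve. all: by end_near. Qed.

Lemma wvar_le k n (f : state R -> R) c :
  wmean k n (fun S => (f S - wmean k n f) ^+ 2) <= wmean k n (fun S => (f S - c) ^+ 2).
Proof.
have -> : wmean k n (fun S => (f S - c) ^+ 2) =
    wmean k n (fun S => (f S - wmean k n f) ^+ 2) + (wmean k n f - c) ^+ 2.
  set m := wmean k n f.
  have -> : (fun S => (f S - c) ^+ 2) = (fun S => (f S - m) ^+ 2 +
      (2 * (m - c) * f S + ((m - c) ^+ 2 - 2 * (m - c) * m) * 1)).
    by apply/funext => S; ring.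
  by rewrite wmeanD (wmean_lin k n _ _ f (fun=> 1)) wmean_cst -/m; ring.
by rewrite lerDl sqr_ge0.
Qed.

Lemma var_bound j k : (j < k)%N ->
  E k (fun S => (obs S j.+2 - E k (fun S => obs S j.+2)) ^+ 2) <=
  (8 * alpha + 2 * (1 + alpha) ^+ 2) * k%:R.
Proof.
move=> jk; rewrite (le_trans (wvar_le k (nk k) _ (mk k j))) //.
apply: (@le_trans _ _ (E k (fun S => 2 * (S.1 j - mk k j) ^+ 2 + 2 * S.2 j.+2 ^+ 2))).
  apply: wmean_le => S _; rewrite obs2.
  rewrite -subr_ge0 (_ : _ - _ = (S.1 j - mk k j - S.2 j.+2) ^+ 2) ?sqr_ge0 //; ring.
rewrite (wmean_lin k _ _ _ (fun S => (S.1 j - mk k j) ^+ 2)).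
have h1 := @pvar_path R k j.+1 jk (nk k) j (ltnSn j).
have [_ h2] := cycle_le k (ltn0Sn j.+1).
have h3 := nk_le k.
have k1 : 1 <= k%:R :> R by rewrite ler1n (leq_ltn_trans _ jk).
have := ler_wpM2l (sqr_ge0 (1 + alpha)) k1.
rewrite mulr1 mulrDl -!mulrA => h4.
by move: h1 h2 h3 h4; rewrite -/(mk k j); lra.
Qed.

Lemma loops_mean_cvg :
  (fun k => E k (fun S => obs S 1%N)) @ \oo --> 2^-1 * (alpha / (1 + alpha)).
Proof.
have h := @loops_cvg R alpha alpha0 1; rewrite expr1 in h; apply: (cvg_ext _ h) => k.
by apply: eq_wmean => S _; rewrite /obs /= add0r mul1r subr0.
Qed.

Lemma loops_var_cvg :
  (fun k => E k (fun S => (obs S 1%N - E k (fun S => obs S 1%N)) ^+ 2)) @ \oo -->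
  2^-1 * (alpha / (1 + alpha)).
Proof.
set lam := _ * _.
have m1 := loops_mean_cvg; have f2 := @loops_cvg R alpha alpha0 2.
have h : (fun k => E k (fun S => ff (S.2 1%N) 2) + E k (fun S => obs S 1%N)
    - E k (fun S => obs S 1%N) * E k (fun S => obs S 1%N)) @ \oo --> lam ^+ 2 + lam - lam * lam.
  by apply: cvgB; [apply: cvgD; [exact: f2 | exact: m1] | apply: cvgM; exact: m1].
apply: (@cvg_val _ _ _ lam _ (cvg_ext _ h)); first by ring.
move=> k /=; set m := E k (fun S => obs S 1%N).
have -> : (fun S => (obs S 1%N - m) ^+ 2) = (fun S => ff (S.2 1%N) 2 +
    ((1 - 2 * m) * obs S 1%N + m ^+ 2 * 1)).
  by apply/funext => S; rewrite /obs /=; ring.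
by rewrite wmeanD (wmean_lin k _ _ _ (fun S => obs S 1%N) (fun=> 1)) wmean_cst -/m; ring.
Qed.

Lemma pvar_covk k d u :
  pvar k d (nk k) u = \sum_(i < d) \sum_(j < d) u i * u j * covk alpha k i j.
Proof.
rewrite /pvar.
have -> : (fun S => centered k d (nk k) u S ^+ 2) = (fun S => \sum_(i < d) \sum_(j < d)
    u i * u j * ((S.1 i - mk k i) * (S.1 j - mk k j))).
  apply/funext => S; rewrite /centered /dot -sumrB expr2 mulr_suml; apply: eq_bigr => i _.
  by rewrite mulr_sumr; apply: eq_bigr => j _; rewrite /mk /pmean; ring.
rewrite wmean_sum; apply: eq_bigr => i _; rewrite wmean_sum; apply: eq_bigr => j _.
rewrite wmeanZ; congr (_ * _); rewrite /covk.
have -> : (fun S : state R => (S.1 i - mk k i) * (S.1 j - mk k j)) = (fun S => S.1 i * S.1 j +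
   (- mk k j * S.1 i + (- mk k i * S.1 j + mk k i * mk k j * 1))).
  by apply/funext => S; ring.
rewrite wmeanD wmeanD wmeanZ.
rewrite (wmean_lin k _ _ _ (fun S => S.1 j) (fun=> 1)) wmean_cst -/(mk k i) -/(mk k j).
by rewrite -/(mk k i) -/(mk k j); ring.
Qed.

Lemma cvg_sum_ord d (f : 'I_d -> nat -> R) (l : 'I_d -> R) :
  (forall i, f i @ \oo --> l i) ->
  (fun k => \sum_i f i k) @ \oo --> \sum_i l i.
Proof.
elim: d f l => [|d IH] f l fl.
  rewrite big_ord0; apply: (@cvg_ext _ (fun=> 0)); last exact: cvg_cst.
  by move=> k; rewrite big_ord0.
rewrite big_ord_recl; apply: (@cvg_ext _ (fun k => f ord0 k + \sum_i f (lift ord0 i) k)).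
  by move=> k; rewrite big_ord_recl.
by apply: cvgD => //; apply: (IH (fun i => f (lift ord0 i)) (fun i => l (lift ord0 i))).
Qed.

Lemma cos_lipschitz (x y : R) : `|cos x - cos y| <= `|x - y|.
Proof.
wlog yx : x y / y <= x.
  by move=> H; have [/H//|/ltW/H] := leP y x; rewrite distrC => h; rewrite (distrC x).
have cc : {within `[y, x], continuous (@cos R)}.
  by apply: continuous_subspaceT => z; exact: continuous_cos.
have [c _ ->] := MVT_segment yx (fun z _ => is_derive_cos z) cc.
by rewrite normrM normrN ler_piMl // sin_max.
Qed.

Section quadratic_form.
Variables (d : nat) (t : 'rV[R]_d).

Definition rvfun (a : nat) : R := if insub a is Some i then t ord0 i else 0.

Lemma rvfunE (i : 'I_d) : rvfun i = t ord0 i.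
Proof. by rewrite /rvfun valK. Qed.

Definition Hform : R := \sum_(i < d) \sum_(j < d) t ord0 i * t ord0 j * Hij alpha i.+2 j.+2.

Lemma Hform_cvg : (fun k => pvar k d (nk k) (fun a => (Num.sqrt k%:R)^-1 * rvfun a)) @ \oo --> Hform.
Proof.
apply: (@cvg_ext _ (fun k => \sum_(i < d) \sum_(j < d) t ord0 i * t ord0 j * (covk alpha k i j / k%:R))).
  move=> k; rewrite pvar_covk; apply: eq_bigr => i _; apply: eq_bigr => j _.
  rewrite !rvfunE; have -> : k%:R^-1 = (Num.sqrt k%:R)^-1 * (Num.sqrt k%:R)^-1 :> R.
    by rewrite -invfM -expr2 sqr_sqrtr.
  by ring.
apply: cvg_sum_ord => i; apply: cvg_sum_ord => j.
by apply: cvgM; [exact: cvg_cst | exact: cov_cvg].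
Qed.

(** A limit of variances is nonnegative; the positive semi-definiteness of [Hmat] rests on this, not
    on its formula. *)
Lemma Hform_ge0 : 0 <= Hform.
Proof.
apply: (ler_cvg_to (cvg_cst 0) Hform_cvg); apply: nearW => k.
by apply: wmean_ge0 => S _; rewrite sqr_ge0.
Qed.

Definition tau : R := \sum_(i < d) `|t ord0 i|.

Lemma tau_ge0 : 0 <= tau. Proof. exact: sumr_ge0. Qed.

Lemma rvfun_le a : `|rvfun a| <= tau.
Proof.
rewrite /rvfun; case: insubP => [i _ _|_]; last by rewrite normr0 tau_ge0.
by rewrite /tau (bigD1 i) //= lerDl sumr_ge0.
Qed.

Definition proj_obs k (S : state R) : R :=
  \sum_(i < d) t ord0 i * ((obs S i.+2 - cj alpha i.+2 * k%:R) / Num.sqrt k%:R).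

Let eps k : R := (Num.sqrt k%:R)^-1.
Let u k : nat -> R := fun a => eps k * rvfun a.

(** Two replacements: cycles are dropped, at cost [eps k * (1 + alpha)], and [cj alpha i.+2 * k] is
    exchanged for the exact mean, at a cost that [slow] makes small. *)
Lemma proj_obs_dist k : (0 < k)%N ->
  E k (fun S => `|proj_obs k S - centered k d (nk k) (u k) S|) <=
  \sum_(i < d) `|t ord0 i| * (eps k * (1 + alpha)
     + `|Num.sqrt k%:R * (mk k i / k%:R - cj alpha i.+2)|).
Proof.
move=> k0; have s0 : 0 < Num.sqrt (k%:R : R) by rewrite sqrtr_gt0 ltr0n.
have e0 : 0 < eps k by rewrite invr_gt0.
have epsE (x c : R) : eps k * (x - c * k%:R) = Num.sqrt k%:R * (x / k%:R - c).
  have fld (s y : R) : s != 0 -> y = s ^+ 2 -> s^-1 * (x - c * y) = s * (x / y - c).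
    by move=> s1 ->; field.
  by apply: fld; rewrite ?gt_eqF // sqr_sqrtr.
apply: (@le_trans _ _ (E k (fun S => \sum_(i < d) `|t ord0 i| * (eps k * S.2 i.+2
     + `|Num.sqrt k%:R * (mk k i / k%:R - cj alpha i.+2)| * 1)))).
  apply: wmean_le => S [_ c0 _ _].
  rewrite /centered /dot -sumrB /proj_obs -sumrB (le_trans (ler_norm_sum _ _ _)) //.
  apply: ler_sum => i _; rewrite /u rvfunE obs2 -epsE.
  rewrite (_ : t ord0 i * _ - _ = t ord0 i * (eps k * S.2 i.+2 +
     eps k * (mk k i - cj alpha i.+2 * k%:R))); last first.
    by rewrite -/(eps k) -/(pmean R k (nk k) i) -/(mk k i) /mk /pmean; ring.
  rewrite normrM ler_wpM2l // mulr1 (le_trans (ler_normD _ _)) // lerD2r.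
  by rewrite ger0_norm // mulr_ge0 // ltW.
rewrite wmean_sum; apply: ler_sum => i _; rewrite wmeanZ ler_wpM2l //.
rewrite (wmean_lin k _ _ _ (fun S => S.2 i.+2) (fun=> 1)) wmean_cst mulr1 lerD2r.
by rewrite ler_wpM2l ?(ltW e0) //; case: (cycle_le k (ltn0Sn i.+1)).
Qed.

Lemma cos_proj_cvg s :
  (fun k => E k (fun S => cos (proj_obs k S + s))) @ \oo --> expR (- (Hform / 2)) * cos s.
Proof.
have ceps : eps @ \oo --> (0 : R) by exact: cvg_inv_sqrt.
pose A k := \sum_(i < d) `|t ord0 i| * (eps k * (1 + alpha)
     + `|Num.sqrt k%:R * (mk k i / k%:R - cj alpha i.+2)|).
have cA : A @ \oo --> (0 : R).
  apply: (@cvg_val _ _ (\sum_(i < d) `|t ord0 i| * (0 * (1 + alpha) + `|0 : R|))).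
    by rewrite big1 // => i _; rewrite mul0r normr0 addr0 mulr0.
  apply: cvg_sum_ord => i; apply: cvgM; first exact: cvg_cst.
  apply: cvgD; first by apply: cvgM => //; exact: cvg_cst.
  by apply: cvg_norm; exact: mk_slow.
(* The bound of [cos_clt] with [eta = tau * eps k] and [n <= alpha * k = alpha / eps k ^+ 2]. *)
pose B k := alpha * eps k * (128 * tau ^+ 3 + 6 * d%:R ^+ 2 * (4 * alpha + 1) * tau ^+ 2
   + 4 * tau ^+ 4 * eps k).
have cB : B @ \oo --> (0 : R).
  apply: (@cvg_val _ _ (alpha * 0 * (128 * tau ^+ 3 + 6 * d%:R ^+ 2 * (4 * alpha + 1) * tau ^+ 2
   + 4 * tau ^+ 4 * 0))); first by rewrite mulr0 mul0r.
  apply: cvgM; first by apply: cvgM => //; exact: cvg_cst.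
  by apply: cvgD; [exact: cvg_cst | apply: cvgM => //; exact: cvg_cst].
pose L k := expR (- (pvar k d (nk k) (u k) / 2)) * cos s.
have cL : L @ \oo --> expR (- (Hform / 2)) * cos s.
  apply: cvgM; last exact: cvg_cst.
  apply: continuous_cvg; first exact: continuous_expR.
  apply: cvgN; apply: cvgM; last exact: cvg_cst.
  exact: Hform_cvg.
have cteps : (fun k => tau * eps k) @ \oo --> (0 : R).
  by apply: (cvg_val (mulr0 tau)); apply: cvgM => //; exact: cvg_cst.
suff h : (fun k => E k (fun S => cos (proj_obs k S + s)) - L k) @ \oo --> (0 : R).
  have h' : (fun k => E k (fun S => cos (proj_obs k S + s)) - L k + L k) @ \oo -->
      0 + expR (- (Hform / 2)) * cos s by apply: cvgD; [exact: h | exact: cL].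
  apply: (@cvg_val _ _ _ _ (add0r _) (cvg_ext _ h')) => k; exact: subrK.
apply: norm_cvg0.
have cAB : (fun k => A k + B k) @ \oo --> (0 : R).
  by apply: (cvg_val (addr0 0)); apply: cvgD; [exact: cA | exact: cB].
apply: (squeeze_cvgr _ (cvg_cst 0) cAB); near=> k.
rewrite normr_ge0 /=.
have k0 : (0 < k)%N by near: k; exists 1%N.
have dk : (d <= k)%N by near: k; exists d.
have te1 : tau * eps k <= 1.
  by near: k; apply: (cvgr_le _ cteps); exact: ltr01.
have s0 : 0 < Num.sqrt (k%:R : R) by rewrite sqrtr_gt0 ltr0n.
have e0 : 0 < eps k by rewrite invr_gt0.
have ek : eps k ^+ 2 * k%:R = 1.
  by rewrite /eps -[X in _ * X]sqr_sqrtr // exprVn mulVf // expf_neq0 // gt_eqF.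
have te0 : 0 <= tau * eps k by rewrite mulr_ge0 ?tau_ge0 // ltW.
have su : supported d (u k).
  by move=> a da; rewrite /u /rvfun insubF ?mulr0 // ltnNge da.
have ue a : `|u k a| <= tau * eps k.
  by rewrite /u normrM (ger0_norm (ltW e0)) mulrC ler_wpM2r ?rvfun_le // ltW.
have te : 0 <= tau * eps k <= 1 by rewrite te0 te1.
have := cos_clt dk e0 ek s te su ue (nk_le k).
set c := _ + _ + _ => H.
set X := centered k d (nk k) (u k) in H.
rewrite -(subrKA (E k (fun S => cos (X S + s)))) (le_trans (ler_normD _ _)) // lerD //.
  rewrite (le_trans _ (proj_obs_dist k0)) //.
  have -> : E k (fun S => cos (proj_obs k S + s)) - E k (fun S => cos (X S + s)) =
     E k (fun S => cos (proj_obs k S + s) + (-1) * cos (X S + s)).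
    by rewrite wmeanD wmeanZ mulN1r.
  rewrite (le_trans (wmean_norm _ _ _)) //; apply: wmean_le => S _.
  rewrite mulN1r (le_trans (cos_lipschitz _ _)) //.
  by rewrite [X in `|X|](_ : _ = proj_obs k S - X S) //; ring.
rewrite (le_trans H) //.
have c0 : 0 <= c.
  by rewrite /c !addr_ge0 ?mulr_ge0 ?exprn_ge0 ?tau_ge0 ?addr_ge0 ?mulr_ge0 // ltW.
rewrite (le_trans (ler_wpM2r c0 (nk_le k))) //.
have -> : k%:R = (eps k ^+ 2)^-1.
  have e2 : eps k ^+ 2 != 0 by rewrite expf_neq0 // gt_eqF.
  by apply: (mulfI e2); rewrite ek divff.
by rewrite /c /B le_eqVlt; apply/orP; left; apply/eqP; field; rewrite gt_eqF.
Unshelve. all: by end_near. Qed.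

End quadratic_form.

End limit_laws.

(** * Poisson limit of the number of loops *)

Section poisson_limit.
Variables (R : realType).

(** Dominated convergence for series, with a range of summation that grows with [k]: the tail of [g]
    controls the terms beyond a fixed [N], and the finitely many others converge. *)
Lemma tannery (a : nat -> nat -> R) (b g : nat -> R) (M : nat -> nat) (l : R) :
  cvgn (series g) -> (\forall k \near \oo, forall i, `|a k i| <= g i) ->
  (forall i, (fun k => a k i) @ \oo --> b i) -> (forall k, (k <= M k)%N) ->
  series b @ \oo --> l -> (fun k => \sum_(i < M k) a k i) @ \oo --> l.
Proof.
move=> /cvg_ex[G cG] ag ab kM bl; apply/cvgrPdist_le => e e0.
have e4 : 0 < e / 4 by rewrite divr_gt0.
have : \forall N \near \oo, `|G - series g N| <= e / 4 by move/cvgrPdist_le : cG; apply.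
have : \forall N \near \oo, `|l - series b N| <= e / 4 by move/cvgrPdist_le : bl; apply.
move=> -[N1 _ H1] [N2 _ H2]; pose N := maxn N1 N2.
have hb := H1 N (leq_maxl _ _).
have hg m : (N <= m)%N -> `|G - series g m| <= e / 4.
  by move=> Nm; apply: H2 => /=; apply: leq_trans Nm; exact: leq_maxr.
have cN : (fun k => \sum_(i < N) a k i) @ \oo --> \sum_(i < N) b i.
  exact: (@cvg_sum_ord R N (fun i k => a k i) (fun i => b i)).
have hN : \forall k \near \oo, `|\sum_(i < N) b i - \sum_(i < N) a k i| <= e / 4.
  by move/cvgrPdist_le : cN; apply.
near=> k.
have Nk : (N <= M k)%N by apply: leq_trans (kM k); near: k; exists N.
have gk : forall i, `|a k i| <= g i by near: k.
have hNk : `|\sum_(i < N) b i - \sum_(i < N) a k i| <= e / 4 by near: k.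
have tail : `|\sum_(i < M k) a k i - \sum_(i < N) a k i| <= e / 4 + e / 4.
  rewrite -!(big_mkord xpredT (a k)) (big_cat_nat (n := N)) //= addrAC subrr add0r.
  rewrite (le_trans (ler_norm_sum _ _ _)) //.
  apply: (@le_trans _ _ (\sum_(N <= i < M k) g i)); first exact: ler_sum.
  have -> : \sum_(N <= i < M k) g i = (G - series g N) - (G - series g (M k)).
    by rewrite /series /= [X in _ = _ - (_ - X)](big_cat_nat (n := N)) //=; ring.
  rewrite (le_trans (ler_norm _)) // (le_trans (ler_normB _ _)) // lerD //; exact: hg.
rewrite /series /= big_mkord in hb.
have -> : l - \sum_(i < M k) a k i = (l - \sum_(i < N) b i)
   + (\sum_(i < N) b i - \sum_(i < N) a k i)
   - (\sum_(i < M k) a k i - \sum_(i < N) a k i) by ring.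
rewrite (le_trans (ler_normB _ _)) // (le_trans (lerD (ler_normD _ _) tail)) //.
apply: (@le_trans _ _ (e / 4 + e / 4 + (e / 4 + e / 4))); first by rewrite lerD2r lerD.
by rewrite le_eqVlt; apply/orP; left; apply/eqP; field.
Unshelve. all: by end_near. Qed.

Lemma exp_coeffE (x : R) n : exp_coeff x n = x ^+ n / n`!%:R.
Proof. by []. Qed.

Lemma ff_nat (c r : nat) : ff (c%:R : R) r = (c ^_ r)%:R.
Proof.
elim: r => [|r IH]; first by rewrite ffactn0.
rewrite /= IH ffactnSr natrM; have [rc|cr] := leqP r c; first by rewrite natrB.
by rewrite ffact_small // !mul0r.
Qed.

Lemma alternating_bin (m M : nat) : (m < M)%N ->
  \sum_(i < M) (-1) ^+ i * 'C(m, i)%:R = (m == 0%N)%:R :> R.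
Proof.
move=> mM; transitivity (((1 : R) - 1) ^+ m); last by rewrite subrr expr0n.
rewrite exprBn (big_ord_widen M (fun i => (-1) ^+ i * 1 ^+ (m - i) * 1 ^+ i *+ 'C(m, i)) mM).
rewrite [RHS]big_mkcond /=; apply: eq_bigr => i _; rewrite !expr1n !mulr1.
by case: ltnP => mi; [rewrite mulr_natr | rewrite bin_small ?mulr0].
Qed.

(** Inversion of factorial moments: [ff c (r + i) / (r! i!)] is ['C(c, r) * 'C(c - r, i)], whose
    alternating sum over [i] is ['C(c, r) * (1 - 1) ^+ (c - r)]. *)
Lemma indicator_ff (c r M : nat) : (c < M)%N ->
  (c == r)%:R = \sum_(i < M) (-1) ^+ i / (r`!%:R * i`!%:R) * ff (c%:R : R) (r + i).
Proof.
move=> cM; have [cr|rc] := ltnP c r.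
  rewrite (ltn_eqF cr) big1 // => i _.
  by rewrite ff_nat ffact_small ?mulr0 // ltn_addr.
rewrite (eq_bigr (fun i : 'I_M => 'C(c, r)%:R * ((-1) ^+ i * 'C(c - r, i)%:R))); last first.
  move=> i _; rewrite ffD -natrB // !ff_nat -!bin_ffact !natrM.
  have f0 n : n`!%:R != 0 :> R by rewrite pnatr_eq0 -lt0n fact_gt0.
  by field; rewrite !f0.
rewrite -mulr_sumr alternating_bin; last exact: leq_ltn_trans (leq_subr _ _) cM.
have [->|cr] := eqVneq c r; first by rewrite binn subnn mulr1.
by rewrite subn_eq0 leqNgt ltn_neqAle eq_sym cr rc mulr0.
Qed.

Variable (alpha : R).
Hypothesis alpha0 : 0 < alpha.
Local Notation nk := (nk alpha).
Local Notation E k := (@wmean R k (nk k)).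
Local Notation lam := (2^-1 * (alpha / (1 + alpha))).

Lemma loops_lt k (S : state R) c : admissible k (nk k) S -> S.2 1%N = c%:R -> (c < (nk k + k).+1)%N.
Proof.
case=> p0 c0 _ /(_ (nk k + 2 * k).+2 (leqW (ltnSn _))) tot S1.
rewrite ltnS -(ler_nat R) -S1 -tot ler_wpDl ?sumr_ge0 // => [a _|]; first by rewrite mulr_ge0.
rewrite big_ord_recl /= mul0r add0r big_ord_recl /= mul1r lerDl.
by apply: sumr_ge0 => j _; rewrite mulr_ge0.
Qed.

Definition ffmean k r : R := E k (fun S => ff (S.2 1%N) r).

(** A domination uniform in [r]: once [k >= 1], [nk k] is at most [yn], so the factors of the
    numerator do not exceed those of the denominator; for [r > nk k] the numerator is zero. *)
Lemma ffmean_bound k r : (0 < k)%N -> `|ffmean k r| <= 1.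
Proof.
move=> k0; rewrite /ffmean wmean_loops /aseq /afrac addn0.
rewrite normrM ger0_norm ?exprn_ge0 ?invr_ge0 // mulr_ile1 ?exprn_ge0 ?invr_ge0 //.
  by rewrite exprn_ile1 ?invr_ge0 // invf_le1 ?ler1n.
have [rn|nr] := leqP r (nk k); last by rewrite ff_nat ffact_small // mul0r normr0.
have : 0 <= ff ((nk k)%:R : R) r <= ff (yn R k (nk k)) r /\ 0 < ff (yn R k (nk k)) r.
  elim: r rn => [|r IH] rn; first by rewrite /= ltr01 ler01 lexx.
  have [/andP[h1 h2] h3] := IH (ltnW rn); rewrite /=.
  have nr : r%:R + 1 <= (nk k)%:R :> R by rewrite natr1 ler_nat.
  have ny : (nk k)%:R <= yn R k (nk k).
    have : 1 <= k%:R :> R by rewrite ler1n.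
    by rewrite /yn /bn natrD; lra.
  split; last by rewrite mulr_gt0 //; lra.
  by rewrite mulr_ge0 ?ler_pM //; lra.
case=> /andP[h1 h2] h3; rewrite ger0_norm ?divr_ge0 // ?ler_pdivrMr ?mul1r //.
exact: ltW.
Qed.

Lemma ffmean_cvg r : (fun k => ffmean k r) @ \oo --> lam ^+ r.
Proof. exact: loops_cvg. Qed.

Lemma lam_gt0 : 0 < lam.
Proof. by rewrite mulr_gt0 ?invr_gt0 // divr_gt0 // addr_gt0. Qed.

(* Probability of exactly [r] loops, by inclusion-exclusion over the factorial moments *)
Definition loops_prob k r : R := \sum_(i < (nk k + k).+1)
  (-1) ^+ i / (r`!%:R * i`!%:R) * ffmean k (r + i).

Lemma loops_prob_bound k r : (0 < k)%N -> `|loops_prob k r| <= expR 1 * exp_coeff 1 r.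
Proof.
move=> k0; rewrite (le_trans (ler_norm_sum _ _ _)) //.
apply: (@le_trans _ _ (\sum_(i < (nk k + k).+1) exp_coeff 1 r * exp_coeff 1 i)).
  apply: ler_sum => i _; have := ffmean_bound (r + i) k0; move: (ffmean k _) => z z1.
  rewrite !normrM normrX normrN1 expr1n mul1r normfV [`|_ * _|]ger0_norm ?mulr_ge0 //.
  by rewrite !exp_coeffE !expr1n !mul1r invfM ler_piMr ?mulr_ge0 ?invr_ge0.
rewrite -mulr_sumr mulrC; apply: ler_wpM2r; first by rewrite exp_coeffE divr_ge0 ?exprn_ge0.
have nd : nondecreasing_seq (series (@exp_coeff R 1)).
  by apply: nondecreasing_series => i _ _; rewrite divr_ge0 ?exprn_ge0.
have := nondecreasing_cvgn_le nd (is_cvg_series_exp_coeff 1) (nk k + k).+1.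
by rewrite /series /= big_mkord.
Qed.

Lemma loops_prob_cvg r : (fun k => loops_prob k r) @ \oo --> poisson_pmf lam r.
Proof.
(* Here the series runs over the inclusion-exclusion index and is dominated by [exp_coeff 1 i], that
   is [1 / i!]. *)
apply: (@tannery (fun k i => (-1) ^+ i / (r`!%:R * i`!%:R) * ffmean k (r + i))
  (fun i => (-1) ^+ i / (r`!%:R * i`!%:R) * lam ^+ (r + i)) (exp_coeff 1)).
- exact: is_cvg_series_exp_coeff.
- exists 1%N => // k /= k0 i; have := ffmean_bound (r + i) k0; move: (ffmean k _) => z z1.
  rewrite !normrM normrX normrN1 expr1n mul1r.
  rewrite normfV [`|_ * _|]ger0_norm ?mulr_ge0 // !exp_coeffE expr1n mul1r -[leRHS]mulr1.
  rewrite ler_pM ?invr_ge0 ?mulr_ge0 // lef_pV2 ?posrE ?mulr_gt0 ?ltr0n ?fact_gt0 //.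
  by rewrite ler_peMl // ler1n fact_gt0.
- by move=> i; apply: cvgM; [exact: cvg_cst | exact: ffmean_cvg].
- by move=> k; rewrite ltnW // ltnS leq_addl.
rewrite /poisson_pmf lam_gt0.
have h : (fun N => lam ^+ r / r`!%:R * series (exp_coeff (- lam)) N) @ \oo -->
    lam ^+ r / r`!%:R * expR (- lam).
  by apply: cvgM; [exact: cvg_cst | exact: is_cvg_series_exp_coeff].
apply: (cvg_ext _ h) => N; rewrite /series /= mulr_sumr; apply: eq_bigr => i _.
have f0 n : n`!%:R != 0 :> R by rewrite pnatr_eq0 -lt0n fact_gt0.
have fld (x y z p q : R) : p != 0 -> q != 0 -> x / p * (z * y / q) = z / (p * q) * (x * y).
  by move=> p0 q0; field; rewrite p0 q0.
by rewrite exp_coeffE exprD [(- lam) ^+ i]exprNn; apply: fld.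
Qed.

Lemma loops_law k (f : R -> R) :
  E k (fun S => f (obs S 1%N)) = \sum_(r < (nk k + k).+1) f r%:R * loops_prob k r.
Proof.
transitivity (E k (fun S => \sum_(r < (nk k + k).+1) f r%:R *
   (\sum_(i < (nk k + k).+1) (-1) ^+ i / (r`!%:R * i`!%:R) * ff (S.2 1%N) (r + i)))).
  apply: eq_wmean => S adm; have [_ _ [c cE] _] := adm.
  have cM := loops_lt adm cE.
  rewrite /obs /= add0r cE (bigD1 (Ordinal cM)) //= -(indicator_ff _ cM) eqxx mulr1.
  rewrite big1 ?addr0 // => r; rewrite -val_eqE /= => rc.
  by rewrite -(indicator_ff _ cM) eq_sym (negbTE rc) mulr0.
rewrite wmean_sum; apply: eq_bigr => r _; rewrite wmeanZ wmean_sum; congr (_ * _).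
by apply: eq_bigr => i _; rewrite wmeanZ.
Qed.

Theorem loops_poisson (f : R -> R) : (exists M, forall x, `|f x| <= M) ->
  (fun k => E k (fun S => f (obs S 1%N))) @ \oo --> poissonE lam f.
Proof.
move=> [M fM]; have M0 : 0 <= M by rewrite (le_trans _ (fM 0)).
apply: (@cvg_ext _ (fun k => \sum_(r < (nk k + k).+1) f r%:R * loops_prob k r)).
  by move=> k; rewrite loops_law.
pose b r := f r%:R * poisson_pmf lam r : R.
have dom r : `|b r| <= M * exp_coeff lam r.
  rewrite normrM ler_pM // ger0_norm ?poisson_pmf_ge0 // /poisson_pmf lam_gt0 !exp_coeffE.
  rewrite ler_piMr ?divr_ge0 ?exprn_ge0 ?(ltW lam_gt0) //.
  by rewrite expR_le1 oppr_le0 ltW // lam_gt0.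
(* Second passage to the limit, now over the number of loops, dominated through [loops_prob_bound]
   by a multiple of [1 / r!]. *)
apply: (@tannery (fun k r => f r%:R * loops_prob k r) b
  (fun r => M * (expR 1 * exp_coeff 1 r)) (fun k => (nk k + k).+1)).
- have -> : series (fun r => M * (expR 1 * exp_coeff 1 r)) =
     (fun N => M * expR 1 * series (exp_coeff 1) N).
    by apply/funext => N; rewrite /series /= mulr_sumr; apply: eq_bigr => i _; rewrite mulrA.
  by apply: is_cvgM; [exact: is_cvg_cst | exact: is_cvg_series_exp_coeff].
- by exists 1%N => // k /= k0 i; rewrite normrM ler_pM // loops_prob_bound.
- by move=> r; apply: cvgM; [exact: cvg_cst | exact: loops_prob_cvg].
- by move=> k; rewrite ltnW // ltnS leq_addl.
have cb : cvgn (series b).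
  apply: normed_cvg; apply: (series_le_cvg _ _ dom) => //.
    move=> r; rewrite mulr_ge0 // !exp_coeffE divr_ge0 ?exprn_ge0 // ltW //; exact: lam_gt0.
  have -> : series (fun r => M * exp_coeff lam r) = (fun N => M * series (exp_coeff lam) N).
    by apply/funext => N; rewrite /series /= mulr_sumr.
  by apply: is_cvgM; [exact: is_cvg_cst | exact: is_cvg_series_exp_coeff].
have -> : poissonE lam f = limn (series b).
  rewrite /poissonE; congr (lim (_ @ \oo)); apply/funext => N.
  by rewrite /series /= big_mkord; apply: eq_bigr => i _; rewrite mulrC.
exact: cb.
Qed.

End poisson_limit.

(** * Standard Gaussian vectors *)

Section gauss1.
Variable R : realType.
Local Notation mu := (@lebesgue_measure R).
Local Notation phi := (@normal_pdf R 0 1).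
Implicit Types (h : R -> R).

Lemma seq_continuous h :
  (forall (u : nat -> R) x, u @ \oo --> x -> (fun n => h (u n)) @ \oo --> h x) -> continuous h.
Proof. by move=> hu x; apply/(@cvg_nbhsP _ R^o) => u; exact: hu. Qed.

Lemma Rintegral_dct (f_ : nat -> R -> R) (f g : R -> R) :
  (forall n, measurable_fun setT (f_ n)) -> measurable_fun setT f ->
  mu.-integrable setT (EFin \o g) ->
  (forall n x, `|f_ n x| <= g x) ->
  (forall x, (fun n => f_ n x) @ \oo --> f x) ->
  (fun n => \int[mu]_x f_ n x) @ \oo --> \int[mu]_x f x.
Proof.
move=> mf_ mf ig fg ff; apply: fine_cvg.
have mE (h : R -> R) : measurable_fun setT h -> measurable_fun setT (EFin \o h).
  by move=> mh; apply/measurable_EFinP.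
have [intf _ h] : [/\ mu.-integrable setT (EFin \o f),
   (fun n => \int[mu]_(x in setT) `|(f_ n x)%:E - (f x)%:E|)%E @ \oo --> 0%E &
   (fun n => \int[mu]_(x in setT) (f_ n x)%:E)%E @ \oo --> (\int[mu]_(x in setT) (f x)%:E)%E].
  apply: (@dominated_convergence _ _ _ mu setT measurableT
    (fun n x => (f_ n x)%:E) (fun x => (f x)%:E) (EFin \o g)) => //.
  - by move=> n; exact: mE.
  - exact: mE.
  - by apply: aeW => x _; apply: cvg_EFin; [exact: nearW | exact: ff].
  - by apply: aeW => x n _; rewrite /= lee_fin.
by rewrite /Rintegral fineK //; exact: integrable_fin_num.
Qed.

Lemma phi_ge0 x : 0 <= phi x. Proof. exact: normal_pdf_ge0. Qed.

Lemma phi_integrable : mu.-integrable setT (EFin \o phi).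
Proof. exact: integrable_normal_pdf. Qed.

Lemma Rintegral_phi : \int[mu]_x phi x = 1.
Proof. by rewrite /Rintegral integral_normal_pdf. Qed.

Lemma measurable_phi : measurable_fun setT phi.
Proof. exact: measurable_normal_pdf. Qed.

Lemma integrable_le (f g : R -> R) : measurable_fun setT f ->
  mu.-integrable setT (EFin \o g) -> (forall x, `|f x| <= g x) ->
  mu.-integrable setT (EFin \o f).
Proof.
move=> mf ig fg; apply: (@le_integrable _ _ _ mu setT measurableT _ (EFin \o g)) => //.
  exact/measurable_EFinP.
by move=> x _ /=; rewrite lee_fin (le_trans (fg x)) // ler_norm.
Qed.

Definition gE h : R := \int[mu]_x (phi x * h x).

Section bounded.
Variables (M : R).
Definition bc h := continuous h /\ forall x, `|h x| <= M.

Lemma bc_measurable h : bc h -> measurable_fun setT (fun x => phi x * h x).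
Proof.
by move=> [ch _]; apply: measurable_funM; [exact: measurable_phi | exact: continuous_measurable_fun].
Qed.

Lemma bc_dominated h x : bc h -> `|phi x * h x| <= M * phi x.
Proof. by move=> [_ hM]; rewrite normrM ger0_norm ?phi_ge0 // mulrC ler_wpM2r ?phi_ge0. Qed.

Lemma Mphi_integrable : mu.-integrable setT (EFin \o (fun x => M * phi x)).
Proof. exact: (integrableZl measurableT M phi_integrable). Qed.

Lemma bc_integrable h : bc h -> mu.-integrable setT (EFin \o (fun x => phi x * h x)).
Proof.
move=> bh; apply: (integrable_le (bc_measurable bh) Mphi_integrable) => x.
exact: bc_dominated.
Qed.

Lemma gE_bound h : bc h -> `|gE h| <= M.
Proof.
move=> bh; rewrite (le_trans (le_normr_Rintegral measurableT (bc_integrable bh))) //.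
have -> : M = \int[mu]_x (M * phi x).
  by rewrite (RintegralZl M measurableT phi_integrable) Rintegral_phi mulr1.
apply: (le_Rintegral measurableT (integrable_norm (bc_integrable bh)) Mphi_integrable).
by move=> x _; exact: bc_dominated.
Qed.

Lemma gE_cvg (f_ : nat -> R -> R) f : (forall n, bc (f_ n)) -> bc f ->
  (forall x, (fun n => f_ n x) @ \oo --> f x) -> (fun n => gE (f_ n)) @ \oo --> gE f.
Proof.
move=> bf_ bf ff; apply: (@Rintegral_dct _ _ (fun x => M * phi x)).
- by move=> n; exact: bc_measurable.
- exact: bc_measurable.
- exact: Mphi_integrable.
- by move=> n x; exact: bc_dominated.
- by move=> x; apply: cvgM; [exact: cvg_cst | exact: ff].
Qed.

Lemma gE_le h h' : bc h -> bc h' -> (forall x, h x <= h' x) -> gE h <= gE h'.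
Proof.
move=> bh bh' hh'; apply: le_Rintegral; [by []|exact: bc_integrable|exact: bc_integrable|].
by move=> x _; rewrite ler_wpM2l ?phi_ge0.
Qed.

Lemma gE_lin h h' a b : bc h -> bc h' ->
  gE (fun x => a * h x + b * h' x) = a * gE h + b * gE h'.
Proof.
move=> bh bh'; have ih := bc_integrable bh; have ih' := bc_integrable bh'.
rewrite /gE -(RintegralZl a measurableT ih) -(RintegralZl b measurableT ih').
rewrite -RintegralD //; last 2 first.
- exact: (integrableZl measurableT a ih).
- exact: (integrableZl measurableT b ih').
by apply: eq_Rintegral => x _; ring.
Qed.

End bounded.

Lemma gE_cst c : gE (fun=> c) = c.
Proof.
rewrite /gE; transitivity (\int[mu]_x (c * phi x)).
  by apply: eq_Rintegral => x _; rewrite mulrC.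
by rewrite (RintegralZl c measurableT phi_integrable) Rintegral_phi mulr1.
Qed.

Lemma phiE x : phi x = normal_peak 1 * expR (- (x ^+ 2 / 2)).
Proof. by rewrite normal_pdfE ?oner_neq0 // /normal_fun subr0 expr1n mulNr. Qed.

Lemma is_derive_phi x : is_derive x (1 : R) phi (- x * phi x).
Proof.
rewrite (_ : phi = fun x => normal_peak 1 * expR (- (x ^+ 2 / 2))); last first.
  by apply/funext => y; exact: phiE.
apply: is_derive_eq; rewrite /GRing.scale /=; by field.
Qed.

Lemma continuous_phi : continuous phi.
Proof. by apply: continuous_normal_pdf; exact: oner_neq0. Qed.

Lemma xphi_integrable : mu.-integrable setT (EFin \o (fun x => `|x| * phi x)).
Proof.
(* Comparison with the centred density of standard deviation 2: [|x| expR (- x^2 / 2) <= 2 expR (-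
   x^2 / 8)], because [expR (3 x^2 / 8) >= 1 + 3 x^2 / 8 >= |x| / 2]. *)
pose c := 2 * normal_peak 1 / normal_peak 2 : R.
have ic : mu.-integrable setT (EFin \o (fun x => c * normal_pdf 0 2 x)).
  exact: (integrableZl measurableT c (integrable_normal_pdf 0 2)).
apply: (integrable_le _ ic).
  by apply: measurable_funM; [exact: normr_measurable | exact: measurable_phi].
move=> x; rewrite normrM normr_id (ger0_norm (phi_ge0 x)) phiE.
have two : (2 : R) != 0 by [].
have p1 : 0 < normal_peak 1 :> R by apply: normal_peak_gt0; exact: oner_neq0.
have p2 : 0 < normal_peak 2 :> R by apply: normal_peak_gt0.
have -> : c * normal_pdf 0 2 x = normal_peak 1 * (2 * expR (- (x ^+ 2 / 8))).
  rewrite normal_pdfE // /normal_fun subr0 /c.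
  have -> : - x ^+ 2 / (2 ^+ 2 *+ 2) = - (x ^+ 2 / 8) by field.
  by field; rewrite gt_eqF.
rewrite mulrCA ler_pM2l //.
have -> : - (x ^+ 2 / 2) = - (x ^+ 2 / 8) + - (3 * x ^+ 2 / 8) by field.
rewrite expRD mulrCA [leRHS]mulrC ler_pM2l ?expR_gt0 //.
rewrite expRN ler_pdivrMr ?expR_gt0 //.
apply: (@le_trans _ _ (2 * (1 + 3 * x ^+ 2 / 8))); last by rewrite ler_pM2l // expR_ge1Dx.
rewrite -(real_normK (num_real x)); move: `|x| => y.
rewrite -subr_ge0 (_ : _ - y = 3 / 4 * (y - 2 / 3) ^+ 2 + 5 / 3); last by field.
by have := sqr_ge0 (y - 2 / 3); lra.
Qed.

Lemma continuous_cos_affine (t s : R) : continuous (fun x : R => cos (t * x + s)).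
Proof.
move=> x; apply: continuous_comp; last exact: continuous_cos.
apply: cvgD; last exact: cvg_cst.
by apply: cvgM; [exact: cvg_cst | exact: cvg_id].
Qed.

Lemma continuous_sin_affine (t s : R) : continuous (fun x : R => sin (t * x + s)).
Proof.
move=> x; apply: continuous_comp; last exact: continuous_sin.
apply: cvgD; last exact: cvg_cst.
by apply: cvgM; [exact: cvg_cst | exact: cvg_id].
Qed.

Lemma bc_cos t s : bc 1 (fun x => cos (t * x + s)).
Proof. by split=> [|x]; [exact: continuous_cos_affine | exact: cos_max]. Qed.

Lemma xsin_integrable t s :
  mu.-integrable setT (EFin \o (fun x => phi x * (- (x * sin (t * x + s))))).
Proof.
apply: (integrable_le _ xphi_integrable).
  apply: measurable_funM; first exact: measurable_phi.
  apply: continuous_measurable_fun => x; apply: cvgN; apply: cvgM; first exact: cvg_id.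
  exact: continuous_sin_affine.
move=> x; rewrite normrM (ger0_norm (phi_ge0 x)) normrN normrM mulrCA ler_wpM2l //.
by rewrite ler_piMr ?phi_ge0 // sin_max.
Qed.

(** Fundamental theorem of calculus on [[-n, n]]; dominated convergence recovers the integral over
    the line. *)
Lemma Rintegral_derivative_eq0 (F f : R -> R) : continuous f ->
  mu.-integrable setT (EFin \o f) -> (forall x, is_derive x (1 : R) F (f x)) ->
  (fun n : nat => F n%:R - F (- n%:R)) @ \oo --> (0 : R) -> \int[mu]_x f x = 0.
Proof.
move=> cf intf dF F0.
have mf : measurable_fun setT f by exact: continuous_measurable_fun.
pose fn (n : nat) := f \_ `[- n%:R, n%:R].
have cvg_int : (fun n => \int[mu]_x fn n x) @ \oo --> \int[mu]_x f x.
  apply: (@Rintegral_dct _ _ (fun x => `|f x|)) => //.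
  - by move=> n; apply/measurable_restrict => //; exact: measurable_funTS.
  - exact: integrable_norm.
  - by move=> n x; rewrite /fn patchE; case: ifP => // _; rewrite normr0.
  - move=> x; apply: (@cvg_near _ (fun=> f x)); last exact: cvg_cst.
    near=> n; rewrite /fn patchE mem_set //= in_itv /= -ler_norml.
    by near: n; exact: nbhs_infty_ger.
have FTC n : \int[mu]_x fn n.+1 x = F n.+1%:R - F (- n.+1%:R).
  rewrite -Rintegral_mkcond /Rintegral (@continuous_FTC2 _ f F) //.
  - by have := ltr0Sn R n; lra.
  - exact: continuous_subspaceT.
  - have cF x : {for x, continuous F}.
      by apply/differentiable_continuous/derivable1_diffP; case: (dF x).
    split; first by move=> x _; case: (dF x).
      by apply: cvg_at_right_filter; exact: cF.
    by apply: cvg_at_left_filter; exact: cF.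
  - by move=> x _; rewrite derive1E; have [_] := dF x.
apply: (@cvg_unique _ (@norm_hausdorff _ R^o) _ _ _ _ cvg_int).
apply: (@cvg_near _ (fun n : nat => F n%:R - F (- n%:R))) F0.
by exists 1%N => // -[|n] // _; rewrite FTC.
Unshelve. all: by end_near. Qed.

Lemma phi_parts t s :
  \int[mu]_x (phi x * (- (x * sin (t * x + s)))) = - t * gE (fun x => cos (t * x + s)).
Proof.
have i1 := xsin_integrable t s; have i2 := bc_integrable (bc_cos t s).
have i2t := integrableZl measurableT t i2.
have h : \int[mu]_x (phi x * (- (x * sin (t * x + s))) + t * (phi x * cos (t * x + s))) = 0.
  apply: (@Rintegral_derivative_eq0 (fun x => phi x * sin (t * x + s))).
  - move=> x; apply: cvgD.
      apply: cvgM; first exact: continuous_phi.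
      by apply: cvgN; apply: cvgM; [exact: cvg_id | exact: continuous_sin_affine].
    apply: cvgM; first exact: cvg_cst.
    by apply: cvgM; [exact: continuous_phi | exact: continuous_cos_affine].
  - exact: (integrableD measurableT i1 i2t).
  - move=> x; have dphi := is_derive_phi x.
    apply: is_derive_eq; rewrite /GRing.scale /=; by ring.
  - apply: norm_cvg0.
    have b : (fun n : nat => 4 * normal_peak 1 * (n%:R : R)^-1) @ \oo --> (0 : R).
      by apply: (cvg_val (mulr0 _)); apply: cvgM; [exact: cvg_cst | exact: cvg_inv_nat].
    apply: (squeeze_cvgr _ (cvg_cst 0) b); exists 1%N => // n /= n1.
    have n0 : 1 <= n%:R :> R by rewrite ler1n.
    have p1 : 0 < normal_peak 1 :> R by apply: normal_peak_gt0; exact: oner_neq0.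
    have phin (x : R) : x ^+ 2 = n%:R ^+ 2 -> `|phi x * sin (t * x + s)| <= 2 * normal_peak 1 * n%:R^-1.
      move=> xn; rewrite normrM ger0_norm ?phi_ge0 //.
      apply: (@le_trans _ _ (phi x)); first by rewrite ler_piMr ?phi_ge0 // sin_max.
      rewrite phiE xn mulrC -mulrA mulrCA [leRHS]mulrC ler_pM2r //.
      rewrite expRN -[2]invrK -invfM lef_pV2 ?posrE ?expR_gt0 ?mulr_gt0 ?invr_gt0 //; last by lra.
      apply: (le_trans _ (expR_ge1Dx _)); nra.
    rewrite normr_ge0 /= (le_trans (ler_normB _ _)) //.
    have := phin n%:R erefl; have := phin (- n%:R) (sqrrN _); lra.
rewrite (RintegralD measurableT i1 i2t) in h.
rewrite (RintegralZl t measurableT i2) in h.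
by apply/eqP; rewrite -subr_eq0 mulNr opprK; apply/eqP.
Qed.

(* [t |-> E cos (t X + s)] solves [y' = - t y]. *)
Lemma is_derive_gE_cos s t :
  is_derive t (1 : R) (fun t => gE (fun x => cos (t * x + s)))
    (- t * gE (fun x => cos (t * x + s))).
Proof.
pose f (t x : R) := phi x * cos (t * x + s).
have dcos (x t' : R) : is_derive t' (1 : R) (fun t => f t x) (phi x * (- (x * sin (t' * x + s)))).
  apply: is_derive_eq; rewrite /GRing.scale /=; by ring.
have p1 t' x : partial1of2 f t' x = phi x * (- (x * sin (t' * x + s))).
  by rewrite partial1of2E; have [_] := dcos x t'.
have h := @cvg_differentiation_under_integral R _ _ mu f setT measurableT t (t - 1) (t + 1)
  _ _ _ (fun x => `|x| * phi x) _ xphi_integrable _.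
have {}h : r^-1 *: (gE (fun x => cos ((r + t) * x + s)) - gE (fun x => cos (t * x + s)))
    @[r --> 0^'] --> \int[mu]_y partial1of2 f t y.
  apply: h.
  - by rewrite /= in_itv /=; apply/andP; split; lra.
  - by move=> t' _; exact: (bc_integrable (bc_cos t' s)).
  - by move=> t' x _ _; case: (dcos x t').
  - by move=> x; rewrite mulr_ge0 ?phi_ge0.
  - move=> t' x _ _; rewrite p1 normrM (ger0_norm (phi_ge0 x)) normrN normrM mulrCA.
    by rewrite ler_wpM2l // ler_piMr ?phi_ge0 // sin_max.
have e : \int[mu]_y partial1of2 f t y = - t * gE (fun x => cos (t * x + s)).
  by rewrite -phi_parts; apply: eq_Rintegral => x _; exact: p1.
rewrite e in h; apply: DeriveDef.
  apply/cvg_ex; eexists; move: h; under eq_fun do rewrite -[X in _ *: (gE (fun x => cos ((X + _) * x + s)) - _)]mulr1; exact.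
by apply/cvg_lim => //; move: h; under eq_fun do rewrite -[X in _ *: (gE (fun x => cos ((X + _) * x + s)) - _)]mulr1; exact.
Qed.

(** By the differential equation, multiplication by [expR (t ^+ 2 / 2)] gives a function of zero
    derivative, equal to [cos s] at [t = 0]. *)
Lemma gE_cos t s : gE (fun x => cos (t * x + s)) = expR (- (t ^+ 2 / 2)) * cos s.
Proof.
pose h t := gE (fun x => cos (t * x + s)) * expR (t ^+ 2 / 2).
have dh x : is_derive x (1 : R) h 0.
  have dg := is_derive_gE_cos s x.
  apply: is_derive_eq; rewrite /GRing.scale /=; by field.
have := is_derive_0_is_cst t 0 dh; rewrite /h.
rewrite expr0n /= mul0r expR0 mulr1.
have -> : (fun x : R => cos (0 * x + s)) = fun=> cos s.
  by apply/funext => x; rewrite mul0r add0r.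
rewrite gE_cst => <-; rewrite mulrCA -expRD addNr expR0 mulr1 //.
Qed.

End gauss1.

(** * Gaussian expectations in dimension [d] *)

Section gaussd.
Variable R : realType.

(** Sequential and coordinatewise, so that fixing the first coordinate in an iterated integral stays
    within the class. *)
Definition scont d (f : 'rV[R]_d -> R) :=
  forall (u : nat -> 'rV[R]_d) (z : 'rV[R]_d), (forall i, (fun n => u n ord0 i) @ \oo --> z ord0 i) ->
  (fun n => f (u n)) @ \oo --> f z.

Definition bsc d M (f : 'rV[R]_d -> R) := scont f /\ forall z, `|f z| <= M.

Definition consr d (x : R) (z : 'rV[R]_d) : 'rV[R]_d.+1 :=
  \row_(i < d.+1) (if unlift ord0 i is Some i' then z ord0 i' else x).

Lemma continuous_scont d (f : 'rV[R]_d -> R) : continuous f -> scont f.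
Proof.
move=> cf u z uz; apply: (continuous_cvg _ (cf z)).
apply/cvg_ballP => e e0.
have h : \forall n \near \oo, forall i, ball (z ord0 i) e (u n ord0 i).
  have H i : \forall n \near \oo, ball (z ord0 i) e (u n ord0 i).
    by have /cvg_ballP := uz i; apply.
  have := @filter_forall _ _ (fun i n => ball (z ord0 i) e (u n ord0 i)) \oo _ H.
  by apply.
near=> n; split=> // i j; rewrite (ord1 i).
by have : forall i, ball (z ord0 i) e (u n ord0 i) by near: n.
Unshelve. all: by end_near. Qed.

Lemma consr0 d x (z : 'rV[R]_d) : consr x z ord0 ord0 = x.
Proof. by rewrite mxE unlift_none. Qed.

Lemma consrS d x (z : 'rV[R]_d) i : consr x z ord0 (lift ord0 i) = z ord0 i.
Proof. by rewrite mxE liftK. Qed.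

Lemma consr_cvg d (u : nat -> R) (w : nat -> 'rV[R]_d) x (z : 'rV[R]_d) i : u @ \oo --> x ->
  (forall i, (fun n => w n ord0 i) @ \oo --> z ord0 i) ->
  (fun n => consr (u n) (w n) ord0 i) @ \oo --> consr x z ord0 i.
Proof.
move=> ux wz; case: (unliftP ord0 i) => [j ->|->].
  rewrite consrS; apply: (cvg_ext _ (wz j)) => n; exact/esym/consrS.
rewrite consr0; apply: (cvg_ext _ ux) => n; exact/esym/consr0.
Qed.

Lemma bsc_consr d M (f : 'rV[R]_d.+1 -> R) x : bsc M f -> bsc M (fun z => f (consr x z)).
Proof.
move=> [cf fM]; split=> [u z uz|z]; last exact: fM.
by apply: cf => i; apply: consr_cvg uz; exact: cvg_cst.
Qed.

Lemma stdgaussES d (f : 'rV[R]_d.+1 -> R) :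
  stdgaussE f = gE (fun x => stdgaussE (fun z => f (consr x z))).
Proof. by []. Qed.

(** Proved jointly by induction on [d]: the inner expectation must be continuous in the outer
    variable, and that continuity is the convergence statement one dimension lower. *)
Lemma stdgaussE_bound_cvg d M :
  (forall f : 'rV[R]_d -> R, bsc M f -> `|stdgaussE f| <= M) /\
  (forall (f_ : nat -> 'rV[R]_d -> R) f, (forall n, bsc M (f_ n)) -> bsc M f ->
    (forall z, (fun n => f_ n z) @ \oo --> f z) ->
    (fun n => stdgaussE (f_ n)) @ \oo --> stdgaussE f).
Proof.
elim: d => [|d [IHb IHc]].
  by split=> [f [_ fM]|f_ f _ _ ff]; [exact: fM | exact: ff].
have inner (f : 'rV[R]_d.+1 -> R) : bsc M f -> bc M (fun x => stdgaussE (fun z => f (consr x z))).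
  move=> bf; split=> [|x]; last by apply: IHb; exact: bsc_consr.
  apply: seq_continuous => u x ux; apply: IHc => [n||z]; [exact: bsc_consr|exact: bsc_consr|].
  apply: bf.1 => i; apply: consr_cvg ux _ => j; exact: cvg_cst.
split=> [f bf|f_ f bf_ bf ff]; first by rewrite stdgaussES; apply: gE_bound; exact: inner.
rewrite stdgaussES; apply: (@gE_cvg _ M (fun n x => stdgaussE (fun z => f_ n (consr x z)))).
- by move=> n; exact: inner.
- exact: inner.
- by move=> x; apply: IHc => [n||z]; [exact: bsc_consr|exact: bsc_consr|exact: ff].
Qed.

Lemma stdgaussE_inner d M (f : 'rV[R]_d.+1 -> R) : bsc M f ->
  bc M (fun x => stdgaussE (fun z => f (consr x z))).
Proof.
have [IHb IHc] := stdgaussE_bound_cvg d M.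
move=> bf; split=> [|x]; last by apply: IHb; exact: bsc_consr.
apply: seq_continuous => u x ux; apply: IHc => [n||z]; [exact: bsc_consr|exact: bsc_consr|].
apply: bf.1 => i; apply: consr_cvg ux _ => j; exact: cvg_cst.
Qed.

Lemma stdgaussE_cvg d M (f_ : nat -> 'rV[R]_d -> R) f :
  (forall n, bsc M (f_ n)) -> bsc M f ->
  (forall z, (fun n => f_ n z) @ \oo --> f z) ->
  (fun n => stdgaussE (f_ n)) @ \oo --> stdgaussE f.
Proof. by have [_] := stdgaussE_bound_cvg d M; apply. Qed.

Lemma stdgaussE_le d M (f g : 'rV[R]_d -> R) : bsc M f -> bsc M g ->
  (forall z, f z <= g z) -> stdgaussE f <= stdgaussE g.
Proof.
elim: d f g => [|d IH] f g bf bg fg; first exact: fg.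
rewrite !stdgaussES; apply: gE_le (stdgaussE_inner bf) (stdgaussE_inner bg) _ => x.
by apply: IH => [||z]; [exact: bsc_consr|exact: bsc_consr|exact: fg].
Qed.

Lemma stdgaussE_lin d M (f g : 'rV[R]_d -> R) a b : bsc M f -> bsc M g ->
  stdgaussE (fun z => a * f z + b * g z) = a * stdgaussE f + b * stdgaussE g.
Proof.
elim: d f g => [|d IH] f g bf bg; first by [].
rewrite !stdgaussES -(gE_lin a b (stdgaussE_inner bf) (stdgaussE_inner bg)).
by congr gE; apply/funext => x; apply: IH; exact: bsc_consr.
Qed.

Lemma stdgaussE_cst d (c : R) : stdgaussE (fun _ : 'rV[R]_d => c) = c.
Proof.
elim: d => [//|d IH]; rewrite stdgaussES -[RHS](gE_cst c).
by congr gE; apply/funext => x.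
Qed.

Lemma stdgaussE_cos d (t : 'I_d -> R) s :
  stdgaussE (fun z : 'rV[R]_d => cos (\sum_i t i * z ord0 i + s)) =
  expR (- ((\sum_i t i ^+ 2) / 2)) * cos s.
Proof.
elim: d t s => [|d IH] t s; first by rewrite /= !big_ord0 mul0r oppr0 expR0 mul1r add0r.
rewrite stdgaussES.
have -> : (fun x : R => stdgaussE (fun z : 'rV[R]_d => cos (\sum_i t i * consr x z ord0 i + s)))
  = (fun x => expR (- ((\sum_i t (lift ord0 i) ^+ 2) / 2)) * cos (t ord0 * x + s) + 0 * 0).
  apply/funext => x; rewrite mulr0 addr0 -(IH (fun i => t (lift ord0 i))).
  congr stdgaussE; apply/funext => z; congr cos.
  rewrite big_ord_recl consr0 [RHS]addrA addrAC [RHS]addrAC; congr (_ + _).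
  by rewrite addrC; congr (_ + _); apply: eq_bigr => i _; rewrite consrS.
have b0 : bc 1 (fun _ : R => 0 : R).
  by split=> [|x]; [exact: cst_continuous | rewrite normr0].
rewrite (gE_lin _ 0 (bc_cos (t ord0) s) b0) mul0r addr0 gE_cos mulrA -expRD.
by congr (expR _ * _); rewrite big_ord_recl; ring.
Qed.

End gaussd.

(** * Approximation by trigonometric polynomials *)

Section trigonometric_polynomials.
Variables (R : realType) (d : nat).
Implicit Types (f g : 'rV[R]_d -> R).

(** The phase [s] yields sines, so these combinations are closed under products. The inductive form
    reduces a property stable under linear combinations to single cosines. *)
Inductive trig : ('rV[R]_d -> R) -> Prop :=
| trig_cos (t : 'I_d -> R) s : trig (fun z => cos (\sum_i t i * z ord0 i + s))
| trig_lin a b f g : trig f -> trig g -> trig (fun z => a * f z + b * g z).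

Lemma trig_ext f g : f =1 g -> trig f -> trig g.
Proof. by move=> /funext ->. Qed.

Lemma trig_cst c : trig (fun=> c).
Proof.
apply: trig_ext (trig_lin c 0 (trig_cos (fun=> 0) 0) (trig_cos (fun=> 0) 0)) => z.
by rewrite big1 ?addr0 ?cos0 ?mulr1 ?mul0r ?addr0 // => i _; rewrite mul0r.
Qed.

Lemma trigM f g : trig f -> trig g -> trig (fun z => f z * g z).
Proof.
elim=> [t s|a b f1 f2 _ IH1 _ IH2] tg; last first.
  apply: trig_ext (trig_lin a b (IH1 tg) (IH2 tg)) => z; ring.
elim: tg => [t' s'|a b g1 g2 _ IH1 _ IH2]; last first.
  apply: trig_ext (trig_lin a b IH1 IH2) => z; ring.
apply: trig_ext (trig_lin 2^-1 2^-1 (trig_cos (fun i => t i + t' i) (s + s'))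
                   (trig_cos (fun i => t i - t' i) (s - s'))) => z.
have -> : \sum_i (t i + t' i) * z ord0 i + (s + s') =
    (\sum_i t i * z ord0 i + s) + (\sum_i t' i * z ord0 i + s').
  rewrite addrACA -big_split; congr (_ + _); apply: eq_bigr => i _; exact: mulrDl.
have -> : \sum_i (t i - t' i) * z ord0 i + (s - s') =
    (\sum_i t i * z ord0 i + s) - (\sum_i t' i * z ord0 i + s').
  rewrite opprD addrACA -sumrB; congr (_ + _); apply: eq_bigr => i _; exact: mulrBl.
by rewrite cosD cosB; field.
Qed.

Lemma trig_sum (I : Type) (r : seq I) (P : pred I) (F : I -> 'rV[R]_d -> R) :
  (forall i, trig (F i)) -> trig (fun z => \sum_(i <- r | P i) F i z).
Proof.
move=> tF; elim: r => [|i r IH].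
  by apply: trig_ext (trig_cst 0) => z; rewrite big_nil.
have h := trig_lin (P i)%:R 1 (tF i) IH; apply: trig_ext h => z.
by rewrite big_cons; case: (P i); rewrite /= ?mul1r // mul0r add0r.
Qed.

Lemma trig_prod (I : Type) (r : seq I) (F : I -> 'rV[R]_d -> R) :
  (forall i, trig (F i)) -> trig (fun z => \prod_(i <- r) F i z).
Proof.
move=> tF; elim: r => [|i r IH].
  by apply: trig_ext (trig_cst 1) => z; rewrite big_nil.
by apply: trig_ext (trigM (tF i) IH) => z; rewrite big_cons.
Qed.

Lemma trigX f n : trig f -> trig (fun z => f z ^+ n).
Proof.
move=> tf; elim: n => [|n IH]; first by apply: trig_ext (trig_cst 1) => z; rewrite expr0.
by apply: trig_ext (trigM tf IH) => z; rewrite exprS.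
Qed.

Lemma trig_sin (i : 'I_d) l : trig (fun z => sin (z ord0 i / l)).
Proof.
apply: trig_ext (trig_cos (fun j => (j == i)%:R / l) (- (pi / 2))) => z.
rewrite -cosBpihalf; congr (cos (_ + _)).
rewrite (bigD1 i) //= eqxx big1 ?addr0 => [|j /negbTE->]; last by rewrite !mul0r.
by rewrite mul1r mulrC.
Qed.

End trigonometric_polynomials.

(** * Multivariate Bernstein polynomials on a cube *)

Section bernstein.
Variable R : realType.

Definition bern N (j : nat) (p : R) : R := 'C(N, j)%:R * p ^+ j * (1 - p) ^+ (N - j).

Lemma sum_bern N p : \sum_(j < N.+1) bern N j p = 1.
Proof.
transitivity ((1 - p + p) ^+ N); last by rewrite subrK expr1n.
rewrite exprDn; apply: eq_bigr => j _; rewrite /bern -mulr_natl; ring.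
Qed.

(** Absorption [j * 'C(N + 1, j) = (N + 1) * 'C(N, j - 1)]; applied once or twice it gives the
    binomial mean and second moment. *)
Lemma sum_bern_absorb N p (F : nat -> R) :
  \sum_(j < N.+2) j%:R * F j * bern N.+1 j p =
  N.+1%:R * p * \sum_(j < N.+1) F j.+1 * bern N j p.
Proof.
rewrite big_ord_recl !mul0r add0r mulr_sumr; apply: eq_bigr => j _.
rewrite /bern /= subSS /bump /= add1n exprS.
have e : N.+1%:R * 'C(N, j)%:R = j.+1%:R * 'C(N.+1, j.+1)%:R :> R.
  by rewrite -!natrM -mul_bin_diag.
transitivity (j.+1%:R * 'C(N.+1, j.+1)%:R * (F j.+1 * p * p ^+ j * (1 - p) ^+ (N - j))).
  by ring.
by rewrite -e; ring.
Qed.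

Lemma sum_bern1 N p : \sum_(j < N.+1) j%:R * bern N j p = N%:R * p.
Proof.
case: N => [|N]; first by rewrite big_ord_recl big_ord0 /= !mul0r addr0.
rewrite (eq_bigr (fun j : 'I_N.+2 => j%:R * 1 * bern N.+1 j p)) => [|j _]; last by rewrite mulr1.
rewrite (sum_bern_absorb N p (fun=> 1)) -[RHS]mulr1; congr (_ * _).
by rewrite -[RHS](sum_bern N p); apply: eq_bigr => j _; rewrite mul1r.
Qed.

Lemma sum_bern2 N p : \sum_(j < N.+2) j%:R ^+ 2 * bern N.+1 j p = N.+1%:R * p * (N%:R * p + 1).
Proof.
rewrite (eq_bigr (fun j : 'I_N.+2 => j%:R * j%:R * bern N.+1 j p)) => [|j _]; last by rewrite -expr2.
rewrite (sum_bern_absorb N p (fun j => j%:R)); congr (_ * _).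
rewrite (eq_bigr (fun j : 'I_N.+1 => j%:R * bern N j p + bern N j p)).
  by rewrite big_split /= sum_bern1 sum_bern.
by move=> j _; rewrite -natr1 mulrDl mul1r.
Qed.

(** Equidistant nodes of [[-1, 1]]. The degree is [N + 1], so the denominator is never zero. *)
Definition node N (j : nat) : R := 2 * j%:R / N.+1%:R - 1.

Lemma bern_variance N (v : R) :
  \sum_(j < N.+2) (node N j - v) ^+ 2 * bern N.+1 j ((1 + v) / 2) = (1 - v ^+ 2) / N.+1%:R.
Proof.
set p := (1 + v) / 2.
have n0 : N.+1%:R != 0 :> R by rewrite pnatr_eq0.
rewrite (eq_bigr (fun j : 'I_N.+2 => 4 / N.+1%:R ^+ 2 * (j%:R ^+ 2 * bern N.+1 j p)
   - 4 * (1 + v) / N.+1%:R * (j%:R * bern N.+1 j p) + (1 + v) ^+ 2 * bern N.+1 j p)).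
  rewrite big_split sumrB /= -!mulr_sumr sum_bern sum_bern1 sum_bern2 /p.
  move: n0; rewrite -natr1; move: (N%:R : R) => n n0; by field.
by move=> j _; rewrite /node; move: (bern _ _ _) (j%:R : R) n0 => b x; move: (N.+1%:R) => n n0; field.
Qed.

Lemma bern_ge0 N j (v : R) : -1 <= v <= 1 -> 0 <= bern N j ((1 + v) / 2).
Proof.
move=> /andP[v1 v2]; rewrite /bern !mulr_ge0 ?exprn_ge0 //; first by lra.
by rewrite subr_ge0 ler_pdivrMr //; lra.
Qed.

Lemma node_bound N j : (j < N.+2)%N -> -1 <= node N j <= 1.
Proof.
move=> jN; have n0 : 0 < N.+1%:R :> R by rewrite ltr0n.
have : 0 <= (j%:R / N.+1%:R : R) <= 1.
  by apply/andP; split; [exact: divr_ge0 | rewrite ler_pdivrMr // mul1r ler_nat -ltnS].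
by rewrite /node -mulrA; move: (_ / _) => x; lra.
Qed.

Variable d : nat.

Definition bernd N (u : 'I_d -> R) (j : {ffun 'I_d -> 'I_N.+2}) : R :=
  \prod_i bern N.+1 (j i) ((1 + u i) / 2).

Lemma sum_bernd N u : \sum_j @bernd N u j = 1.
Proof.
rewrite /bernd -(bigA_distr_bigA (fun i (j : 'I_N.+2) => bern N.+1 j ((1 + u i) / 2))).
by rewrite big1 // => i _; rewrite sum_bern.
Qed.

Lemma bernd_ge0 N u j : (forall i, -1 <= u i <= 1) -> 0 <= @bernd N u j.
Proof. by move=> u1; apply: prodr_ge0 => i _; exact: bern_ge0. Qed.

Lemma bernd_variance N u i0 : (forall i, -1 <= u i <= 1) ->
  \sum_(j : {ffun 'I_d -> 'I_N.+2}) (node N (j i0) - u i0) ^+ 2 * @bernd N u j <= N.+1%:R^-1.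
Proof.
move=> u1.
rewrite (eq_bigr (fun j : {ffun 'I_d -> 'I_N.+2} =>
   \prod_i ((if i == i0 then (node N (j i) - u i) ^+ 2 else 1) * bern N.+1 (j i) ((1 + u i) / 2)))).
  rewrite -(bigA_distr_bigA (fun i (j : 'I_N.+2) =>
    (if i == i0 then (node N j - u i) ^+ 2 else 1) * bern N.+1 j ((1 + u i) / 2))).
  rewrite (bigD1 i0) //= eqxx [X in _ * X]big1 => [|i /negbTE->]; last first.
    by rewrite -[RHS](sum_bern N.+1 ((1 + u i) / 2)); apply: eq_bigr => j _; rewrite mul1r.
  by rewrite mulr1 bern_variance ler_piMl ?invr_ge0 // gerBl sqr_ge0.
move=> j _; rewrite big_split /=; congr (_ * _).
by rewrite (bigD1 i0) //= eqxx big1 ?mulr1 // => i /negbTE->.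
Qed.

End bernstein.

Section approximation.
Variable R : realType.

Lemma third_le_sin (u : R) : 0 <= u <= 2 -> u / 3 <= sin u.
Proof. by move=> /andP[u0 u2]; apply: le_trans (sin_ge_cubic u0); nra. Qed.

Lemma third_le_norm_sin (u : R) : `|u| <= 2 -> `|u| / 3 <= `|sin u|.
Proof.
wlog u0 : u / 0 <= u.
  move=> H u2; have [/H|u0] := leP 0 u; first exact.
  by rewrite -(normrN u) -(normrN (sin u)) -sinN; apply: H; rewrite ?normrN // oppr_ge0 ltW.
rewrite (ger0_norm u0) => u2; apply: le_trans (ler_norm _).
by apply: third_le_sin; rewrite u0.
Qed.

(* A quantitative inverse of [sin], which replaces continuity of [asin] at the end points *)
Lemma sin_expansive (a b : R) : `|a| <= 2^-1 -> `|b| <= pi / 2 -> `|a - b| <= 36 * `|sin a - sin b|.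
Proof.
have p2 := pihalf_lt2 R; have p1 := pihalf_ge1 R.
move=> a1 b1; pose u := (a - b) / 2; pose w := (a + b) / 2.
have ea : a = w + u by rewrite /w /u; field.
have eb : b = w - u by rewrite /w /u; field.
have -> : sin a - sin b = 2 * (sin u * cos w) by rewrite ea eb sinD sinB; ring.
have -> : a - b = 2 * u by rewrite /u; field.
have u2 : `|u| <= 2.
  rewrite /u normrM (ger0_norm (_ : 0 <= 2^-1)) // ler_pdivrMr //.
  by rewrite (le_trans (ler_normB _ _)) //; lra.
have w2 : `|w| <= (2^-1 + pi / 2) / 2.
  by rewrite /w normrM (ger0_norm (_ : 0 <= 2^-1)) // ler_pM2r // (le_trans (ler_normD _ _)) // lerD.
(* [pi / 2 - |w| >= (pi / 2 - 1/2) / 2 >= 1/4], and [third_le_sin] gives [1/12]; with the factor 3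
   lost on [sin u] this makes the constant 36. *)
have cw : 12^-1 <= cos w.
  have -> : cos w = sin (pi / 2 - `|w|).
    by rewrite -cosBpihalf addrAC subrr add0r cosN cos_norm.
  have w0 := normr_ge0 w; apply: le_trans (third_le_sin _); lra.
have su := third_le_norm_sin u2; clearbody u w.
rewrite !normrM (ger0_norm (_ : 0 <= 2)) // (ger0_norm (_ : 0 <= cos w)); last by lra.
have h : `|u| / 3 * 12^-1 <= `|sin u| * cos w.
  by apply: ler_pM => //; rewrite ?divr_ge0 // invr_ge0.
lra.
Qed.

Variable d : nat.
Implicit Types f : 'rV[R]_d -> R.

(** Only [x] is confined to the box, since the points [sine_node] may lie outside it. *)
Lemma box_unif_continuous f (L eps : R) : continuous f -> 0 < eps ->
  exists2 delta, 0 < delta & forall x y : 'rV[R]_d, (forall i, `|x ord0 i| <= L) ->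
    (forall i, `|x ord0 i - y ord0 i| <= delta) -> `|f x - f y| <= eps.
Proof.
move=> cf eps0.
have cK : compact [set v : 'rV[R]_d | forall i, `[(- L), L]%classic (v ord0 i)].
  by apply: (@rV_compact R d (fun=> `[(- L), L]%classic)) => i; exact: segment_compact.
have /compact_near_coveringP nK := cK.
pose P (delta : R) (x : 'rV[R]_d) := forall y : 'rV[R]_d,
  (forall i, `|x ord0 i - y ord0 i| <= delta) -> `|f x - f y| <= eps.
have : \forall delta \near (0 : R)^'+,
    [set v : 'rV[R]_d | forall i, `[(- L), L]%classic (v ord0 i)] `<=` P delta.
  apply: nK => x0 _.
  have eps20 : 0 < eps / 2 by lra.
  have /cvg_ballP /(_ _ eps20) := cf x0.
  rewrite near_simpl => /nbhs_ballP[r /= r0 hr].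
  have r20 : 0 < r / 2 by lra.
  have near_x0 (y : 'rV[R]_d) : (forall i, `|x0 ord0 i - y ord0 i| < r) -> `|f x0 - f y| < eps / 2.
    by move=> h; apply: hr; split=> // i j; rewrite (ord1 i); exact: h.
  near=> x delta => y xy.
  have x0x i : `|x0 ord0 i - x ord0 i| < r / 2.
    have : ball x0 (r / 2) x by near: x; exact: nbhsx_ballx.
    by move=> [_] /(_ ord0 i).
  have dr : delta < r / 2 by near: delta; exact: nbhs_right_lt.
  rewrite (le_trans (ler_distD (f x0) _ _)) // (distrC (f x)) ltW // [ltRHS]splitr ltrD //.
    by apply: near_x0 => i; have := x0x i; lra.
  apply: near_x0 => i; rewrite (le_lt_trans (ler_distD (x ord0 i) _ _)) //.
  by have := x0x i; have /= := xy i; lra.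
move=> h; have [delta [d0 hd]] := filter_ex (filterI (nbhs_right_gt (0 : R)) h).
exists delta => // x y xL; apply: hd => i /=.
by rewrite in_itv /= -ler_norml.
Unshelve. all: by end_near. Qed.

(** The scale [2 * L] keeps the angles of the box within [[-1/2, 1/2]], away from the critical
    points of [sin], where close sines would not give proportionally close angles. *)
Definition sine_node L N (j : {ffun 'I_d -> 'I_N.+2}) : 'rV[R]_d :=
  \row_i (2 * L * asin (node R N (j i))).

(* Bernstein's polynomial of degree [N.+1] of [f] in the variables [sin (z_i / (2L))] *)
Definition sine_bernstein f L N (z : 'rV[R]_d) : R :=
  \sum_j f (sine_node L j) * @bernd R d N (fun i => sin (z ord0 i / (2 * L))) j.

Lemma sin_itv (x : R) : -1 <= sin x <= 1.
Proof. by rewrite -ler_norml sin_max. Qed.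

Lemma trig_sine_bernstein f L N : trig (sine_bernstein f L N).
Proof.
apply: trig_sum => j; apply: trigM (trig_cst _ _) _; apply: trig_prod => i.
have tp : trig (fun z : 'rV[R]_d => (1 + sin (z ord0 i / (2 * L))) / 2).
  apply: trig_ext (trig_lin 2^-1 2^-1 (trig_cst d 1) (trig_sin i (2 * L))) => z; by field.
apply: trigM; first by apply: trigM; [exact: trig_cst | exact: trigX].
apply: trigX; apply: trig_ext (trig_lin 1 (-1) (trig_cst d 1) tp) => z; ring.
Qed.

Lemma sine_bernstein_le f L N (M : R) z : (forall z, `|f z| <= M) -> `|sine_bernstein f L N z| <= M.
Proof.
move=> fM; rewrite (le_trans (ler_norm_sum _ _ _)) //.
rewrite -[leRHS]mulr1 -[X in _ <= _ * X](sum_bernd N (fun i => sin (z ord0 i / (2 * L)))) mulr_sumr.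
apply: ler_sum => j _; rewrite normrM (ger0_norm (bernd_ge0 _ _)) => [|i]; last exact: sin_itv.
by rewrite ler_wpM2r // bernd_ge0 // => i; exact: sin_itv.
Qed.

(** Bernstein's argument: nodes close to the point are handled by uniform continuity, the others by
    Chebyshev's inequality, each coordinate having variance at most [1 / (N + 1)]. *)
Lemma trig_approx f (M L eps : R) : continuous f -> (forall z, `|f z| <= M) -> 0 < L -> 0 < eps ->
  exists T, [/\ trig T, forall z, `|T z| <= M &
    forall z : 'rV[R]_d, (forall i, `|z ord0 i| <= L) -> `|T z - f z| <= eps].
Proof.
move=> cf fM L0 eps0; have M0 : 0 <= M by exact: le_trans (fM 0).
have eps20 : 0 < eps / 2 by lra.
have [delta d0 hdelta] := box_unif_continuous L cf eps20.
(* [sin_expansive] turns a distance [e] between sines into [2 * L * 36 * e = delta] between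
   points. *)
pose e := delta / (72 * L); have e0 : 0 < e by rewrite divr_gt0 // mulr_gt0.
pose c := 2 * M / e ^+ 2; have c0 : 0 <= c by rewrite divr_ge0 ?sqr_ge0 // mulr_ge0.
pose K := c * d%:R.
(* Makes [K / (N + 1) <= eps / 2], the contribution of the remote nodes. *)
pose N := Num.truncn (2 * K / eps).
exists (sine_bernstein f L N); split; first exact: trig_sine_bernstein.
  by move=> z; exact: sine_bernstein_le.
have L20 : 0 < 2 * L by rewrite mulr_gt0.
move=> z zL; pose s i := sin (z ord0 i / (2 * L)).
have s1 i : -1 <= s i <= 1 by exact: sin_itv.
have -> : f z = \sum_j f z * @bernd R d N s j by rewrite -mulr_sumr sum_bernd mulr1.
rewrite /sine_bernstein -sumrB (le_trans (ler_norm_sum _ _ _)) //.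
have pt (j : {ffun 'I_d -> 'I_N.+2}) : `|f (sine_node L j) - f z| <=
    eps / 2 + c * \sum_i (node R N (j i) - s i) ^+ 2.
  have [near_j|/existsNP[i far_j]] := pselect (forall i, `|node R N (j i) - s i| <= e).
    apply: (@le_trans _ _ (eps / 2)); last first.
      by rewrite lerDl; apply: mulr_ge0 => //; apply: sumr_ge0 => i _; exact: sqr_ge0.
    rewrite distrC; apply: hdelta => // i; rewrite mxE.
    have nb := node_bound R (ltn_ord (j i)).
    have h : `|z ord0 i / (2 * L) - asin (node R N (j i))| <= 36 * `|s i - sin (asin (node R N (j i)))|.
      apply: sin_expansive.
        by rewrite normrM (gtr0_norm (_ : 0 < (2 * L)^-1)) ?invr_gt0 // ler_pdivrMr // mulKf.
      by rewrite ler_norml asin_geNpi2 ?asin_lepi2.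
    rewrite asinK ?in_itv //= distrC in h.
    have -> : z ord0 i - 2 * L * asin (node R N (j i)) =
        2 * L * (z ord0 i / (2 * L) - asin (node R N (j i))) by field; rewrite gt_eqF.
    have hn := near_j i; rewrite distrC in hn.
    rewrite normrM (gtr0_norm L20) distrC.
    apply: (@le_trans _ _ (2 * L * (36 * e))).
      by apply: (ler_wpM2l (ltW L20)); apply: (le_trans h); apply: ler_wpM2l.
    by rewrite /e le_eqVlt; apply/orP; left; apply/eqP; field; rewrite gt_eqF.
  have far : e ^+ 2 <= \sum_i (node R N (j i) - s i) ^+ 2.
    rewrite (bigD1 i) //= -[leLHS]addr0 lerD ?sumr_ge0 // => [|k _]; last exact: sqr_ge0.
    rewrite -(real_normK (num_real (node R N (j i) - s i))) lerXn2r ?nnegrE ?(ltW e0) //.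
    by rewrite ltW // ltNge; exact/negP.
  apply: (@le_trans _ _ (2 * M)).
    by rewrite (le_trans (ler_normB _ _)) //; have := fM (sine_node L j); have := fM z; lra.
  apply: (@le_trans _ _ (c * e ^+ 2)).
    by rewrite /c divfK // expf_neq0 // gt_eqF.
  by rewrite -[leLHS]add0r; apply: lerD; [exact: ltW|exact: ler_wpM2l].
pose V (j : {ffun 'I_d -> 'I_N.+2}) := \sum_i (node R N (j i) - s i) ^+ 2.
have le1 : \sum_j `|f (sine_node L j) * @bernd R d N s j - f z * @bernd R d N s j| <=
    \sum_j (eps / 2 + c * V j) * @bernd R d N s j.
  apply: ler_sum => j _; rewrite -mulrBl normrM (ger0_norm (bernd_ge0 _ s1)).
  by rewrite ler_wpM2r // bernd_ge0.
apply: (le_trans le1).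
rewrite (eq_bigr (fun j => eps / 2 * @bernd R d N s j +
   c * \sum_i (node R N (j i) - s i) ^+ 2 * @bernd R d N s j)); last first.
  by move=> j _; rewrite mulrDl -[X in _ + X]mulrA /V mulr_suml.
rewrite big_split /= -!mulr_sumr sum_bernd mulr1 exchange_big /= [leRHS]splitr lerD2l.
apply: (@le_trans _ _ (c * \sum_(i < d) N.+1%:R^-1)).
  by apply: ler_wpM2l => //; apply: ler_sum => i _; exact: bernd_variance.
rewrite sumr_const card_ord -[_ *+ d]mulr_natl mulrA -/K ler_pdivrMr ?ltr0n //.
have := truncnS_gt (2 * K / eps); rewrite -/N ltr_pdivrMr // => /ltW; lra.
Qed.

End approximation.

(** * Gaussian limit for bounded continuous functions *)

Section sequentially_continuous_functions.
Variables (R : realType) (d : nat).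
Implicit Types f g : 'rV[R]_d -> R.

Lemma scont_mulmx f (A : 'M[R]_d) : scont f -> scont (fun z => f (z *m A)).
Proof.
move=> cf u z uz; apply: cf => j; rewrite mxE.
apply: (@cvg_ext _ (fun n => \sum_i u n ord0 i * A i j)) => [n|]; first by rewrite mxE.
by apply: cvg_sum_ord => i; apply: cvgM; [exact: uz | exact: cvg_cst].
Qed.

Lemma bsc_mulmx M f (A : 'M[R]_d) : bsc M f -> bsc M (fun z => f (z *m A)).
Proof. by move=> [cf fM]; split=> [|z]; [exact: scont_mulmx | exact: fM]. Qed.

Lemma bsc_weaken M M' f : M <= M' -> bsc M f -> bsc M' f.
Proof. by move=> MM' [cf fM]; split=> // z; exact: le_trans (fM z) MM'. Qed.

Lemma bsc_lin M a b f g : bsc M f -> bsc M g ->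
  bsc (`|a| * M + `|b| * M) (fun z => a * f z + b * g z).
Proof.
move=> [cf fM] [cg gM]; split=> [u z uz|z].
  by apply: cvgD; apply: cvgM; [exact: cvg_cst|exact: cf|exact: cvg_cst|exact: cg].
by rewrite (le_trans (ler_normD _ _)) // !normrM lerD // ler_wpM2l.
Qed.

Lemma bsc_trig f : trig f -> exists M, bsc M f.
Proof.
elim=> [t s|a b f1 f2 _ [M1 b1] _ [M2 b2]]; last first.
  exists (`|a| * (`|M1| + `|M2|) + `|b| * (`|M1| + `|M2|)); apply: bsc_lin.
    by apply: bsc_weaken b1; rewrite -[leLHS]addr0 lerD // ler_norm.
  by apply: bsc_weaken b2; rewrite -[leLHS]add0r lerD // ler_norm.
exists 1; split=> [u z uz|z]; last exact: cos_max.
apply: continuous_cvg; first exact: continuous_cos.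
apply: cvgD; last exact: cvg_cst.
by apply: cvg_sum_ord => i; apply: cvgM; [exact: cvg_cst | exact: uz].
Qed.

Lemma stdgaussE_dist M N f g h : bsc M f -> bsc M g -> bsc N h -> (forall z, `|f z - g z| <= h z) ->
  `|stdgaussE f - stdgaussE g| <= stdgaussE h.
Proof.
move=> bf bg bh fgh; pose M' := `|1 : R| * M + `|-1 : R| * M.
have bfg : bsc M' (fun z => 1 * f z + (-1) * g z) by exact: bsc_lin.
have bfg' := bsc_weaken (ler_norm _ : M' <= `|M'|) bfg.
have {bfg'} bfg' : bsc (`|M'| + `|N|) (fun z => 1 * f z + (-1) * g z).
  by apply: bsc_weaken bfg'; rewrite lerDl.
have bh' : bsc (`|M'| + `|N|) h.
  by apply: bsc_weaken bh; rewrite -[leLHS]add0r lerD // ler_norm.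
have bN : bsc (`|-1 : R| * (`|M'| + `|N|) + `|0 : R| * (`|M'| + `|N|)) (fun z => (-1) * h z + 0 * h z).
  exact: bsc_lin.
rewrite normrN1 normr0 mul1r mul0r addr0 in bN.
have e : stdgaussE f - stdgaussE g = stdgaussE (fun z => 1 * f z + (-1) * g z).
  by rewrite (stdgaussE_lin 1 (-1) bf bg); ring.
have eN : - stdgaussE h = stdgaussE (fun z => (-1) * h z + 0 * h z).
  by rewrite (stdgaussE_lin (-1) 0 bh' bh'); ring.
rewrite e ler_norml eN; apply/andP; split.
  apply: (stdgaussE_le bN bfg') => z; have := fgh z; rewrite ler_norml => /andP[]; lra.
apply: (stdgaussE_le bfg' bh') => z; have := fgh z; rewrite ler_norml => /andP[]; lra.
Qed.

(** A continuous bounded majorant of the indicator of the complement of the box, itself at most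
    [2 / L ^+ 2] times the squared norm: suited both to Gaussian expectations and to Chebyshev's
    inequality. *)
Definition tail (L : R) (x : 'rV[R]_d) : R := \sum_i 2 * x ord0 i ^+ 2 / (L ^+ 2 + x ord0 i ^+ 2).

Lemma tail_den (L x : R) : 0 < L -> 0 < L ^+ 2 + x ^+ 2.
Proof. by move=> L0; rewrite ltr_wpDr ?sqr_ge0 ?exprn_gt0. Qed.

Lemma tail_term_ge0 (L x : R) : 0 < L -> 0 <= 2 * x ^+ 2 / (L ^+ 2 + x ^+ 2).
Proof.
move=> L0; apply: divr_ge0; last exact/ltW/tail_den.
by apply: mulr_ge0 => //; exact: sqr_ge0.
Qed.

Lemma tail_ge0 L x : 0 < L -> 0 <= tail L x.
Proof. by move=> L0; apply: sumr_ge0 => i _; exact: tail_term_ge0. Qed.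

Lemma tail_ge1 L (x : 'rV[R]_d) i : 0 < L -> L < `|x ord0 i| -> 1 <= tail L x.
Proof.
move=> L0 Lx; rewrite /tail (bigD1 i) //= -[leLHS]addr0 lerD //; last first.
  by apply: sumr_ge0 => j _; exact: tail_term_ge0.
rewrite ler_pdivlMr ?tail_den // mul1r.
have : L ^+ 2 <= x ord0 i ^+ 2.
  by rewrite -[leRHS]real_normK ?num_real // lerXn2r ?nnegrE ?(ltW L0) // ltW.
lra.
Qed.

Lemma tail_le L x : 0 < L -> tail L x <= \sum_i 2 / L ^+ 2 * x ord0 i ^+ 2.
Proof.
move=> L0; apply: ler_sum => i _; have L20 : 0 < L ^+ 2 by rewrite exprn_gt0.
rewrite mulrAC -!mulrA ler_wpM2l // ler_wpM2r ?sqr_ge0 //.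
by rewrite lef_pV2 ?posrE ?tail_den // lerDl sqr_ge0.
Qed.

Lemma bsc_tail L : 0 < L -> bsc (2 * d%:R) (tail L).
Proof.
move=> L0; split=> [u z uz|z].
  apply: cvg_sum_ord => i.
  have h : (fun n => u n ord0 i ^+ 2) @ \oo --> z ord0 i ^+ 2.
    by rewrite expr2; apply: (cvg_ext _ (cvgM (uz i) (uz i))) => n; rewrite expr2.
  apply: cvgM; first by apply: cvgM; [exact: cvg_cst | exact: h].
  by apply: cvgV; [rewrite gt_eqF // tail_den | apply: cvgD; [exact: cvg_cst | exact: h]].
rewrite ger0_norm ?tail_ge0 // mulr_natr -[X in _ *+ X]card_ord -sumr_const.
apply: ler_sum => i _; rewrite ler_pdivrMr ?tail_den // ler_wpM2l //.
by rewrite lerDr sqr_ge0.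
Qed.

Lemma tail_cvg x : (fun n => tail n.+1%:R x) @ \oo --> (0 : R).
Proof.
have h : (fun n => \sum_(i < d) 2 * x ord0 i ^+ 2 * n.+1%:R^-1) @ \oo --> (0 : R).
  apply: (@cvg_val _ _ (\sum_(i < d) 2 * x ord0 i ^+ 2 * 0)).
    by rewrite big1 // => i _; rewrite mulr0.
  apply: cvg_sum_ord => i; apply: cvgM; first exact: cvg_cst.
  exact: cvg_harmonic.
apply: (squeeze_cvgr _ (cvg_cst 0) h); apply: nearW => n.
rewrite tail_ge0 //=; apply: ler_sum => i _.
apply: ler_wpM2l; first by apply: mulr_ge0 => //; exact: sqr_ge0.
rewrite lef_pV2 ?posrE ?tail_den //.
rewrite -[leLHS]addr0 lerD ?sqr_ge0 // expr2 ler_peMr // ler1n //.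
Qed.

End sequentially_continuous_functions.

Section central_limit_theorem.
Variables (R : realType) (alpha : R).
Hypothesis alpha0 : 0 < alpha.
Local Notation E k := (@wmean R k (nk alpha k)).

(** Tightness. The deviation splits into a path fluctuation, a cycle count and the error in the
    mean; the factor 3 comes from [(a + b + c)^2 <= 3 (a^2 + b^2 + c^2)]. *)
Lemma second_moment_bound i : \forall k \near \oo,
  E k (fun S => (obs S i.+2 - cj alpha i.+2 * k%:R) ^+ 2) <=
  (12 * alpha + 3 * (1 + alpha) ^+ 2 + 3) * k%:R.
Proof.
have sl := mk_slow alpha0 i.
have /cvgrPdist_le /(_ _ ltr01) near1 := sl.
near=> k.
have k0 : 0 < k%:R :> R by near: k; exact: near_posnat.
have k1 : 1 <= k%:R :> R by rewrite ler1n -(ltr0n R).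
have near_mean : `|0 - Num.sqrt k%:R * (mk alpha k i / k%:R - cj alpha i.+2)| <= 1.
  by near: k; exact: near1.
set m := mk alpha k i in near_mean *; set c := cj alpha i.+2 in near_mean *.
have hm : (m - c * k%:R) ^+ 2 <= k%:R.
  move: near_mean; rewrite sub0r normrN.
  have -> : m - c * k%:R = k%:R * (m / k%:R - c) by field; rewrite gt_eqF.
  rewrite -(ler_pXn2r (_ : 0 < 2)%N) ?nnegrE // expr1n real_normK ?num_real //.
  rewrite exprMn sqr_sqrtr ?(ltW k0) // => h; rewrite exprMn [k%:R ^+ 2]expr2 -mulrA.
  by rewrite -[leRHS]mulr1 ler_wpM2l ?(ltW k0).
apply: (@le_trans _ _ (E k (fun S => 3 * (S.1 i - m) ^+ 2 +
    3 * (1 * S.2 i.+2 ^+ 2 + (m - c * k%:R) ^+ 2 * 1)))).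
  apply: wmean_le => S _; rewrite obs2; move: (S.1 i) (S.2 i.+2) (c * _) => p z b.
  rewrite -subr_ge0 (_ : _ - _ = (p - m - z) ^+ 2 + (p - m - (m - b)) ^+ 2 + (z - (m - b)) ^+ 2).
    by rewrite !addr_ge0 ?sqr_ge0.
  by ring.
rewrite (wmean_lin k _ _ _ (fun S => (S.1 i - m) ^+ 2)).
rewrite (wmean_lin k _ _ _ (fun S => S.2 i.+2 ^+ 2) (fun=> 1)) wmean_cst mulr1 mul1r.
have ik : (i < k)%N by near: k; exact: nbhs_infty_gt.
have h1 : E k (fun S => (S.1 i - m) ^+ 2) <= 4 * (nk alpha k)%:R.
  exact: (@pvar_path R k i.+1 ik (nk alpha k) i (ltnSn i)).
have [_ h2] := cycle_le alpha0 k (ltn0Sn i.+1).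
have h3 := nk_le alpha0 k.
have h4 : (1 + alpha) ^+ 2 <= (1 + alpha) ^+ 2 * k%:R by rewrite ler_peMr ?sqr_ge0.
move: h1 h2 h3 h4 hm; move: (E k _) (E k _) ((m - _) ^+ 2) ((1 + alpha) ^+ 2) => x y z w.
move: (nk alpha k)%:R (k%:R : R) => n N; lra.
Unshelve. all: by end_near. Qed.

Variable d : nat.
Variable A : 'M[R]_d.
Hypothesis AA : A^T *m A = \matrix_(i, j) Hij alpha i.+2 j.+2.

Definition normalized k (S : state R) : 'rV[R]_d :=
  \row_(i < d) ((obs S i.+2 - cj alpha i.+2 * k%:R) / Num.sqrt k%:R).

Local Notation G := (fun f : 'rV[R]_d -> R => stdgaussE (fun z => f (z *m A))).

(** The variance of the linear form [t] on the Gaussian vector [z *m A]; it depends on [A] only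
    through [A^T *m A]. *)
Lemma Hform_mulmx (t : 'rV[R]_d) : \sum_j (\sum_i A j i * t ord0 i) ^+ 2 = Hform alpha t.
Proof.
transitivity (\sum_i \sum_l t ord0 i * t ord0 l * (A^T *m A) i l); last first.
  by rewrite AA; apply: eq_bigr => i _; apply: eq_bigr => l _; rewrite mxE.
under [RHS]eq_bigr => i _ do under eq_bigr => l _ do rewrite mxE mulr_sumr.
under [RHS]eq_bigr => i _ do rewrite exchange_big /=.
rewrite exchange_big /=; apply: eq_bigr => j _.
rewrite expr2 mulr_suml; apply: eq_bigr => i _; rewrite mulr_sumr.
by apply: eq_bigr => l _; rewrite mxE; ring.
Qed.

Lemma trig_clt T : trig T -> (fun k => E k (fun S => T (normalized k S))) @ \oo --> G T.
Proof.
elim=> [t s|a b f g tf IHf tg IHg].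
  pose tv : 'rV[R]_d := \row_i t i.
  have -> : stdgaussE (fun z : 'rV[R]_d => cos (\sum_i t i * (z *m A) ord0 i + s)) =
      expR (- (Hform alpha tv / 2)) * cos s.
    rewrite -Hform_mulmx -stdgaussE_cos; congr stdgaussE; apply/funext => z.
    congr (cos (_ + s)).
    under eq_bigr => i _ do rewrite mxE mulr_sumr.
    rewrite exchange_big /=; apply: eq_bigr => j _; rewrite mulr_suml.
    by apply: eq_bigr => i _; rewrite mxE; ring.
  have h := @cos_proj_cvg R alpha alpha0 d tv s.
  apply: (cvg_ext _ h) => k; congr (E k _); apply/funext => S.
  by congr (cos (_ + s)); apply: eq_bigr => i _; rewrite !mxE.
have [Mf bf] := bsc_trig tf; have [Mg bg] := bsc_trig tg.
have bf' : bsc (`|Mf| + `|Mg|) (fun z => f (z *m A)).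
  by apply: bsc_weaken (bsc_mulmx A bf); rewrite -[leLHS]addr0 lerD // ler_norm.
have bg' : bsc (`|Mf| + `|Mg|) (fun z => g (z *m A)).
  by apply: bsc_weaken (bsc_mulmx A bg); rewrite -[leLHS]add0r lerD // ler_norm.
rewrite (stdgaussE_lin a b bf' bg').
apply: (@cvg_ext _ (fun k => a * E k (fun S => f (normalized k S)) +
    b * E k (fun S => g (normalized k S)))); first by move=> k; rewrite -wmean_lin.
by apply: cvgD; apply: cvgM; [exact: cvg_cst|exact: IHf|exact: cvg_cst|exact: IHg].
Qed.

Lemma wmean_dist k n (f g : state R -> R) :
  `|wmean k n f - wmean k n g| <= wmean k n (fun S => `|f S - g S|).
Proof.
apply: le_trans (wmean_norm _ _ _); rewrite le_eqVlt; apply/orP; left; apply/eqP; congr `|_|.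
rewrite -[X in _ - X]mul1r -[X in X - _]mul1r -mulNr -wmean_lin.
by apply: eq_wmean => S _; rewrite mulN1r mul1r.
Qed.

(** [trig_clt] applies to a trigonometric polynomial [T] close to [f] on a box. Outside the box both
    are bounded by [M], so the error there is at most [2 * M * tail L]. *)
Lemma gaussian_clt (f : 'rV[R]_d -> R) (M : R) : continuous f -> (forall z, `|f z| <= M) ->
  (fun k => E k (fun S => f (normalized k S))) @ \oo --> G f.
Proof.
move=> cf fM; have M0 : 0 <= M by exact: le_trans (fM 0).
have bf : bsc M f by split=> //; exact: continuous_scont.
pose C := 12 * alpha + 3 * (1 + alpha) ^+ 2 + 3.
have C0 : 0 <= C.
  apply: addr_ge0 => //; apply: addr_ge0; apply: mulr_ge0 => //; [exact: ltW|exact: sqr_ge0].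
pose D := \sum_(i < d) 2 * C.
have tail0 : (fun n => 2 * M * G (tail n.+1%:R)) @ \oo --> (0 : R).
  apply: (@cvg_val _ _ (2 * M * stdgaussE (fun _ : 'rV[R]_d => 0))).
    by rewrite stdgaussE_cst mulr0.
  apply: cvgM; first exact: cvg_cst.
  apply: (@stdgaussE_cvg _ _ (2 * d%:R)).
  - by move=> n; apply: bsc_mulmx; exact: bsc_tail.
  - split=> [u z _|z]; first exact: cvg_cst.
    by rewrite normr0 mulr_ge0.
  - by move=> z; exact: tail_cvg.
(* The Chebyshev bound [D / L ^+ 2] for the counts is weakened to [D / L], with [L = n + 1 >= 1]. *)
have walk0 : (fun n : nat => 2 * M * D * n.+1%:R^-1) @ \oo --> (0 : R).
  by apply: (cvg_val (mulr0 (2 * M * D))); apply: cvgM; [exact: cvg_cst | exact: cvg_harmonic].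
(* Five shares of [e]: the approximation error and the tail, for the Gaussian and for the counts,
   and the convergence for [T]. *)
apply/cvgrPdist_le => e e0; have e50 : 0 < e / 5 by lra.
have /cvgrPdist_le /(_ _ e50) nt := tail0.
have /cvgrPdist_le /(_ _ e50) nw := walk0.
have [n [n1 n2]] := filter_ex (filterI nt nw).
set L : R := n.+1%:R in n1 n2 *; have L0 : 0 < L by rewrite ltr0n.
have [T [tT TM Tf]] := trig_approx cf fM L0 e50.
have dist (x : 'rV[R]_d) : `|f x - T x| <= e / 5 * 1 + 2 * M * tail L x.
  rewrite mulr1.
  have [/Tf xL|/existsNP[i /negP]] := pselect (forall i, `|x ord0 i| <= L).
    by rewrite distrC (le_trans xL) // lerDl mulr_ge0 ?mulr_ge0 ?tail_ge0.
  rewrite -ltNge => /(tail_ge1 L0) h.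
  have := ler_normB (f x) (T x); have := fM x; have := TM x.
  have : 2 * M * 1 <= 2 * M * tail L x by rewrite ler_wpM2l // mulr_ge0.
  lra.
have bT : bsc M T by split=> //; have [? []] := bsc_trig tT.
have gauss_dist : `|G f - G T| <= e / 5 + e / 5.
  have : `|G f - G T| <= e / 5 + 2 * M * G (tail L).
    have bD : bsc (`|e / 5| * (1 + 2 * d%:R) + `|2 * M| * (1 + 2 * d%:R))
        (fun z => e / 5 * 1 + 2 * M * tail L (z *m A)).
      apply: (@bsc_lin _ _ _ _ _ (fun=> 1) (fun z => tail L (z *m A))).
        by split=> [u z _|z]; [exact: cvg_cst | rewrite normr1 lerDl mulr_ge0].
      by apply: bsc_weaken (bsc_mulmx A (bsc_tail d L0)); rewrite lerDr.
    apply: le_trans (stdgaussE_dist (bsc_mulmx A bf) (bsc_mulmx A bT) bD (fun z => dist (z *m A))) _.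
    rewrite (@stdgaussE_lin _ _ (1 + 2 * d%:R) (fun=> 1) (fun z => tail L (z *m A))) ?stdgaussE_cst ?mulr1 //.
      by split=> [u z _|z]; [exact: cvg_cst | rewrite normr1 lerDl mulr_ge0].
    by apply: bsc_weaken (bsc_mulmx A (bsc_tail d L0)); rewrite lerDr.
  by move: n1; rewrite /= sub0r normrN => n1 h; have := ler_norm (2 * M * G (tail L)); lra.
have /cvgrPdist_le /(_ _ e50) nT := trig_clt tT.
near=> k.
have kT : `|G T - E k (fun S => T (normalized k S))| <= e / 5 by near: k; exact: nT.
have k0 : 0 < k%:R :> R by near: k; exact: near_posnat.
have kC : forall i : 'I_d, E k (fun S => normalized k S ord0 i ^+ 2) <= C.
  move=> i.
  have : forall i : 'I_d, E k (fun S => (obs S i.+2 - cj alpha i.+2 * k%:R) ^+ 2) <= C * k%:R.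
    near: k; apply: filter_forall => j; exact: second_moment_bound.
  move=> /(_ i) h; rewrite -(ler_pM2r k0) (le_trans _ h) // mulrC -wmeanZ.
  apply: wmean_le => S _; rewrite mxE exprMn exprVn sqr_sqrtr ?(ltW k0) //.
  by rewrite mulrCA divff ?mulr1 // gt_eqF.
have walk_dist : `|E k (fun S => T (normalized k S)) - E k (fun S => f (normalized k S))| <= e / 5 + e / 5.
  have h : E k (fun S => tail L (normalized k S)) <= D / L ^+ 2.
    apply: (@le_trans _ _ (E k (fun S => \sum_i 2 / L ^+ 2 * normalized k S ord0 i ^+ 2))).
      by apply: wmean_le => S _; exact: tail_le.
    rewrite wmean_sum /D mulr_suml; apply: ler_sum => i _; rewrite wmeanZ.
    have := kC i; move: (E k _) => v vC.
    by rewrite mulrAC -!mulrA ler_wpM2l // ler_wpM2r ?invr_ge0 ?exprn_ge0.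
  rewrite (le_trans (wmean_dist _ _ _ _)) //.
  apply: (@le_trans _ _ (E k (fun S => e / 5 * 1 + 2 * M * tail L (normalized k S)))).
    by apply: wmean_le => S _; rewrite distrC; exact: dist.
  rewrite (wmean_lin k _ _ _ (fun=> 1) (fun S => tail L (normalized k S))) wmean_cst mulr1 lerD2l.
  move: n2; rewrite /= sub0r normrN => n2.
  apply: le_trans n2; apply: le_trans (ler_norm _); rewrite -[leRHS]mulrA; apply: ler_wpM2l; first exact: mulr_ge0.
  rewrite (le_trans h) // ler_wpM2l ?sumr_ge0 // => [i _|]; first by rewrite mulr_ge0.
  by rewrite lef_pV2 ?posrE ?exprn_gt0 // expr2 ler_peMr ?(ltW L0) // ler1n.
have := ler_distD (G T) (G f) (E k (fun S => f (normalized k S))).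
have := ler_distD (E k (fun S => T (normalized k S))) (G T) (E k (fun S => f (normalized k S))).
lra.
Unshelve. all: by end_near. Qed.

End central_limit_theorem.

Theorem theorem2 (R : realType) (alpha : R) (halpha : 0 < alpha) :
  (* E[U_j] ~ c_j n1/2 and Var(U_j) = O(n1/2), for j >= 2 ; here n1 = 2k *)
  (forall j : nat, (2 <= j)%N ->
     ((fun k : nat =>
         CMexp (2 * k) (n2of alpha (2 * k)) (fun G => (ncomp j G)%:R)
         / (cj alpha j * k%:R)) @ \oo --> (1 : R))
     /\ (exists C : R, \forall k \near \oo,
           `|CMvar (2 * k) (n2of alpha (2 * k)) (fun G => (ncomp j G)%:R)|
             <= C * k%:R)) /\
  (* E[U_1] ~ alpha/(2(1+alpha)) and Var(U_1) ~ alpha/(2(1+alpha)) *)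
  ((fun k : nat =>
      CMexp (2 * k) (n2of alpha (2 * k)) (fun G => (ncomp 1 G)%:R)
      / (2^-1 * (alpha / (1 + alpha)))) @ \oo --> (1 : R)) /\
  ((fun k : nat =>
      CMvar (2 * k) (n2of alpha (2 * k)) (fun G => (ncomp 1 G)%:R)
      / (2^-1 * (alpha / (1 + alpha)))) @ \oo --> (1 : R)) /\
  (* Gaussian limit of the normalized vector (U_j)_{2<=j<=q}, H(alpha) PSD *)
  (forall q : nat, (2 <= q)%N ->
     (forall x : 'rV[R]_(q.-1), 0 <= (x *m Hmat alpha q *m x^T) ord0 ord0) /\
     (forall A : 'M[R]_(q.-1), A^T *m A = Hmat alpha q ->
      forall f : 'rV[R]_(q.-1) -> R, continuous f ->
      (exists M : R, forall x, `|f x| <= M) ->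
      (fun k : nat =>
         CMexp (2 * k) (n2of alpha (2 * k))
           (fun G => f (\row_(i < q.-1)
               (((ncomp (i + 2) G)%:R - cj alpha (i + 2) * k%:R)
                  / Num.sqrt k%:R))))
        @ \oo --> stdgaussE (fun z => f (z *m A)))) /\
  (* U_1 converges in distribution to Poisson(alpha/(2(1+alpha))) *)
  (forall f : R -> R, continuous f -> (exists M : R, forall x, `|f x| <= M) ->
     (fun k : nat =>
        CMexp (2 * k) (n2of alpha (2 * k)) (fun G => f (ncomp 1 G)%:R))
       @ \oo --> poissonE (2^-1 * (alpha / (1 + alpha))) f).
Proof.
have CME k (Phi : (nat -> R) -> R) :
    CMexp (2 * k) (n2of alpha (2 * k)) (fun G => Phi (fun j => (ncomp j G)%:R)) =
    wmean k (nk alpha k) (fun S => Phi (obs S)).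
  exact: CMexp_wmean.
have CM1 k j : CMexp (2 * k) (n2of alpha (2 * k)) (fun G => (ncomp j G)%:R) =
    wmean k (nk alpha k) (fun S : state R => obs S j).
  exact: (CME k (fun h => h j)).
have CMV k j : CMvar (2 * k) (n2of alpha (2 * k)) (fun G => (ncomp j G)%:R) =
    wmean k (nk alpha k) (fun S : state R => (obs S j - wmean k (nk alpha k) (fun S => obs S j)) ^+ 2).
  rewrite /CMvar CM1; set m := wmean _ _ _.
  exact: (CME k (fun h => (h j - m) ^+ 2)).
have lam0 : 2^-1 * (alpha / (1 + alpha)) != 0.
  by rewrite !mulf_neq0 ?invr_eq0 // gt_eqF // addr_gt0.
split=> [[|[|j]] // _|].
  split.
    apply: (cvg_ext _ (@mean_cvg R alpha halpha j)) => k.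
    by congr (_ / _); rewrite CM1.
  exists (8 * alpha + 2 * (1 + alpha) ^+ 2); exists j.+1 => // k jk.
  rewrite CMV ger0_norm; last by apply: wmean_ge0 => S _; exact: sqr_ge0.
  exact: var_bound.
split.
  apply: (cvg_val (divff lam0)); apply: cvgM; last exact: cvg_cst.
  apply: (cvg_ext _ (@loops_mean_cvg R alpha halpha)) => k.
  by rewrite CM1.
split.
  apply: (cvg_val (divff lam0)); apply: cvgM; last exact: cvg_cst.
  by apply: (cvg_ext _ (@loops_var_cvg R alpha halpha)) => k; rewrite CMV.
split=> [q _|f _ fM]; last first.
  apply: (cvg_ext _ (@loops_poisson R alpha halpha f fM)) => k.
  exact/esym/(CME k (fun h => f (h 1%N))).
have HE : Hmat alpha q = \matrix_(i, j) Hij alpha i.+2 j.+2.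
  by apply/matrixP => i j; rewrite !mxE !addn2.
split=> [x|A AA f cf [M fM]].
  have -> : (x *m Hmat alpha q *m x^T) ord0 ord0 = Hform alpha x; last exact: Hform_ge0.
  rewrite HE mxE /Hform exchange_big /=; apply: eq_bigr => j _; rewrite !mxE mulr_suml.
  by apply: eq_bigr => i _; rewrite !mxE; ring.
rewrite HE in AA; apply: (cvg_ext _ (@gaussian_clt R alpha halpha _ A AA f M cf fM)) => k.
apply/esym; apply: etrans
  (CME k (fun h => f (\row_i ((h (i + 2)%N - cj alpha (i + 2)%N * k%:R) / Num.sqrt k%:R)))) _.
apply: eq_wmean => S _; congr f.
by apply/rowP => i; rewrite !mxE addn2.
Qed.
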